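(* Let $\sigma^2>0$ (with $\sigma>0$). The density of the free unitary normal distribution $\mathfrak N_{\sigma^2}$ with respect to the length measure on $\mathbb T$ is given by $$f_{\sigma^2}(e^{i\theta})=\frac{2}{\pi\sigma^2}\operatorname{Im}\zeta_{\sigma^2/4}\left(\frac{\theta-\pi}{2}\right),\qquad\theta\in[-\pi,\pi).$$ The distribution $\mathfrak N_{\sigma^2}$ is invariant under complex conjugation, meaning that $f_{\sigma^2}(e^{i\theta})=f_{\sigma^2}(e^{-i\theta})$. Moreover: (a) For $\sigma^2>4$, the function $\theta\mapsto f_{\sigma^2}(e^{i\theta})$ is strictly positive and real analytic on $\mathbb R$. (b) For $0<\sigma^2<4$, the function $\theta\mapsto f_{\sigma^2}(e^{i\theta})$ is continuous on its period $[-\pi,\pi]$. It is strictly positive and real-analytic on the interval $(-m_{\sigma^2},+m_{\sigma^2})$, and vanishes on its complement $[-\pi,\pi]\setminus(-m_{\sigma^2},+m_{\sigma^2})$, where $$m_{\sigma^2}:=2\arcsin\frac\sigma2+\frac\sigma2\sqrt{4-\sigma^2}=\int_0^\sigma\sqrt{4-t^2}\,dt.$$ At the points $\pm m_{\sigma^2}$, the function $\theta\mapsto f_{\sigma^2}(e^{i\theta})$ vanishes and has square-root singularities with $$f_{\sigma^2}(e^{i(m_{\sigma^2}-\varepsilon)})=f_{\sigma^2}(e^{i(\varepsilon-m_{\sigma^2})})\sim\frac1{\pi\sigma^2}\sqrt[4]{\frac{4\sigma^2}{4-\sigma^2}}\cdot\sqrt\varepsilon,\qquad\varepsilon\downarrow0.$$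 (c) For $\sigma^2=4$, the function $\theta\mapsto f_{\sigma^2}(e^{i\theta})$ is strictly positive and real-analytic on the interval $(-\pi,\pi)$. At $\theta=\pm\pi$, it vanishes and has cubic-root singularities with $$f_{\sigma^2}(e^{i(\pi-\varepsilon)})=f_{\sigma^2}(e^{i(\varepsilon-\pi)})\sim\frac{\sqrt3}{4\pi}\left(\frac{3\varepsilon}{2}\right)^{1/3},\qquad\varepsilon\downarrow0.$$
   Context: $\mathbb H=\{\theta\in\mathbb C:\operatorname{Im}\theta>0\}$, $\mathbb T=\{|z|=1\}$. $a\sim b$ means that the quotient $a/b$ tends to $1$. The function $\zeta_t$, $t>0$: it is known that for every $\theta\in\mathbb H$ the equation $\zeta-t\tan\zeta=\theta$ has a unique (simple) solution $\zeta=\zeta_t(\theta)$ in $\mathbb H$; the function $\zeta_t:\mathbb H\to\mathbb H$ is analytic, admits a continuous extension to the closed half-plane $\overline{\mathbb H}$ (also denoted $\zeta_t$), and satisfies $\zeta_t(\theta+\pi)=\zeta_t(\theta)+\pi$, $\zeta_t(-\bar\theta)=-\overline{\zeta_t(\theta)}$. For a probability measure $\mu$ on $\mathbb T$, the $\psi$-transform is $\psi_\mu(z)=\int_{\mathbb T}\frac{uz}{1-uz}\mu(du)$, $|z|<1$. If $\psi_\mu'(0)=\int_{\mathbb T} u\,\mu(du)\neq0$, then $\psi_\mu$ has an analytic inverse $\psi_\mu^{-1}$ near $0$ and the $S$-transform is $S_\mu(z)=\frac{1+z}{z}\psi_\mu^{-1}(z)$. The free unitary normal distribution $\mathfrak N_{\sigma^2}$,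 $\sigma^2>0$, is the (unique) probability measure on $\mathbb T$ with $S_{\mathfrak N_{\sigma^2}}(z)=e^{\sigma^2(z+\frac12)}$ for $z$ near $0$. *)

(* Defs.v *)
From HB Require Import structures.
From mathcomp Require Import all_boot all_order all_algebra.
From mathcomp Require Import all_classical all_reals all_analysis.
From mathcomp Require Import complex.
From mathcomp Require Import ring lra.

Set Implicit Arguments.
Unset Strict Implicit.
Unset Printing Implicit Defensive.
Import Order.TTheory GRing.Theory Num.Theory.
Import numFieldNormedType.Exports.

Local Open Scope classical_set_scope.
Local Open Scope ring_scope.
Local Open Scope complex_scope.

(* real-closed does not equip [R[i]] with a topology; this is the one given by
   the modulus. *)
HB.instance Definition _ (R : rcfType) := PseudoPointedMetric.copy R[i] R[i]^o.

(* Being the sum of a power series on a neighbourhood of [x]; used both for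
   [K = R] (real analyticity) and for [K = R[i]] (holomorphy near [x]). *)
Definition analytic_at (K : numFieldType) (g : K -> K) (x : K) : Prop :=
  exists a : nat -> K, \forall h \near (0 : K),
    series (fun k => a k * h ^+ k) @ \oo --> g (x + h).

Definition sim_right0 (R : realType) (a b : R -> R) : Prop :=
  a e / b e @[e --> 0^'+] --> (1 : R).

Section ComplexFunctions.
Variable R : realType.
Implicit Types z : R[i].

Definition cexp z : R[i] :=
  (expR (complex.Re z))%:C * (cos (complex.Im z) +i* sin (complex.Im z)).
Definition csin z : R[i] := (cexp ('i * z) - cexp (- ('i * z))) / (2 * 'i).
Definition ccos z : R[i] := (cexp ('i * z) + cexp (- ('i * z))) / 2.
Definition ctan z : R[i] := csin z / ccos z.

Definition upper_half : set R[i] := [set z | 0 < complex.Im z].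
Definition closed_upper_half : set R[i] := [set z | 0 <= complex.Im z].

(* On the open half-plane [zeta theta] is the unique solution of the equation;
   on the real line it is determined by continuity. *)
Definition is_zeta (t : R) (zeta : R[i] -> R[i]) : Prop :=
  (forall theta, upper_half theta ->
     [set w | upper_half w /\ w - t%:C * ctan w = theta] = [set zeta theta])
  /\ {within closed_upper_half, continuous zeta}.

End ComplexFunctions.

Definition circle (R : realType) : Type :=
  set_type [set z : R[i] | `|z| = 1].

Section Circle.
Variable R : realType.

HB.instance Definition _ := Topological.on (circle R).

Lemma cis_subproof (theta : R) :
  (cos theta +i* sin theta) \in [set z : R[i] | `|z| = 1].
Proof. by rewrite inE /= normc_def /= cos2Dsin2 sqrtr1. Qed.

Definition cis (theta : R) : circle R :=
  exist _ (cos theta +i* sin theta) (cis_subproof theta).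

HB.instance Definition _ := isPointed.Build (circle R) (cis 0).

HB.instance Definition _ :=
  Measurable.copy (circle R) (g_sigma_algebraType (@open (circle R))).

Lemma continuous_cis : continuous cis.
Proof.
apply: (@continuous_comp_initial _ R (R[i] : topologicalType) set_val cis).
move=> x; apply/cvg_ballP => -[a b] /[dup] e0; rewrite ltcE /=.
move=> /andP[/eqP b0 a0]; rewrite {}b0 in e0 *.
have cc : \forall y \near x, `|cos x - cos y| < a / 2.
  by have /cvgrPdist_lt := @continuous_cos R x; apply; exact: divr_gt0.
have cs : \forall y \near x, `|sin x - sin y| < a / 2.
  by have /cvgrPdist_lt := @continuous_sin R x; apply; exact: divr_gt0.
near=> y.
rewrite /ball /= normc_def /= -/(a%:C) ltcR.
have hc : `|cos x - cos y| < a / 2 by near: y.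
have hs : `|sin x - sin y| < a / 2 by near: y.
rewrite -(@ltr_pXn2r _ 2) ?nnegrE ?sqrtr_ge0 ?ltW // sqr_sqrtr; last first.
  by rewrite addr_ge0 ?sqr_ge0.
move: hc hs; rewrite !ltr_norml => /andP[? ?] /andP[? ?].
nra.
Unshelve. all: by end_near. Qed.

Lemma measurable_cis : measurable_fun setT cis.
Proof.
apply: (@measurability _ _ _ _ _ _ (@open (circle R))) => //.
move=> _ [U oU <-]; rewrite setTI; apply: measurable_realfun.open_measurable.
by move/continuousP: continuous_cis; apply.
Qed.

HB.instance Definition _ :=
  isMeasurableFun.Build _ _ _ _ cis measurable_cis.

Definition length_measure : set (circle R) -> \bar R :=
  pushforward
    (mrestr (@lebesgue_measure R) (measurable_itv `[(- pi)%R, pi[)) cis.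

Let length_measure0 : length_measure set0 = 0%E.
Proof. by rewrite /length_measure /pushforward preimage_set0 measure0. Qed.

Let length_measure_ge0 A : (0 <= length_measure A)%E.
Proof. exact: (@measure_ge0 _ _ _ (mrestr lebesgue_measure _)). Qed.

Let length_measure_sigma_additive : semi_sigma_additive length_measure.
Proof.
pose m : {measure set (measurableTypeR R) -> \bar R} :=
  mrestr (@lebesgue_measure R) (measurable_itv `[(- pi)%R, pi[).
pose n : {measure set (circle R) -> \bar R} :=
  measure_function_pushforward__canonical__measure_function_Measure
    m measurable_cis.
exact: (@measure_semi_sigma_additive _ _ _ n).
Qed.

HB.instance Definition _ := isMeasure.Build _ _ _ length_measure
  length_measure0 length_measure_ge0 length_measure_sigma_additive.

Definition is_density (mu : set (circle R) -> \bar R) (f : circle R -> R) :=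
  [/\ measurable_fun setT f, (forall u, 0 <= f u) &
      forall A, measurable A ->
        mu A = (\int[length_measure]_(u in A) (f u)%:E)%E].

Definition cintegral (mu : set (circle R) -> \bar R) (g : circle R -> R[i]) :
    R[i] :=
  fine (\int[mu]_u (complex.Re (g u))%:E)%E +i*
  fine (\int[mu]_u (complex.Im (g u))%:E)%E.

Definition psi (mu : probability (circle R) R) (z : R[i]) : R[i] :=
  cintegral mu (fun u => set_val u * z / (1 - set_val u * z)).

Definition mean (mu : probability (circle R) R) : R[i] :=
  cintegral mu set_val.

(* [chi] represents the germ at 0 of the compositional inverse of [psi mu]. *)
Definition is_psi_inverse (mu : probability (circle R) R)
    (chi : R[i] -> R[i]) : Prop :=
  [/\ analytic_at chi 0, chi 0 = 0,
      \forall z \near (0 : R[i]), psi mu (chi z) = z &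
      \forall z \near (0 : R[i]), chi (psi mu z) = z].

(* [S] represents the germ of the S-transform; the point 0 is a removable
   singularity of the defining formula, hence the deleted neighbourhood. *)
Definition is_S_transform (mu : probability (circle R) R)
    (S : R[i] -> R[i]) : Prop :=
  mean mu != 0 /\
  exists2 chi, is_psi_inverse mu chi &
    \forall z \near (0 : R[i])^', S z = (1 + z) / z * chi z.

Definition free_unitary_normal (s2 : R) (mu : probability (circle R) R) :=
  is_S_transform mu (fun z => cexp (s2%:C * (z + 2^-1))).

(* [m_{sigma^2}], the right end of the arc carrying the measure when
   [sigma < 2]. *)
Definition edge (sigma : R) : R :=
  2 * asin (sigma / 2) + sigma / 2 * Num.sqrt (4 - sigma ^+ 2).

End Circle.

(* Main.v *)
Require Import Defs.
From HB Require Import structures.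
From mathcomp Require Import all_boot all_order all_algebra.
From mathcomp Require Import all_classical all_reals all_analysis.
From mathcomp Require Import complex measurable_realfun.
From mathcomp Require Import ring lra.
Set Implicit Arguments.
Unset Strict Implicit.
Unset Printing Implicit Defensive.
Import Order.TTheory GRing.Theory Num.Theory.
Import numFieldNormedType.Exports.
Local Open Scope classical_set_scope.
Local Open Scope ring_scope.
Local Open Scope complex_scope.

(** The formula for the S-transform is a functional equation for [psi] near 0;
    in terms of the moments it is a recursion, which propagates the equation to
    the whole disc.  Consequently [theta + i t (1 + 2 psi (- e^{2 i theta}))]
    solves the equation defining [zeta theta], and [Im zeta] is [Im theta] plus
    [t] times the Poisson integral of [mu].  Its boundary values being
    continuous, dominated convergence and Fubini's theorem show that the
    measure with the asserted density has mass 1 and dominates [mu] on open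
    sets; hence it is [mu].

    Where [Im zeta > 0], [tan zeta] belongs to the solution of a polynomial
    differential system, whose power series has geometrically bounded
    coefficients; this gives analyticity.  The support and the behaviour at
    its ends come from the real and imaginary parts of
    [t tan zeta = zeta - theta]. *)

(** Analytic identities are propagated along real segments: a defect [y] with [y' = c y], [c]
    bounded and [y = 0] at one end vanishes at the other. This is why power series carry bounds
    [M * q ^+ n] with [q < 1]: their sums are then differentiable up to the end [s = 1] of the
    segment. The functional equation of psi contains an exponential, but its logarithmic derivative
    is polynomial in psi and its derivative; hence the recursion for the moments. For zeta, the
    derivative dzeta / dtheta = 1 / (1 - t - t tan^2 zeta) is adjoined as an unknown, and further
    products are adjoined until the system is quadratic, so that bounding coefficients amounts to
    bounding Cauchy products. The denominator is nonzero because the root is simple. Since zeta is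
    characterised only above the real axis, real points are always reached from above, by
    continuity. The ends of the support come from the critical points of x - t tan x, where cos^2 x
    = t = sigma^2 / 4. At sigma = 2 the two critical points nearest 0 merge, which turns the square
    root into a cubic root. *)

Local Notation Re := complex.Re.
Local Notation Im := complex.Im.
Local Notation normc := Normc.normc.

(** * Complex numbers in coordinates: modulus, exponential, sine and cosine *)

Section ComplexBasics.
Variable R : realType.
Implicit Types (x y s : R) (z w : R[i]).

Lemma ReD z w : Re (z + w) = Re z + Re w. Proof. by case: z w => ? ? []. Qed.
Lemma ImD z w : Im (z + w) = Im z + Im w. Proof. by case: z w => ? ? []. Qed.
Lemma ReN z : Re (- z) = - Re z. Proof. by case: z. Qed.
Lemma ImN z : Im (- z) = - Im z. Proof. by case: z. Qed.
Lemma ReM z w : Re (z * w) = Re z * Re w - Im z * Im w.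
Proof. by case: z w => ? ? []. Qed.
Lemma ImM z w : Im (z * w) = Re z * Im w + Im z * Re w.
Proof. by case: z w => ? ? []. Qed.
Lemma Re1 : Re (1 : R[i]) = 1. Proof. by []. Qed.
Lemma Im1 : Im (1 : R[i]) = 0. Proof. by []. Qed.
Lemma Re0 : Re (0 : R[i]) = 0. Proof. by []. Qed.
Lemma Im0 : Im (0 : R[i]) = 0. Proof. by []. Qed.
Lemma Rei : Re ('i : R[i]) = 0. Proof. by []. Qed.
Lemma Imi : Im ('i : R[i]) = 1. Proof. by []. Qed.
Lemma Re_real x : Re x%:C = x. Proof. by []. Qed.
Lemma Im_real x : Im x%:C = 0. Proof. by []. Qed.
Lemma Re_mk x y : Re (x +i* y) = x. Proof. by []. Qed.
Lemma Im_mk x y : Im (x +i* y) = y. Proof. by []. Qed.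
Definition ReImE := (Re_mk, Im_mk, ReD, ImD, ReN, ImN, ReM, ImM, Re1, Im1, Re0, Im0, Rei, Imi,
  Re_real, Im_real).

Lemma natC n : (n%:R : R[i]) = (n%:R : R)%:C.
Proof. by rewrite rmorph_nat. Qed.

Lemma ReV_nat z n : Re (z / n%:R) = Re z / n%:R.
Proof. by rewrite natC -fmorphV ReM Im_real mulr0 subr0. Qed.
Lemma ImV_nat z n : Im (z / n%:R) = Im z / n%:R.
Proof. by rewrite natC -fmorphV ImM Im_real mulr0 add0r. Qed.
Lemma Re_nat n : Re (n%:R : R[i]) = n%:R. Proof. by rewrite natC. Qed.
Lemma Im_nat n : Im (n%:R : R[i]) = 0. Proof. by rewrite natC. Qed.

Lemma Re_sum (I : Type) (r : seq I) (P : pred I) (F : I -> R[i]) :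
  Re (\sum_(i <- r | P i) F i) = \sum_(i <- r | P i) Re (F i).
Proof. exact: (big_morph _ ReD Re0). Qed.
Lemma Im_sum (I : Type) (r : seq I) (P : pred I) (F : I -> R[i]) :
  Im (\sum_(i <- r | P i) F i) = \sum_(i <- r | P i) Im (F i).
Proof. exact: (big_morph _ ImD Im0). Qed.

Lemma complex_eqP z w : Re z = Re w -> Im z = Im w -> z = w.
Proof. by case: z w => a b [c d] /= -> ->. Qed.

Lemma ii : 'i * 'i = -1 :> R[i]. Proof. by rewrite -expr2 sqr_i. Qed.
Lemma i_neq0 : ('i : R[i]) != 0.
Proof. by apply/eqP => /(congr1 (@complex.Im R)) /= /eqP; rewrite oner_eq0. Qed.

Lemma normcM z w : normc (z * w) = normc z * normc w.
Proof. exact: Normc.normcM. Qed.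
Lemma normcV z : normc z^-1 = (normc z)^-1.
Proof. exact: Normc.normcV. Qed.
Lemma normc0 : normc (0 : R[i]) = 0. Proof. exact: Normc.normc0. Qed.
Lemma normc1 : normc (1 : R[i]) = 1. Proof. exact: Normc.normc1. Qed.
Lemma normcN z : normc (- z) = normc z.
Proof. by case: z => a b; rewrite /= !sqrrN. Qed.
Lemma normcD z w : normc (z + w) <= normc z + normc w.
Proof. exact: (le_normcD z w). Qed.
Lemma normc_sqr z : normc z ^+ 2 = Re z ^+ 2 + Im z ^+ 2.
Proof. by case: z => a b; rewrite /Normc.normc sqr_sqrtr// addr_ge0// sqr_ge0. Qed.
Lemma normc_ge0 z : 0 <= normc z.
Proof. by case: z => a b; rewrite /Normc.normc sqrtr_ge0. Qed.
Lemma normc_norm z : `|z| = (normc z)%:C.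
Proof. by case: z => a b; rewrite normc_def. Qed.
Lemma Re_normc z : `|Re z| <= normc z.
Proof.
rewrite -(@ler_pXn2r _ 2) ?nnegrE ?normc_ge0 // normc_sqr -normrX.
by rewrite ger0_norm ?sqr_ge0// lerDl sqr_ge0.
Qed.
Lemma Im_normc z : `|Im z| <= normc z.
Proof.
rewrite -(@ler_pXn2r _ 2) ?nnegrE ?normc_ge0 // normc_sqr -normrX.
by rewrite ger0_norm ?sqr_ge0// lerDr sqr_ge0.
Qed.
Lemma normc_real x : normc x%:C = `|x|.
Proof. by rewrite /= expr0n addr0 sqrtr_sqr. Qed.
Lemma normc_i : normc ('i : R[i]) = 1.
Proof. by rewrite /= expr0n add0r expr1n sqrtr1. Qed.
Lemma normc_le_ReIm z : normc z <= `|Re z| + `|Im z|.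
Proof.
rewrite [in leLHS](complexE z) (le_trans (normcD _ _))// normcM normc_i mul1r.
by rewrite !normc_real.
Qed.
Lemma normcX z n : normc (z ^+ n) = normc z ^+ n.
Proof.
elim: n => [|n IH]; first by rewrite !expr0 normc1.
by rewrite !exprS normcM IH.
Qed.
Lemma normc_eq0 z : (normc z == 0) = (z == 0).
Proof.
apply/eqP/eqP => [/(@Normc.eq0_normc R) //|->]; exact: normc0.
Qed.
Lemma normc_gt0 z : (0 < normc z) = (z != 0).
Proof. by rewrite lt_def normc_ge0 andbT normc_eq0. Qed.
Lemma normcB z w : normc (z - w) = normc (w - z).
Proof. by rewrite -normcN opprB. Qed.
Lemma normc_sum (I : Type) (r : seq I) (P : pred I) (F : I -> R[i]) :
  normc (\sum_(i <- r | P i) F i) <= \sum_(i <- r | P i) normc (F i).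
Proof.
elim/big_ind2 : _ => [|x1 x2 y1 y2 h1 h2|//]; first by rewrite normc0.
exact: (le_trans (normcD _ _) (lerD _ _)).
Qed.

Lemma near0_normc (P : R[i] -> Prop) :
  (\forall z \near (0 : R[i]), P z) -> exists2 d : R, 0 < d & forall z, normc z < d -> P z.
Proof.
move=> /nbhs_ballP[[a b]]; rewrite /= ltcE /= => /andP[/eqP -> a0] h.
exists a => // z za; apply: h; rewrite /ball /= sub0r normrN normc_norm.
by rewrite -/(a%:C) ltcR.
Qed.

Lemma near0'_normc (P : R[i] -> Prop) :
  (\forall z \near (0 : R[i])^', P z) ->
  exists2 d : R, 0 < d & forall z, normc z < d -> z != 0 -> P z.
Proof. by move=> /near0_normc[d d0 h]; exists d. Qed.

Lemma within_continuous_normc (A : set R[i]) (f : R[i] -> R[i]) z (e : R) :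
  {within A, continuous f} -> A z -> 0 < e ->
  exists2 d : R, 0 < d & forall w, A w -> normc (w - z) < d -> normc (f w - f z) < e.
Proof.
move=> /subspace_continuousP /(_ z) + Az e0 => /(_ Az).
have eC : 0 < e%:C :> R[i] by rewrite ltcR.
move=> /cvg_ballP /(_ _ eC) /nbhs_ballP[[a b]].
rewrite /= ltcE /= => /andP[/eqP -> a0] h.
exists a => // w Aw wza; have := h w.
rewrite /ball /= !normc_norm !(normcB _ w) !(normcB (f z)) !ltcR; exact.
Qed.

Lemma Re_cexp z : Re (cexp z) = expR (Re z) * cos (Im z).
Proof. by rewrite /cexp !ReImE /= mul0r subr0. Qed.
Lemma Im_cexp z : Im (cexp z) = expR (Re z) * sin (Im z).
Proof. by rewrite /cexp !ReImE /= mul0r addr0. Qed.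
Lemma cexpD z w : cexp (z + w) = cexp z * cexp w.
Proof.
by apply: complex_eqP; rewrite !(ReM, ImM, Re_cexp, Im_cexp) !(ReD, ImD) expRD ?cosD ?sinD; ring.
Qed.
Lemma cexp0 : cexp 0 = 1 :> R[i].
Proof. by rewrite /cexp /= expR0 cos0 sin0; apply: complex_eqP; rewrite !ReImE /= ; ring. Qed.
Lemma cexp_neq0 z : cexp z != 0.
Proof.
apply/eqP => h; have := cexpD z (- z); rewrite subrr cexp0 h mul0r => /eqP.
by rewrite oner_eq0.
Qed.
Lemma cexpN z : cexp (- z) = (cexp z)^-1.
Proof.
by apply: (mulfI (cexp_neq0 z)); rewrite -cexpD subrr cexp0 divff// cexp_neq0.
Qed.
Lemma normc_cexp z : normc (cexp z) = expR (Re z).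
Proof.
have h : normc (cexp z) ^+ 2 = expR (Re z) ^+ 2.
  by rewrite normc_sqr Re_cexp Im_cexp !exprMn -mulrDr cos2Dsin2 mulr1.
by move/eqP: h; rewrite eqrXn2 ?normc_ge0 ?expR_ge0// => /eqP.
Qed.

Definition sh y := (expR y - expR (- y)) / 2.
Definition ch y := (expR y + expR (- y)) / 2.

Lemma ch2_sh2 y : ch y ^+ 2 = 1 + sh y ^+ 2.
Proof.
have := expRxMexpNx_1 y; rewrite /ch /sh => h.
apply/eqP; rewrite -subr_eq0; apply/eqP.
transitivity (expR y * expR (- y) - 1); first by field.
by rewrite h subrr.
Qed.

Lemma csinE z : csin z =
  (sin (Re z) * ch (Im z)) +i* (cos (Re z) * sh (Im z)).
Proof.
have i2 : 2 * 'i != 0 :> R[i] by rewrite mulf_neq0 ?i_neq0 ?pnatr_eq0.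
rewrite /csin; apply: (mulIf i2); rewrite divfK//.
by apply: complex_eqP; rewrite !(ReImE, Re_nat, Im_nat, Re_cexp, Im_cexp);
  rewrite !(mul0r, mul1r, add0r, sub0r) !(sinN, cosN, opprK) /ch /sh; field.
Qed.

Lemma ccosE z : ccos z =
  (cos (Re z) * ch (Im z)) -i* (sin (Re z) * sh (Im z)).
Proof.
rewrite /ccos; apply: complex_eqP; rewrite ?ReV_nat ?ImV_nat;
  rewrite !(ReImE, Re_nat, Im_nat, Re_cexp, Im_cexp);
  by rewrite !(mul0r, mul1r, add0r, sub0r) !(sinN, cosN, opprK) /ch /sh; field.
Qed.

(** This is the common denominator of the real and imaginary parts of tan (x + i y); it is positive
    off the real axis. *)
Lemma normc_ccos z : normc (ccos z) ^+ 2 = cos (Re z) ^+ 2 + sh (Im z) ^+ 2.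
Proof.
rewrite normc_sqr ccosE !ReImE; have := ch2_sh2 (Im z).
have := cos2Dsin2 (Re z); move: (ch _) (sh _) (cos _) (sin _) => a b c d h1 h2.
have -> : c ^+ 2 + b ^+ 2 = c ^+ 2 + b ^+ 2 * (c ^+ 2 + d ^+ 2) by rewrite h1 mulr1.
by rewrite exprMn sqrrN exprMn h2; ring.
Qed.
End ComplexBasics.

(** * Calculus of real derivatives *)

Section RealDerivatives.
Variable R : realType.
Implicit Types (f g : R -> R) (x a b : R).

Lemma drvD f g x a b : is_derive x (1 : R) f a -> is_derive x (1 : R) g b ->
  is_derive x (1 : R) (fun s => f s + g s) (a + b).
Proof. by move=> fa gb; exact: is_deriveD. Qed.
Lemma drvB f g x a b : is_derive x (1 : R) f a -> is_derive x (1 : R) g b ->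
  is_derive x (1 : R) (fun s => f s - g s) (a - b).
Proof. by move=> fa gb; exact: is_deriveB. Qed.
Lemma drvN f x a : is_derive x (1 : R) f a -> is_derive x (1 : R) (fun s => - f s) (- a).
Proof. by move=> fa; exact: is_deriveN. Qed.
Lemma drvM f g x a b : is_derive x (1 : R) f a -> is_derive x (1 : R) g b ->
  is_derive x (1 : R) (fun s => f s * g s) (a * g x + f x * b).
Proof.
move=> fa gb; have := is_deriveM fa gb => h; apply: (is_derive_eq h).
by rewrite addrC /GRing.scale/= mulrC.
Qed.
Lemma drv_comp f g x a b : is_derive (g x) (1 : R) f a -> is_derive x (1 : R) g b ->
  is_derive x (1 : R) (fun s => f (g s)) (b * a).
Proof. by move=> fa gb; rewrite mulrC; exact: (@is_derive1_comp _ f g). Qed.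
Lemma drv_eq f x a b : is_derive x (1 : R) f a -> a = b -> is_derive x (1 : R) f b.
Proof. by move=> ? <-. Qed.

Lemma drv_cst x a : is_derive x (1 : R) (fun=> a) 0. Proof. exact: is_derive_cst. Qed.
Lemma drv_id x : is_derive x (1 : R) (fun s => s) 1. Proof. exact: is_derive_id. Qed.
Lemma drvZ f x k a : is_derive x (1 : R) f a -> is_derive x (1 : R) (fun s => k * f s) (k * a).
Proof. by move=> fa; exact: is_deriveZ. Qed.

Lemma drv_nincr f df (a b : R) :
  (forall x, a <= x <= b -> is_derive x (1 : R) f (df x)) ->
  (forall x, a <= x <= b -> df x <= 0) -> a <= b -> f b <= f a.
Proof.
move=> h h0 ab.
apply: (@ler0_derive1_le_cc _ f a b) => //; rewrite ?in_itv/= ?lexx ?ab//.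
- move=> x; rewrite in_itv/= => /andP[ax xb].
  by apply: ex_derive; apply: h; rewrite !ltW.
- move=> x; rewrite in_itv/= => /andP[ax xb].
  have xab : a <= x <= b by rewrite !ltW.
  by rewrite derive1E; have ? := h _ xab; rewrite derive_val; exact: h0.
- apply: derivable_within_continuous => x; rewrite in_itv/= => xab.
  by apply: ex_derive; apply: h.
Qed.
End RealDerivatives.

(** * Complex functions of a real variable and linear differential equations *)

Section ComplexDerivative.
Variable R : realType.
Implicit Types (f g : R -> R[i]) (x a b : R) (k l : R[i]).

(** Differentiation is only ever along real segments; taken componentwise, each rule reduces to its
    real counterpart. *)
Definition cder f x l :=
  is_derive x (1 : R) (fun s => Re (f s)) (Re l) /\
  is_derive x (1 : R) (fun s => Im (f s)) (Im l).

Lemma cder_eq f x k l : cder f x k -> k = l -> cder f x l.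
Proof. by move=> ? <-. Qed.

Lemma cder_cst k x : cder (fun=> k) x 0.
Proof. by split; exact: is_derive_cst. Qed.

Lemma cder_id x : cder (fun s => s%:C) x 1.
Proof. by split; [exact: is_derive_id | exact: is_derive_cst]. Qed.

Lemma cderD f g x k l : cder f x k -> cder g x l ->
  cder (fun s => f s + g s) x (k + l).
Proof.
move=> [? ?] [? ?]; split.
  by under eq_fun do rewrite ReD; rewrite ReD; exact: drvD.
by under eq_fun do rewrite ImD; rewrite ImD; exact: drvD.
Qed.

Lemma cderN f x k : cder f x k -> cder (fun s => - f s) x (- k).
Proof.
move=> [? ?]; split.
  by under eq_fun do rewrite ReN; rewrite ReN; exact: drvN.
by under eq_fun do rewrite ImN; rewrite ImN; exact: drvN.
Qed.

Lemma cderB f g x k l : cder f x k -> cder g x l ->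
  cder (fun s => f s - g s) x (k - l).
Proof. by move=> fk gl; apply: cderD => //; exact: cderN. Qed.

Lemma cderM f g x k l : cder f x k -> cder g x l ->
  cder (fun s => f s * g s) x (k * g x + f x * l).
Proof.
move=> [? ?] [? ?]; split.
  under eq_fun do rewrite ReM; refine (drv_eq (drvB (drvM _ _) (drvM _ _)) _).
  by rewrite !ReImE; ring.
under eq_fun do rewrite ImM; refine (drv_eq (drvD (drvM _ _) (drvM _ _)) _).
by rewrite !ReImE; ring.
Qed.

Lemma cderZ c f x k : cder f x k -> cder (fun s => c * f s) x (c * k).
Proof.
move=> fk; apply: cder_eq; first by apply: cderM; [exact: cder_cst|exact: fk].
by rewrite mul0r add0r.
Qed.

Lemma cder_cexp f x k : cder f x k -> cder (fun s => cexp (f s)) x (k * cexp (f x)).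
Proof.
move=> [? ?]; split.
  under eq_fun do rewrite Re_cexp; refine (drv_eq (drvM (drv_comp _ _) (drv_comp _ _)) _).
  by rewrite !(ReM, ImM, Re_cexp, Im_cexp); ring.
under eq_fun do rewrite Im_cexp; refine (drv_eq (drvM (drv_comp _ _) (drv_comp _ _)) _).
by rewrite !(ReM, ImM, Re_cexp, Im_cexp); ring.
Qed.

(* Gronwall: [|y|^2 exp(-2Cs)] is nonincreasing. *)
Lemma cder_linear_eq0 (y c : R -> R[i]) (C a b : R) :
  (forall s, a <= s <= b -> cder y s (c s * y s)) ->
  (forall s, a <= s <= b -> Re (c s) <= C) ->
  y a = 0 -> a <= b -> y b = 0.
Proof.
move=> hy hc ya ab.
pose g s := (Re (y s) * Re (y s) + Im (y s) * Im (y s)) * expR (- (2 * C) * s).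
pose dg s := 2 * (Re (c s) - C) * ((Re (y s)) ^+ 2 + (Im (y s)) ^+ 2) * expR (- (2 * C) * s).
have dgP s : a <= s <= b -> is_derive s (1 : R) g (dg s).
  move=> /hy[h1 h2]; refine (drv_eq (drvM (drvD (drvM h1 h1) (drvM h2 h2))
    (drv_comp (is_derive_expR _) (drvZ _ (drv_id _)))) _).
  by rewrite /dg !(ReM, ImM) mulr1; ring.
have gab : g b <= g a.
  apply: (drv_nincr dgP) => // s sab.
  rewrite /dg mulr_le0_ge0 ?expR_ge0// mulr_le0_ge0 ?addr_ge0 ?sqr_ge0//.
  by rewrite mulr_ge0_le0// subr_le0 hc.
move: gab; rewrite {2}/g ya !mul0r addr0 mul0r /g pmulr_lle0 ?expR_gt0//.
rewrite -!expr2 => h.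
have /eqP : Re (y b) ^+ 2 + Im (y b) ^+ 2 = 0.
  by apply/eqP; rewrite eq_le h addr_ge0 ?sqr_ge0.
rewrite paddr_eq0 ?sqr_ge0// !sqrf_eq0 => /andP[/eqP h1 /eqP h2].
exact: complex_eqP.
Qed.

End ComplexDerivative.

(** * Real series with geometric bounds *)

Section GeometricBounds.
Variable R : realType.
Implicit Types (q r M x : R) (u : nat -> R).

(** Each of the n + 1 powers r^i with i <= n is at least r^n, and their sum is (1 - r^(n+1)) / (1 -
    r). *)
Lemma natr_geo_le r n : 0 <= r < 1 -> n.+1%:R * r ^+ n <= (1 - r)^-1.
Proof.
move=> /andP[r0 r1]; rewrite -[leRHS]mul1r ler_pdivlMr ?subr_gt0//.
suff : n.+1%:R * r ^+ n * (1 - r) <= 1 - r ^+ n.+1.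
  by move/le_trans; apply; rewrite gerBl exprn_ge0.
rewrite -[X in X - _ ^+ _](expr1n _ n.+1) subrXX mulrC; apply: ler_wpM2l; first by rewrite subr_ge0 ltW.
rewrite mulr_natl -[n.+1 in leLHS]card_ord -sumr_const; apply: ler_sum => i _.
rewrite expr1n mul1r; apply: (@ler_wiXn2l _ r) => //; first exact: ltW.
by rewrite -ltnS.
Qed.

(** A factor n + 1, as produced by a derivative or a Cauchy product, is absorbed by enlarging the
    ratio: the previous bound is applied to q / r. *)
Lemma natr_geo_dom q r : 0 <= q -> q < r -> exists2 K, 0 <= K &
  forall n, n.+1%:R * q ^+ n <= K * r ^+ n.
Proof.
move=> q0 qr; have r0 : 0 < r by apply: le_lt_trans qr.
have qr1 : 0 <= q / r < 1 by rewrite divr_ge0 ?(ltW r0)//= ltr_pdivrMr// mul1r.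
exists (1 - q / r)^-1; first by rewrite invr_ge0 subr_ge0 ltW//; case/andP: qr1.
move=> n; have := natr_geo_le n qr1.
by rewrite expr_div_n mulrA ler_pdivrMr// exprn_gt0.
Qed.

Lemma le_geo_eq0 q M x : 0 <= q < 1 -> (forall n, x <= M * q ^+ n) -> x <= 0.
Proof.
move=> /andP[q0 q1] h.
have hc : (geometric M q @ \oo --> 0) by apply: cvg_geometric; rewrite ger0_norm.
rewrite -(cvg_lim (@norm_hausdorff _ _) hc); apply: limr_ge.
  by apply/cvg_ex; exists 0.
by apply: nearW => n; exact: h.
Qed.

Lemma geo_tail u q M : 0 <= q < 1 -> 0 <= M -> (forall n, `|u n| <= M * q ^+ n) ->
  cvgn (series u) /\ forall n, `|limn (series u) - series u n| <= M * q ^+ n / (1 - q).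
Proof.
move=> /andP[q0 q1] M0 h.
have q'0 : 0 < 1 - q by rewrite subr_gt0.
have cu : cvgn (series u).
  apply: normed_cvg; apply: (@series_le_cvg _ _ (geometric M q)) => //=.
  - by move=> n; rewrite mulr_ge0// exprn_ge0.
  - by apply: is_cvg_geometric_series; rewrite ger0_norm.
split=> // n.
have step m : `|series u (n + m)%N - series u n| <= M * q ^+ n * (1 - q ^+ m) / (1 - q).
  elim: m => [|m IH]; first by rewrite addn0 subrr normr0 expr0 subrr mulr0 mul0r.
  rewrite addnS seriesSr /=.
  rewrite addrAC (le_trans (ler_normD _ _))// (le_trans (lerD IH (h _)))//.
  rewrite exprD exprS -(ler_pM2r q'0) mulrDl !divfK ?gt_eqF//.
  by rewrite le_eqVlt; apply/orP; left; apply/eqP; ring.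
have hl : (fun m => `|series u m - series u n|) @ \oo --> `|limn (series u) - series u n|.
  by apply: cvg_norm; apply: cvgB => //; exact: cvg_cst.
rewrite -(cvg_lim (@norm_hausdorff _ _) hl); apply: limr_le.
  by apply/cvg_ex; exists `|limn (series u) - series u n|.
exists n => // m /= nm; rewrite -(subnKC nm) (le_trans (step _))//.
rewrite ler_pM2r ?invr_gt0// -[leRHS]mulr1 ler_wpM2l ?mulr_ge0 ?exprn_ge0//.
by rewrite gerBl exprn_ge0.
Qed.

Lemma cvgn_pseries_geo u q M K : 0 <= q -> 0 <= M -> 0 <= K -> q * K < 1 ->
  (forall n, `|u n| <= M * q ^+ n) -> cvgn (pseries u K).
Proof.
move=> q0 M0 K0 qK h.
have qK1 : 0 <= q * K < 1 by rewrite mulr_ge0.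
suff b n : `|u n * K ^+ n| <= M * (q * K) ^+ n by have [] := geo_tail qK1 M0 b.
by rewrite normrM normrX (ger0_norm K0) exprMn mulrA ler_wpM2r ?exprn_ge0.
Qed.
End GeometricBounds.

Lemma geo_le (R : realType) (M q r : R) n : 0 <= q <= r -> 0 <= M ->
  M * q ^+ n <= M * r ^+ n.
Proof.
move=> /andP[q0 qr] M0; apply: ler_wpM2l => //.
by apply: lerXn2r => //; rewrite nnegrE// (le_trans q0).
Qed.

(** * Complex power series on [-1, 1]: algebra and differentiation *)

Section PowerSeries.
Variable R : realType.
Implicit Types (c d : nat -> R[i]) (s q M : R).

(** The ratio is strictly below 1, so the radius of convergence exceeds 1 and the end s = 1 of the
    segment is an interior point. *)
Definition geo_bounded c := exists q M : R,
  [/\ 0 <= q, q < 1, 0 <= M & forall n, normc (c n) <= M * q ^+ n].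

Definition psum c s : R[i] :=
  limn (pseries (fun n => Re (c n)) s) +i* limn (pseries (fun n => Im (c n)) s).

Definition ppart c n s : R[i] := \sum_(0 <= k < n) c k * s%:C ^+ k.

Definition conv c d n : R[i] := \sum_(i < n.+1) c i * d (n - i)%N.

Definition dser c n : R[i] := n.+1%:R * c n.+1.

Lemma Re_realM z s : Re (z * s%:C) = Re z * s.
Proof. by rewrite ReM Im_real mulr0 subr0. Qed.
Lemma Im_realM z s : Im (z * s%:C) = Im z * s.
Proof. by rewrite ImM Im_real mulr0 add0r. Qed.
Lemma Re_ppart c n s : Re (ppart c n s) = pseries (fun n => Re (c n)) s n.
Proof. by rewrite Re_sum; apply: eq_bigr => i _; rewrite -rmorphXn Re_realM. Qed.
Lemma Im_ppart c n s : Im (ppart c n s) = pseries (fun n => Im (c n)) s n.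
Proof. by rewrite Im_sum; apply: eq_bigr => i _; rewrite -rmorphXn Im_realM. Qed.

Lemma psum_tail c q M s : 0 <= q < 1 -> 0 <= M ->
  (forall n, normc (c n) <= M * q ^+ n) -> `|s| <= 1 ->
  forall n, normc (psum c s - ppart c n s) <= 2 * M * q ^+ n / (1 - q).
Proof.
move=> q01 M0 h s1 n.
have hs m x : `|x| <= normc (c m) -> `|x * s ^+ m| <= M * q ^+ m.
  move=> xc; rewrite normrM normrX -[leRHS]mulr1 ler_pM ?exprn_ge0 ?exprn_ile1//.
  exact: le_trans xc (h _).
have [_ /(_ n) h1] := geo_tail q01 M0 (fun m => hs m _ (Re_normc (c m))).
have [_ /(_ n) h2] := geo_tail q01 M0 (fun m => hs m _ (Im_normc (c m))).
rewrite (le_trans (normc_le_ReIm _))// ReD ReN ImD ImN Re_ppart Im_ppart.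
by rewrite (le_trans (lerD h1 h2))// -!mulrA mulr_natl mulr2n.
Qed.

(** Operations on series are proved through this criterion: the expected value is compared with the
    partial sums, and a geometric error identifies it. The larger of the two ratios serves for both
    errors. *)
Lemma psum_unique c s L q M : geo_bounded c -> `|s| <= 1 -> 0 <= q < 1 ->
  (forall n, normc (L - ppart c n s) <= M * q ^+ n) -> L = psum c s.
Proof.
move=> [p [K [p0 p1 K0 hc]]] s1 /andP[q0 q1] h.
have p01 : 0 <= p < 1 by rewrite p0.
pose r := Num.max p q.
have r01 : 0 <= r < 1 by rewrite le_max p0/= gt_max p1.
have M0 : 0 <= M by have := h 0%N; rewrite expr0 mulr1; exact: le_trans (normc_ge0 _).
apply/eqP; rewrite -subr_eq0 -normc_eq0 eq_le normc_ge0 andbT.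
apply: (@le_geo_eq0 _ r (M + 2 * K / (1 - p))) => // n.
rewrite -(subrK (ppart c n s) L) -addrA (le_trans (normcD _ _))// mulrDl lerD//.
  by rewrite (le_trans (h n))// geo_le// q0 le_max lexx orbT.
rewrite normcB (le_trans (psum_tail p01 K0 hc s1 n))//.
rewrite mulrAC geo_le ?p0 ?le_max ?lexx//.
by rewrite divr_ge0 ?mulr_ge0 ?subr_ge0// ltW.
Qed.

Lemma geo_bounded2 c d : geo_bounded c -> geo_bounded d ->
  exists q M : R, [/\ 0 <= q < 1, 0 <= M, forall n, normc (c n) <= M * q ^+ n &
    forall n, normc (d n) <= M * q ^+ n].
Proof.
move=> [p [K [p0 p1 K0 hc]]] [q [M [q0 q1 M0 hd]]].
exists (Num.max p q), (Num.max K M); split.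
- by rewrite le_max p0 gt_max p1.
- by rewrite le_max K0.
- move=> n; rewrite (le_trans (hc n))// (le_trans (@geo_le _ _ _ (Num.max p q) n _ _))// ?p0 ?le_max ?lexx//.
  by apply: ler_wpM2r; rewrite ?exprn_ge0 ?le_max ?p0 ?lexx.
- move=> n; rewrite (le_trans (hd n))// (le_trans (@geo_le _ _ _ (Num.max p q) n _ _))// ?q0 ?le_max ?lexx ?orbT//.
  by apply: ler_wpM2r; rewrite ?exprn_ge0 ?le_max ?p0 ?lexx ?orbT.
Qed.

Lemma geo_boundedD c d : geo_bounded c -> geo_bounded d ->
  geo_bounded (fun n => c n + d n).
Proof.
move=> hc hd; have [q [M [/andP[q0 q1] M0 {}hc {}hd]]] := geo_bounded2 hc hd.
exists q, (M + M); split=> //; first exact: addr_ge0.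
by move=> n; rewrite (le_trans (normcD _ _))// mulrDl lerD.
Qed.

Lemma geo_boundedZ k c : geo_bounded c -> geo_bounded (fun n => k * c n).
Proof.
move=> [p [K [p0 p1 K0 hc]]]; exists p, (normc k * K); split=> //.
  by rewrite mulr_ge0 ?normc_ge0.
by move=> n; rewrite normcM -mulrA ler_wpM2l ?normc_ge0.
Qed.

Lemma geo_bounded_natr c (k : nat -> R[i]) : geo_bounded c ->
  (forall n, normc (k n) <= n.+1%:R) -> geo_bounded (fun n => k n * c n).
Proof.
move=> [p [K [p0 p1 K0 hc]]] hk.
have p2 : p < (1 + p) / 2 by lra.
have [A A0 hA] := natr_geo_dom p0 p2.
exists ((1 + p) / 2), (A * K); split; rewrite ?mulr_ge0//; [lra|lra|].
move=> n; rewrite normcM mulrAC (le_trans (ler_pM _ _ (hk n) (hc n))) ?normc_ge0//.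
by rewrite mulrCA [leRHS]mulrC ler_wpM2l.
Qed.

Lemma geo_bounded_shift c : geo_bounded c -> geo_bounded (fun n => c n.+1).
Proof.
move=> [p [K [p0 p1 K0 hc]]]; exists p, K; split=> // n.
rewrite (le_trans (hc _))// ler_wpM2l// exprS ler_piMl ?exprn_ge0// ltW//.
Qed.

Lemma geo_bounded_dser c : geo_bounded c -> geo_bounded (dser c).
Proof.
move=> /geo_bounded_shift hc; apply: geo_bounded_natr => // n.
by rewrite natC normc_real ger0_norm.
Qed.

Lemma geo_bounded_conv c d : geo_bounded c -> geo_bounded d -> geo_bounded (conv c d).
Proof.
move=> hc hd; have [q [M [/andP[q0 q1] M0 {}hc {}hd]]] := geo_bounded2 hc hd.
have p2 : q < (1 + q) / 2 by lra.
have [A A0 hA] := natr_geo_dom q0 p2.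
exists ((1 + q) / 2), (A * (M * M)); split; rewrite ?mulr_ge0//; [lra|lra|].
move=> n; rewrite (le_trans (normc_sum _ _ _))//.
rewrite (@le_trans _ _ (\sum_(i < n.+1) (M * M) * q ^+ n))//; last first.
  by rewrite sumr_const card_ord -[_ *+ n.+1]mulr_natl mulrCA [leRHS]mulrAC [leRHS]mulrC ler_wpM2l ?mulr_ge0.
apply: ler_sum => i _; rewrite normcM (le_trans (ler_pM _ _ (hc _) (hd _))) ?normc_ge0//.
by rewrite mulrACA -exprD subnKC// -ltnS.
Qed.

Lemma psumD c d s : geo_bounded c -> geo_bounded d -> `|s| <= 1 ->
  psum (fun n => c n + d n) s = psum c s + psum d s.
Proof.
move=> hc hd s1; have [q [M [q01 M0 {}hc' {}hd']]] := geo_bounded2 hc hd.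
apply/esym; apply: (@psum_unique _ _ _ q (2 * (2 * M / (1 - q)))) => //.
  exact: geo_boundedD.
move=> n; rewrite (_ : ppart _ n s = ppart c n s + ppart d n s); last first.
  by rewrite -big_split; apply: eq_bigr => i _; rewrite mulrDl.
rewrite opprD addrACA (le_trans (normcD _ _))//.
rewrite (le_trans (lerD (psum_tail q01 M0 hc' s1 n) (psum_tail q01 M0 hd' s1 n)))//.
by rewrite le_eqVlt; apply/orP; left; apply/eqP; ring.
Qed.

Lemma psumZ k c s : geo_bounded c -> `|s| <= 1 ->
  psum (fun n => k * c n) s = k * psum c s.
Proof.
move=> hc s1; have [q [M [q0 q1 M0 hc']]] := hc.
have q01 : 0 <= q < 1 by rewrite q0.
apply/esym; apply: (@psum_unique _ _ _ q (normc k * (2 * M / (1 - q)))) => //.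
  exact: geo_boundedZ.
move=> n; rewrite (_ : ppart _ n s = k * ppart c n s); last first.
  by rewrite mulr_sumr; apply: eq_bigr => i _; rewrite mulrA.
rewrite -mulrBr normcM -[leRHS]mulrA ler_wpM2l ?normc_ge0//.
by rewrite (le_trans (psum_tail q01 M0 hc' s1 n))// mulrAC.
Qed.

Lemma ppartS c n s : ppart c n.+1 s = ppart c n s + c n * s%:C ^+ n.
Proof. by rewrite /ppart big_nat_recr. Qed.

(** The second factor is cut at n - i, so that its error, of order q^(n - i), combines with the q^i
    of the first factor. *)
Lemma ppart_conv c d n s :
  ppart (conv c d) n s = \sum_(0 <= i < n) c i * s%:C ^+ i * ppart d (n - i) s.
Proof.
elim: n => [|n IH]; first by rewrite /ppart !big_nil.
rewrite ppartS IH [RHS]big_nat_recr//= subSnn.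
have -> : \sum_(0 <= i < n) c i * s%:C ^+ i * ppart d (n.+1 - i) s =
  \sum_(0 <= i < n)
    (c i * s%:C ^+ i * ppart d (n - i) s + c i * d (n - i)%N * s%:C ^+ n).
  apply: eq_big_nat => i /andP[_ ni]; rewrite subSn 1?ltnW// ppartS mulrDr; congr (_ + _).
  by rewrite mulrACA -exprD subnKC// ltnW.
rewrite big_split/= -addrA; congr (_ + _).
rewrite /conv big_ord_recr/= subnn mulrDl big_mkord mulr_suml; congr (_ + _).
by rewrite ppartS /ppart big_nil add0r expr0 mulr1 mulrAC.
Qed.

Lemma psumM c d s : geo_bounded c -> geo_bounded d -> `|s| <= 1 ->
  psum (conv c d) s = psum c s * psum d s.
Proof.
move=> hc hd s1; have [q [M [q01 M0 {}hc' {}hd']]] := geo_bounded2 hc hd.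
have [/andP[q0 q1]] := (q01, tt).1.
have [A A0 hA] := @natr_geo_dom R q ((1 + q) / 2) q0 ltac:(lra).
have q'0 : 0 < 1 - q by rewrite subr_gt0.
apply/esym; apply: (@psum_unique _ _ _ ((1 + q) / 2)
  (2 * M / (1 - q) * normc (psum d s) + A * (M * (2 * M / (1 - q))))) => //.
- exact: geo_bounded_conv.
- by apply/andP; split; lra.
move=> n; rewrite ppart_conv.
(* The error is the tail of [c] times the sum of [d], plus n terms each of order q^n; this number n
   of terms is why the ratio is raised to (1 + q) / 2. *)
have -> : psum c s * psum d s = (psum c s - ppart c n s) * psum d s +
    \sum_(0 <= i < n) c i * s%:C ^+ i * psum d s.
  by rewrite -mulr_suml -mulrDl subrK.
rewrite -addrA -sumrB (le_trans (normcD _ _))// [leRHS]mulrDl lerD//.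
  rewrite normcM [leRHS]mulrAC ler_wpM2r ?normc_ge0//.
  rewrite (le_trans (psum_tail q01 M0 hc' s1 n))// mulrAC ler_wpM2l ?mulr_ge0 ?invr_ge0 ?(ltW q'0)//.
  by rewrite lerXn2r ?nnegrE//; lra.
rewrite (le_trans (normc_sum _ _ _))//.
rewrite (@le_trans _ _ (\sum_(0 <= i < n) M * (2 * M / (1 - q)) * q ^+ n))//.
  rewrite !big_nat; apply: ler_sum => i /andP[_ ni].
  rewrite -mulrBr !normcM normcX normc_real.
  have -> : M * (2 * M / (1 - q)) * q ^+ n = M * q ^+ i * 1 * (2 * M * q ^+ (n - i) / (1 - q)).
    by rewrite -{1}(subnKC (ltnW ni)) exprD; ring.
  apply: ler_pM; rewrite ?mulr_ge0 ?normc_ge0 ?exprn_ge0//.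
  - by rewrite ler_pM ?normc_ge0 ?exprn_ge0// exprn_ile1.
  - exact: psum_tail.
rewrite sumr_const_nat subn0 -[_ *+ n]mulr_natl mulrCA [leRHS]mulrAC [leRHS]mulrC ler_wpM2l ?mulr_ge0 ?invr_ge0 ?(ltW q'0)//.
rewrite (le_trans _ (hA n))// ler_wpM2r ?exprn_ge0//.
by rewrite ler_nat.
Qed.

Lemma cder_psum c s : geo_bounded c -> `|s| <= 1 -> cder (psum c) s (psum (dser c) s).
Proof.
move=> hc s1.
have hd := geo_bounded_dser hc; have hdd := geo_bounded_dser hd.
have [q [M [q01 M0 b1 b2]]] := geo_bounded2 hc hd.
have [p [K [p01 K0 b3 _]]] := geo_bounded2 hdd hdd.
pose r := Num.max p q.
have r01 : 0 <= r < 1 by rewrite le_max gt_max; case/andP: p01 => -> ->; case/andP: q01 => _ ->.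
have [r0 r1] := andP r01.
(* [k] lies strictly between 1 and 1 / r, so the series and its first two derived series converge at
   a point beyond |s|. *)
pose k := 2 / (1 + r).
have k1 : 1 < k by rewrite /k ltr_pdivlMr ?mul1r; lra.
have k0 : 0 <= k by lra.
have rk : r * k < 1 by rewrite /k mulrA ltr_pdivrMr; lra.
have [q0 p0] : 0 <= q /\ 0 <= p by split; [case/andP: q01|case/andP: p01].
have qk : q * k < 1 by rewrite (le_lt_trans _ rk)// ler_wpM2r// le_max lexx orbT.
have pk : p * k < 1 by rewrite (le_lt_trans _ rk)// ler_wpM2r// le_max lexx.
have sk : `|s| < `|k| by rewrite (ger0_norm k0) (le_lt_trans s1).
have dR e : (fun n => Re (dser e n)) = pseries_diffs (fun n => Re (e n)).
  by apply/funext => n; rewrite /dser ReM Re_nat Im_nat mul0r subr0.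
have dI e : (fun n => Im (dser e n)) = pseries_diffs (fun n => Im (e n)).
  by apply/funext => n; rewrite /dser ImM Re_nat Im_nat mul0r addr0.
split.
  rewrite {2}/psum Re_mk dR; apply: (@pseries_snd_diffs _ _ k) => //.
  - by apply: (cvgn_pseries_geo q0 M0) => // n; rewrite (le_trans (Re_normc _)).
  - by rewrite -dR; apply: (cvgn_pseries_geo q0 M0) => // n; rewrite (le_trans (Re_normc _)).
  - by rewrite -!dR; apply: (cvgn_pseries_geo p0 K0) => // n; rewrite (le_trans (Re_normc _)).
rewrite {2}/psum Im_mk dI; apply: (@pseries_snd_diffs _ _ k) => //.
- by apply: (cvgn_pseries_geo q0 M0) => // n; rewrite (le_trans (Im_normc _)).
- by rewrite -dI; apply: (cvgn_pseries_geo q0 M0) => // n; rewrite (le_trans (Im_normc _)).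
- by rewrite -!dI; apply: (cvgn_pseries_geo p0 K0) => // n; rewrite (le_trans (Im_normc _)).
Qed.
End PowerSeries.

(** * Continuity and measurability on the circle *)

Section CircleMeasurability.
Variable R : realType.
Implicit Types (u v : circle R).

Lemma normc_circle u : normc (set_val u) = 1.
Proof.
have /set_mem /= := valP u; rewrite normc_norm => /(congr1 (@complex.Re R)).
by rewrite Re_real.
Qed.

Lemma open_circle_preimage (A : set R[i]) :
  open A -> open ((set_val : circle R -> R[i]) @^-1` A).
Proof. move=> oA. by exists A. Qed.
Lemma nbhs_circle (u : circle R) (e : R) : 0 < e ->
  nbhs u [set v : circle R | normc (set_val v - set_val u) < e].
Proof.
move=> e0.
have eC : 0 < e%:C :> R[i] by rewrite ltcR.
have := nbhsx_ballx (set_val u : R[i]) _ eC.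
rewrite nbhsE => -[U [oU Uu] hU].
have oV := open_circle_preimage oU.
have : nbhs u ((set_val : circle R -> R[i]) @^-1` U).
  by apply: open_nbhs_nbhs; split.
apply: filterS => v /= Uv.
by have := hU _ Uv; rewrite /ball /= normc_norm ltcR normcB.
Qed.

Lemma lipschitz_continuous_circle (F : circle R -> R) L :
  (forall u v, `|F u - F v| <= L * normc (set_val u - set_val v)) -> continuous F.
Proof.
move=> h u; have FF : ProperFilter (nbhs u) by exact: nbhs_pfilter.
apply/(@cvgrPdist_lt _ _ _ (nbhs u)) => e e0.
have eL : 0 < e / (`|L| + 1) by rewrite divr_gt0// ltr_wpDl.
have := nbhs_circle u eL; apply: filterS => v hv.
rewrite (le_lt_trans (h u v))// normcB.
apply: (@le_lt_trans _ _ ((`|L| + 1) * normc (set_val v - set_val u))).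
  by rewrite ler_wpM2r ?normc_ge0// (le_trans (ler_norm L))// lerDl.
by rewrite mulrC -ltr_pdivlMr// ltr_wpDl.
Qed.

Lemma measurable_open_circle (U : set (circle R)) : open U -> measurable U.
Proof. by move=> oU; exact: sub_sigma_algebra. Qed.

Lemma continuous_measurable_circle (F : circle R -> R) :
  continuous F -> measurable_fun setT F.
Proof.
move=> /continuousP cF; apply: (measurability _ (measurable_realfun.RGenOpens.measurableE R)).
move=> _ [_ [a [b ->]] <-]; rewrite setTI; apply: measurable_open_circle.
exact/cF/interval_open.
Qed.

End CircleMeasurability.

(** * Integrals of bounded functions against a probability *)

Section ProbabilityIntegral.
Context d (T : measurableType d) (R : realType) (P : probability T R).

Lemma Rintegral_cst_prob (r : R) : \int[P]_u r = r.
Proof.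
have h : fine (P setT) = 1 by rewrite probability_setT.
by rewrite Rintegral_cst// -[RHS]mulr1 -h.
Qed.

Lemma prob_bounded_integrable (F : T -> R) M :
  measurable_fun setT F -> (forall u, `|F u| <= M) -> P.-integrable setT (EFin \o F).
Proof.
move=> mF hM; apply: measurable_bounded_integrable => //.
  by apply: (le_lt_trans (probability_le1 P measurableT)); exact: ltry.
exists M; split; first exact: num_real.
by move=> N MN u _; exact: (le_trans (hM u) (ltW MN)).
Qed.

Lemma normr_Rintegral_prob (F : T -> R) M : P.-integrable setT (EFin \o F) ->
  (forall u, `|F u| <= M) -> `|\int[P]_u F u| <= M.
Proof.
move=> iF hF; rewrite (le_trans (le_normr_Rintegral _ _))//.
rewrite -[leRHS]Rintegral_cst_prob; apply: le_Rintegral => //.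
- exact: (integrable_norm iF).
- by apply: (@prob_bounded_integrable (fun=> M) `|M|).
Qed.

Lemma Rintegral_prob_ge (F : T -> R) (r : R) : P.-integrable setT (EFin \o F) ->
  (forall u, r <= F u) -> r <= \int[P]_u F u.
Proof.
move=> iF hF; rewrite -[leLHS]Rintegral_cst_prob; apply: le_Rintegral => //.
by apply: (@prob_bounded_integrable (fun=> r) `|r|).
Qed.

Lemma prob_integrableZ (F : T -> R) (a : R) : P.-integrable setT (EFin \o F) ->
  P.-integrable setT (EFin \o (fun u => a * F u)).
Proof.
move=> iF; rewrite (_ : _ \o _ = (fun u => a%:E * (EFin \o F) u)%E)//.
exact: integrableZl.
Qed.

End ProbabilityIntegral.

(** * Complex integrals on the circle, moments, and the Poisson kernel *)

Section ComplexIntegral.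
Variables (R : realType) (mu : probability (circle R) R).
Implicit Types (u v : circle R) (g h : circle R -> R[i]) (M L s : R) (k z : R[i]).

(** One condition giving continuity, hence measurability, and boundedness, hence integrability. It
    is stable under linear combinations and holds for the powers of u and for the kernel of psi. *)
Definition lipschitzc g := exists L : R, forall u v,
  normc (g u - g v) <= L * normc (set_val u - set_val v).

Lemma lipschitzc_bounded g : lipschitzc g -> exists M : R, forall u, normc (g u) <= M.
Proof.
move=> [L hL]; exists (normc (g (cis 0)) + `|L| * 2) => u.
rewrite -(subrK (g (cis 0)) (g u)) (le_trans (normcD _ _))// addrC lerD2l.
rewrite (le_trans (hL _ _))// (le_trans (ler_wpM2r (normc_ge0 _) (ler_norm L)))//.
apply: ler_wpM2l => //; rewrite (le_trans (normcD _ _))// normcN.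
by rewrite !normc_circle.
Qed.

Lemma lipschitzc_measurable g : lipschitzc g ->
  measurable_fun setT (fun u => Re (g u)) /\ measurable_fun setT (fun u => Im (g u)).
Proof.
move=> [L hL]; split; apply: continuous_measurable_circle;
  apply: (@lipschitz_continuous_circle _ _ L) => u v; apply: le_trans (hL u v).
- by rewrite -ReN -ReD Re_normc.
- by rewrite -ImN -ImD Im_normc.
Qed.

Lemma lipschitzc_integrable g : lipschitzc g ->
  mu.-integrable setT (EFin \o (fun u => Re (g u))) /\
  mu.-integrable setT (EFin \o (fun u => Im (g u))).
Proof.
move=> hg; have [mR mI] := lipschitzc_measurable hg.
have [M hM] := lipschitzc_bounded hg.
split; apply: (@prob_bounded_integrable _ _ _ mu _ M) => // u; apply: le_trans (hM u).
- exact: Re_normc.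
- exact: Im_normc.
Qed.

Lemma lipschitzcD g h : lipschitzc g -> lipschitzc h -> lipschitzc (fun u => g u + h u).
Proof.
move=> [L hL] [K hK]; exists (L + K) => u v.
by rewrite opprD addrACA mulrDl (le_trans (normcD _ _))// lerD.
Qed.

Lemma lipschitzcZ k g : lipschitzc g -> lipschitzc (fun u => k * g u).
Proof.
move=> [L hL]; exists (normc k * L) => u v.
by rewrite -mulrBr normcM -mulrA ler_wpM2l ?normc_ge0.
Qed.

Lemma lipschitzc_cst k : lipschitzc (fun=> k).
Proof. by exists 0 => u v; rewrite subrr normc0 mul0r. Qed.

Lemma lipschitzcX n : lipschitzc (fun u => set_val u ^+ n).
Proof.
exists n%:R => u v; rewrite subrXX normcM mulrC ler_wpM2r ?normc_ge0//.
rewrite (le_trans (normc_sum _ _ _))// -[n in n%:R]card_ord -sumr_const.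
by apply: ler_sum => i _; rewrite normcM !normcX !normc_circle !expr1n mulr1.
Qed.

Lemma cintegralE g : cintegral mu g =
  (\int[mu]_u Re (g u)) +i* (\int[mu]_u Im (g u)).
Proof. by []. Qed.

Lemma cintegralD g h : lipschitzc g -> lipschitzc h ->
  cintegral mu (fun u => g u + h u) = cintegral mu g + cintegral mu h.
Proof.
move=> /lipschitzc_integrable[g1 g2] /lipschitzc_integrable[h1 h2].
rewrite !cintegralE; apply: complex_eqP; rewrite !ReImE -RintegralD//;
  by apply: eq_Rintegral => u _; rewrite !ReImE.
Qed.

Lemma cintegralZ k g : lipschitzc g ->
  cintegral mu (fun u => k * g u) = k * cintegral mu g.
Proof.
move=> hg; have [g1 g2] := lipschitzc_integrable hg.
have [[k1 k2] [k3 k4]] : (mu.-integrable setT (EFin \o (fun u => Re k * Re (g u))) /\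
    mu.-integrable setT (EFin \o (fun u => Im k * Im (g u)))) /\
    (mu.-integrable setT (EFin \o (fun u => Re k * Im (g u))) /\
    mu.-integrable setT (EFin \o (fun u => Im k * Re (g u)))).
  by split; split; exact: prob_integrableZ.
rewrite !cintegralE; apply: complex_eqP; rewrite !ReImE -!RintegralZl//.
- rewrite -RintegralB//; apply: eq_Rintegral => u _; by rewrite !ReImE.
- rewrite -RintegralD//; apply: eq_Rintegral => u _; by rewrite !ReImE.
Qed.

Lemma cintegral_cst k : cintegral mu (fun=> k) = k.
Proof.
by rewrite cintegralE; apply: complex_eqP; rewrite !ReImE; exact: Rintegral_cst_prob.
Qed.

(** The factor 2 comes from estimating the real and imaginary parts separately. *)
Lemma normc_cintegral g M : lipschitzc g -> (forall u, normc (g u) <= M) ->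
  normc (cintegral mu g) <= 2 * M.
Proof.
move=> /lipschitzc_integrable[g1 g2] hM.
rewrite (le_trans (normc_le_ReIm _))// mulr_natl mulr2n cintegralE !ReImE.
by apply: lerD; apply: normr_Rintegral_prob => // u; apply: le_trans (hM u);
  [exact: Re_normc|exact: Im_normc].
Qed.

Definition moment n : R[i] := cintegral mu (fun u => set_val u ^+ n).

(** The moment of order 0 is 1, whereas psi has no constant term. *)
Definition mcoef n : R[i] := if n is 0 then 0 else moment n.

(** The coefficients, in the real variable s, of psi along the segment from 0 to [z]. *)
Definition mser z n : R[i] := mcoef n * z ^+ n.

Lemma normc_mcoef n : normc (mcoef n) <= 2.
Proof.
case: n => [|n]; first by rewrite normc0.
rewrite -[leRHS]mulr1; apply: normc_cintegral; first exact: lipschitzcX.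
by move=> u; rewrite normcX normc_circle expr1n.
Qed.

Lemma geo_bounded_mser z : normc z < 1 -> geo_bounded (mser z).
Proof.
move=> z1; exists (normc z), 2; split; rewrite ?normc_ge0// => n.
by rewrite normcM normcX ler_wpM2r ?exprn_ge0 ?normc_ge0// normc_mcoef.
Qed.

Lemma normc_1Buz u z : 1 - normc z <= normc (1 - set_val u * z).
Proof.
have := normcD (1 - set_val u * z) (set_val u * z).
by rewrite subrK normc1 normcM normc_circle mul1r lerBlDr.
Qed.

Lemma oneBuz_neq0 u z : normc z < 1 -> 1 - set_val u * z != 0.
Proof.
by move=> z1; rewrite -normc_gt0 (lt_le_trans _ (normc_1Buz u z))// subr_gt0.
Qed.

Definition psik z u : R[i] := set_val u * z / (1 - set_val u * z).

Lemma lipschitzc_psik z : normc z < 1 -> lipschitzc (psik z).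
Proof.
move=> z1; exists (normc z / (1 - normc z) ^+ 2) => u v.
have u0 := oneBuz_neq0 u z1; have v0 := oneBuz_neq0 v z1.
have d0 : 0 < 1 - normc z by rewrite subr_gt0.
have -> : psik z u - psik z v =
  z * (set_val u - set_val v) / ((1 - set_val u * z) * (1 - set_val v * z)).
  by rewrite /psik; field; rewrite u0 v0.
rewrite normcM normcV !normcM [leRHS]mulrAC ler_wpM2l ?mulr_ge0 ?normc_ge0//.
rewrite lef_pV2 ?posrE ?exprn_gt0// ?mulr_gt0 ?normc_gt0//.
by rewrite expr2 ler_pM ?normc_1Buz// ltW.
Qed.

Lemma psiE z : psi mu z = cintegral mu (psik z). Proof. by []. Qed.

Lemma lipschitzc_sum (c : nat -> R[i]) n :
  lipschitzc (fun u => \sum_(0 <= k < n) c k * set_val u ^+ k) /\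
  cintegral mu (fun u => \sum_(0 <= k < n) c k * set_val u ^+ k) =
  \sum_(0 <= k < n) c k * moment k.
Proof.
elim: n => [|n [IH1 IH2]].
  rewrite big_nil; under eq_fun do rewrite big_nil.
  by split; [exact: lipschitzc_cst|exact: cintegral_cst].
under eq_fun do rewrite big_nat_recr//=; rewrite big_nat_recr//=.
have h := lipschitzcZ (c n) (lipschitzcX n).
by split; [exact: lipschitzcD|rewrite cintegralD// IH2 cintegralZ//; exact: lipschitzcX].
Qed.

Lemma psik_geo z u n : normc z < 1 ->
  psik z u - \sum_(0 <= k < n.+1) (if k is 0 then 0 else z ^+ k) * set_val u ^+ k =
  (set_val u * z) ^+ n.+1 / (1 - set_val u * z).
Proof.
move=> z1; have u0 := oneBuz_neq0 u z1; apply: (mulIf u0); rewrite divfK//.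
rewrite mulrBl divfK//; elim: n => [|n IH].
  by rewrite big_nat1 mul0r mul0r subr0 expr1.
rewrite big_nat_recr//= mulrDl opprD addrA IH [in RHS]exprS !exprMn; ring.
Qed.

(** The kernel is a finite geometric sum up to an explicit remainder of order |w|^n, uniform in u,
    which may therefore be integrated. *)
Lemma psi_psum z s : normc z < 1 -> `|s| <= 1 ->
  psi mu (z * s%:C) = psum (mser z) s.
Proof.
move=> z1 s1; set w := z * s%:C.
have wz : normc w <= normc z by rewrite normcM normc_real ler_piMr ?normc_ge0.
have w1 : normc w < 1 by apply: le_lt_trans z1.
have d0 : 0 < 1 - normc w by rewrite subr_gt0.
apply: (@psum_unique _ _ _ _ (normc z) (2 / (1 - normc w))) => //.
- exact: geo_bounded_mser.
- by rewrite normc_ge0.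
move=> n.
pose c (k : nat) : R[i] := if k is 0 then 0 else w ^+ k.
have -> : ppart (mser z) n s = \sum_(0 <= k < n) c k * moment k.
  apply: eq_bigr => -[|k] _; rewrite /mser /c /=; first by rewrite !mul0r.
  by rewrite exprMn; ring.
have [l1 <-] := lipschitzc_sum c n; rewrite psiE.
have l2 := lipschitzcZ (-1) l1.
rewrite -mulN1r -(cintegralZ _ l1) -cintegralD//; last exact: lipschitzc_psik.
rewrite [leRHS]mulrAC -[leRHS]mulrA; apply: normc_cintegral.
  by apply: lipschitzcD => //; exact: lipschitzc_psik.
move=> u; rewrite mulN1r; case: n {l1 l2} => [|n].
  rewrite big_nil subr0 expr0 mul1r /psik normcM normcV normcM normc_circle mul1r.
  rewrite ler_pdivrMr ?normc_gt0 ?oneBuz_neq0// (le_trans (ltW w1))//.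
  by rewrite mulrC ler_pdivlMr// mul1r normc_1Buz.
rewrite psik_geo// normcM normcV normcX normcM normc_circle mul1r.
apply: ler_pM; rewrite ?exprn_ge0 ?invr_ge0 ?normc_ge0//.
  by rewrite lerXn2r// nnegrE normc_ge0.
by rewrite lef_pV2 ?posrE ?normc_gt0 ?oneBuz_neq0// normc_1Buz.
Qed.

Definition poisson z u : R := (1 - normc z ^+ 2) / normc (1 - set_val u * z) ^+ 2.

(** [1 + 2 * psik z u] is the Herglotz kernel (1 + u z) / (1 - u z); multiplying by the conjugate of
    the denominator isolates its real part. *)
Lemma Re_psik z u : normc z < 1 -> Re (1 + 2 * psik z u) = poisson z u.
Proof.
move=> z1; have u0 := oneBuz_neq0 u z1.
have n0 : normc (1 - set_val u * z) ^+ 2 != 0 by rewrite expf_neq0// normc_eq0.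
rewrite /psik /poisson; have := normcM (set_val u) z; rewrite normc_circle mul1r => <-.
set w := set_val u * z in u0 n0 *.
have -> : 1 + 2 * (w / (1 - w)) = (1 + w) / (1 - w) by field.
have -> : (1 + w) / (1 - w) = (1 + w) * conjc (1 - w) / (normc (1 - w) ^+ 2)%:C.
  have D0 : conjc (1 - w) != 0 by rewrite conjc_eq0.
  rewrite rmorphXn/= -normc_norm sqr_normc; move: (conjc (1 - w)) D0 => D D0; field.
  by rewrite u0 D0.
rewrite -fmorphV Re_realM; congr (_ / _); rewrite normc_sqr.
by case: {u0 n0} w => a b; rewrite /=; ring.
Qed.

(** Harnack's lower bound. Being uniform in u, it makes positivity pass to the integral. *)
Lemma poisson_ge z u : normc z < 1 -> (1 - normc z) / (1 + normc z) <= poisson z u.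
Proof.
move=> z1; have d0 : 0 < 1 - normc z by rewrite subr_gt0.
have e0 : 0 < 1 + normc z by rewrite ltr_pwDl// normc_ge0.
rewrite /poisson ler_pdivrMr// mulrAC ler_pdivlMr; last first.
  by rewrite exprn_gt0// normc_gt0 oneBuz_neq0.
have -> : (1 - normc z ^+ 2) * (1 + normc z) = (1 - normc z) * (1 + normc z) ^+ 2 by ring.
rewrite ler_pM2l// lerXn2r// ?nnegrE ?normc_ge0 ?(ltW e0)//.
by rewrite (le_trans (normcD _ _))// normcN normc1 normcM normc_circle mul1r.
Qed.

Lemma Re_psi_poisson z : normc z < 1 ->
  Re (1 + 2 * psi mu z) = \int[mu]_u poisson z u.
Proof.
move=> z1; have hk := lipschitzc_psik z1.
rewrite psiE -(cintegralZ _ hk) -[X in Re (X + _)](cintegral_cst 1) -cintegralD.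
- by rewrite cintegralE Re_mk; apply: eq_Rintegral => u _; rewrite Re_psik.
- exact: lipschitzc_cst.
- exact: lipschitzcZ.
Qed.

Lemma poisson_integrable z : normc z < 1 -> mu.-integrable setT (EFin \o poisson z).
Proof.
move=> z1; have h := lipschitzcD (lipschitzc_cst 1) (lipschitzcZ 2 (lipschitzc_psik z1)).
have [+ _] := lipschitzc_integrable h.
by rewrite (_ : (fun u => _) = poisson z)//; apply/funext => u; rewrite Re_psik.
Qed.

Lemma Re_psi_gt0 z : normc z < 1 -> 0 < Re (1 + 2 * psi mu z).
Proof.
move=> z1; have d0 : 0 < (1 - normc z) / (1 + normc z).
  by rewrite divr_gt0 ?subr_gt0// ltr_pwDl// normc_ge0.
rewrite Re_psi_poisson// (lt_le_trans d0)//.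
by apply: Rintegral_prob_ge => [|u]; [exact: poisson_integrable|exact: poisson_ge].
Qed.

End ComplexIntegral.

(** * Uniqueness of the coefficients of a power series *)

Section PowerSeriesUniqueness.
Variable R : realType.
Implicit Types (c d : nat -> R[i]) (s : R).

Lemma psum_bounded c : geo_bounded c ->
  exists B : R, forall s, `|s| <= 1 -> normc (psum c s) <= B.
Proof.
move=> [q [M [q0 q1 M0 h]]]; exists (2 * M / (1 - q)) => s s1.
have := @psum_tail _ c q M s ltac:(by rewrite q0) M0 h s1 0.
by rewrite /ppart big_nil subr0 expr0 mulr1.
Qed.

Lemma psum_shift c s : geo_bounded c -> `|s| <= 1 ->
  psum c s = c 0 + s%:C * psum (fun n => c n.+1) s.
Proof.
move=> hc s1; have hs := geo_bounded_shift hc.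
have [q [M [q01 M0 _ h2]]] := geo_bounded2 hc hs.
have [/andP[q0 q1]] := (q01, tt).1.
pose Q := (1 + q) / 2.
have Q0 : 0 < Q by rewrite /Q; lra.
have Q1 : Q < 1 by rewrite /Q; lra.
have qQ : q <= Q by rewrite /Q; lra.
set L := c 0 + _.
apply/esym; apply: (@psum_unique _ _ _ L Q (normc L + 2 * M / (1 - q) / Q)) => //.
  by rewrite (ltW Q0).
have d0 : 0 <= 2 * M / (1 - q) by rewrite divr_ge0 ?mulr_ge0// subr_ge0 ltW.
move=> [|n].
  rewrite /ppart big_nil subr0 expr0 mulr1 lerDl.
  by rewrite divr_ge0// ltW.
have -> : ppart c n.+1 s = c 0 + s%:C * ppart (fun n => c n.+1) n s.
  rewrite /ppart big_nat_recl//= expr0 mulr1; congr (_ + _).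
  by rewrite mulr_sumr; apply: eq_bigr => i _; rewrite exprS mulrCA.
rewrite /L opprD addrACA subrr add0r -mulrBr normcM normc_real.
rewrite mulrDl ler_wpDl ?mulr_ge0 ?normc_ge0 ?exprn_ge0 ?(ltW Q0)//.
rewrite exprS mulrA divfK ?gt_eqF// (@le_trans _ _ (2 * M * q ^+ n / (1 - q)))//.
  by rewrite -[leRHS]mul1r ler_pM ?normc_ge0// psum_tail.
by rewrite mulrAC geo_le// q0.
Qed.

Lemma psum0E c : geo_bounded c -> psum c 0 = c 0.
Proof. by move=> hc; rewrite psum_shift ?normr0// mul0r addr0. Qed.

Lemma psum_eq0_coef0 c (d : R) : geo_bounded c -> 0 < d ->
  (forall s, 0 < s < d -> psum c s = 0) -> c 0 = 0.
Proof.
move=> hc d0 h.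
have hs := geo_bounded_shift hc; have [B hB] := psum_bounded hs.
have B0 : 0 <= B by apply: le_trans (hB 0 _); rewrite ?normc_ge0 ?normr0.
apply/eqP; rewrite -normc_eq0 eq_le normc_ge0 andbT leNgt; apply/negP => c0.
(* At this [e] the shifted series would have modulus at least [2 * (B + 1)], against its bound
   [B]. *)
pose e := Num.min (d / 2) (Num.min 1 (normc (c 0) / (2 * (B + 1)))).
have B1 : 0 < 2 * (B + 1) by rewrite mulr_gt0// ltr_wpDl.
have e0 : 0 < e by rewrite !lt_min ltr01 !divr_gt0.
have ed : e < d by rewrite gt_min ltr_pdivrMr// ltr_pMr// ltr1n.
have e1 : `|e| <= 1 by rewrite gtr0_norm// !ge_min lexx orbT.
have ec : e <= normc (c 0) / (2 * (B + 1)) by rewrite !ge_min lexx !orbT.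
have := h e; rewrite e0 ed => /(_ isT); rewrite psum_shift// => /eqP.
rewrite addr_eq0 => /eqP ce; have hN := hB e e1.
have Ne : normc (c 0) = e * normc (psum (fun n => c n.+1) e).
  by rewrite ce normcN normcM normc_real gtr0_norm.
move: ec; rewrite ler_pdivlMr// Ne ler_pM2l// => ec; lra.
Qed.

Lemma psum_eq0 c (d : R) : geo_bounded c -> 0 < d ->
  (forall s, 0 < s < d -> psum c s = 0) -> forall n, c n = 0.
Proof.
move=> hc d0 h n; elim: n c d hc d0 h => [|n IH] c d hc d0 h.
  exact: psum_eq0_coef0 d0 h.
pose e := Num.min d 1.
have e0 : 0 < e by rewrite lt_min d0 ltr01.
apply: (IH (fun n => c n.+1) e) => //; first exact: geo_bounded_shift.
move=> s; rewrite lt_min => /and3P[s0 sd s1].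
have := h s; rewrite s0 sd => /(_ isT); rewrite psum_shift//; last first.
  by rewrite gtr0_norm// ltW.
rewrite (psum_eq0_coef0 hc d0 h) add0r => /eqP; rewrite mulf_eq0.
by rewrite (inj_eq (@complexI R) s 0) gt_eqF//= => /eqP.
Qed.

(** Serves to differentiate the functional equation, which is at first known only on an open
    interval. *)
Lemma cder_unique (f g : R -> R[i]) (a b s : R) k l : a < s < b ->
  (forall x, a < x < b -> f x = g x) -> cder f s k -> cder g s l -> k = l.
Proof.
move=> /andP[as_ sb] fg [f1 f2] [g1 g2].
have near_eq : \forall x \near s, f x = g x.
  have : s \in `]a, b[ by rewrite in_itv/= as_.
  by move=> /near_in_itvoo; apply: filterS => x; rewrite in_itv/= => /fg.
have u (F G : R -> R) x y : (\forall z \near s, F z = G z) ->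
    is_derive s (1 : R) F x -> is_derive s (1 : R) G y -> x = y.
  move=> FG dF dG; have dG' := near_eq_is_derive FG dF.
  by rewrite -(@derive_val _ _ _ _ _ _ _ dG') (@derive_val _ _ _ _ _ _ _ dG).
apply: complex_eqP; [apply: u f1 g1|apply: u f2 g2];
  by apply: filterS near_eq => x ->.
Qed.
End PowerSeriesUniqueness.

(** * The functional equation of psi in the whole disc *)

Section DiscIdentity.
Variables (R : realType) (s2 : R) (mu : probability (circle R) R).
Hypothesis hmu : free_unitary_normal s2 mu.
Implicit Types (z : R[i]) (s : R).
Local Notation psi := (psi mu).

(** On |z| <= 1/2 the kernel is at most |z| / (1 - |z|) <= 2 |z|. The bound keeps psi z inside the
    neighbourhood where the S-transform is prescribed. *)
Lemma normc_psi_le z : normc z <= 1/2 -> normc (psi z) <= 4 * normc z.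
Proof.
move=> z1; have z2 : normc z < 1 by lra.
rewrite psiE (_ : 4 * normc z = 2 * (2 * normc z)); last by ring.
apply: normc_cintegral; first exact: lipschitzc_psik.
move=> u; rewrite /psik normcM normcV normcM normc_circle mul1r.
have := normc_1Buz u z; have := oneBuz_neq0 u z2; rewrite -normc_gt0 => h1 h2.
rewrite ler_pdivrMr//; move: (normc_ge0 z) z1 h1 h2; set a := normc z; set b := normc _.
move=> a0 a1 b0 hb; nra.
Qed.

Lemma psi_near0 : exists2 d : R, 0 < d < 1/2 & forall z, normc z < d ->
  psi z * cexp (s2%:C * (psi z + 2^-1)) = z * (1 + psi z).
Proof.
have [_ [chi [_ chi0 _ /near0_normc[d1 d10 h1]] /near0'_normc[d2 d20 h2]]] := hmu.
exists (Num.min d1 (Num.min (d2 / 8) (1/4))).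
  rewrite !lt_min d10/= divr_gt0//= !gt_min; apply/andP; split; first lra.
  by apply/orP; right; apply/orP; right; lra.
move=> z; rewrite !lt_min => /and3P[zd1 zd2 z4].
have pz := h1 _ zd1.
have pd2 : normc (psi z) < d2.
  by apply: (le_lt_trans (normc_psi_le _)); lra.
(* The formula for the S-transform excludes the point 0; if psi z = 0, then z = [chi 0] = 0 and both
   sides vanish. *)
have [p0|p0] := eqVneq (psi z) 0.
  by rewrite p0 mul0r -pz p0 chi0 mul0r.
rewrite h2// pz.
by field.
Qed.

(** Along p(s) = psi (z s), the logarithmic derivative of p e^(s2 (p + 1/2)) = z s (1 + p) reads s
    p' (1 + s2 (p + p^2)) = p + p^2. These are the coefficients of the difference of its sides, [e]
    standing for s p' and [q] for p + p^2. *)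
Definition ode_coef (c : nat -> R[i]) : nat -> R[i] :=
  let q n := c n + conv c c n in
  let e n := n%:R * c n in
  fun n => e n + (s2%:C * conv e q n + (-1) * q n).

Lemma geo_bounded_nser (c : nat -> R[i]) : geo_bounded c -> geo_bounded (fun n => n%:R * c n).
Proof.
move=> hc; apply: geo_bounded_natr => // n.
by rewrite natC normc_real ger0_norm// ler_nat.
Qed.

Lemma psum_nser (c : nat -> R[i]) s : geo_bounded c -> `|s| <= 1 ->
  psum (fun n => n%:R * c n) s = s%:C * psum (dser c) s.
Proof. by move=> hc s1; rewrite psum_shift ?mul0r ?add0r//; exact: geo_bounded_nser. Qed.

Lemma ode_coefE (c : nat -> R[i]) s : geo_bounded c -> `|s| <= 1 ->
  geo_bounded (ode_coef c) /\
  psum (ode_coef c) s =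
    let p := psum c s in let p1 := psum (dser c) s in
    s%:C * p1 * (1 + s2%:C * (p + p * p)) - (p + p * p).
Proof.
move=> hc s1; have he := geo_bounded_nser hc.
have hq := geo_boundedD hc (geo_bounded_conv hc hc).
have b1 := geo_boundedZ s2%:C (geo_bounded_conv he hq).
have b2 := geo_boundedZ (-1) hq.
have b3 := geo_boundedD b1 b2.
split; first exact: geo_boundedD.
rewrite /ode_coef /= psumD// psumD// psumZ//; last exact: geo_bounded_conv.
rewrite psumZ// psumM// psumD//; last exact: geo_bounded_conv.
rewrite psumM// psum_nser//; ring.
Qed.

Lemma conv_mser (a b : nat -> R[i]) z n :
  conv (fun n => a n * z ^+ n) (fun n => b n * z ^+ n) n = conv a b n * z ^+ n.
Proof.
rewrite /conv mulr_suml; apply: eq_bigr => i _.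
by rewrite mulrACA -exprD subnKC// -ltnS.
Qed.

(** Coefficient n is homogeneous of degree n in z: a relation found along one direction is a
    relation between the moments, hence holds along every direction. *)
Lemma ode_coef_scale c z n : ode_coef (fun n => c n * z ^+ n) n = ode_coef c n * z ^+ n.
Proof.
rewrite /ode_coef conv_mser.
have -> : conv (fun n => n%:R * (c n * z ^+ n))
    (fun n => c n * z ^+ n + conv (fun n => c n * z ^+ n) (fun n => c n * z ^+ n) n) n =
  conv (fun n => n%:R * c n) (fun n => c n + conv c c n) n * z ^+ n.
  rewrite -conv_mser; congr conv; apply/funext => k; first by rewrite mulrA.
  by rewrite conv_mser mulrDl.
ring.
Qed.

(** The functional equation, known for small s, is read along the direction z = 1/2; any nonzero
    point of the disc would serve. *)
Lemma ode_coef_mcoef n : ode_coef (mcoef mu) n = 0.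
Proof.
have [d /andP[d0 d1] hd] := psi_near0.
pose z : R[i] := (2^-1)%:C.
have z0 : z != 0 by rewrite (inj_eq (@complexI R) _ 0) invr_eq0 pnatr_eq0.
have nz : normc z = 2^-1 by rewrite normc_real ger0_norm.
have z1 : normc z < 1 by rewrite nz; lra.
have hc := geo_bounded_mser mu z1.
suff : ode_coef (mser mu z) n = 0.
  by rewrite ode_coef_scale => /eqP; rewrite mulf_eq0 expf_eq0 (negbTE z0) andbF orbF => /eqP.
apply: (@psum_eq0 _ _ d) => //; first by have [] := ode_coefE hc (s := 0) ltac:(by rewrite normr0).
move=> s /andP[s0 sd]; have s1 : `|s| <= 1 by rewrite gtr0_norm//; lra.
have [_ ->] := ode_coefE hc s1; cbv zeta.
set p := psum (mser mu z) s; set p1 := psum (dser _) s.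
pose E := cexp (s2%:C * (p + 2^-1)).
have rel x : 0 < x < d -> psum (mser mu z) x * cexp (s2%:C * (psum (mser mu z) x + 2^-1)) =
   z * x%:C * (1 + psum (mser mu z) x).
  move=> /andP[x0 xd]; rewrite -psi_psum//; last by rewrite gtr0_norm//; lra.
  by apply: hd; rewrite normcM nz normc_real gtr0_norm//; lra.
have dp := cder_psum hc s1.
have s0d : 0 < s < d by rewrite s0.
have := cder_unique s0d rel
  (cderM dp (cder_cexp (cderZ s2%:C (cderD dp (cder_cst _ _)))))
  (cderM (cderZ z (cder_id s)) (cderD (cder_cst _ _) dp)).
rewrite -/p -/p1 -/E !addr0 add0r mulr1 => der.
have r0 := rel _ s0d; rewrite -/p -/E in r0.
apply: (mulfI z0); rewrite mulr0.
(* Multiplying the differentiated equation by [p] makes [p * E] appear, which the undifferentiated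
   one replaces; the exponential is gone. *)
have : (p1 * E + p * (s2%:C * p1 * E)) * p = p1 * (1 + s2%:C * p) * (p * E) by ring.
rewrite der r0 => h; rewrite mulrBr.
apply/eqP; rewrite subr_eq0; apply/eqP.
transitivity (p1 * (1 + s2%:C * p) * (z * s%:C * (1 + p)) - z * s%:C * p1 * p); first ring.
rewrite -h; ring.
Qed.

Lemma Re_1D2 z : Re (1 + 2 * z) = 1 + 2 * Re z.
Proof. by rewrite ReD ReM Re_nat Im_nat mul0r subr0. Qed.

(** By the differential equation, the defect [y] of the functional equation along the segment
    satisfies y' = c y; it vanishes at [a], where the equation is already known. *)
Lemma psi_functional z : normc z < 1 ->
  psi z * cexp (s2%:C * (psi z + 2^-1)) = z * (1 + psi z).
Proof.
move=> z1; have [d /andP[d0 d1] hd] := psi_near0.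
have hc := geo_bounded_mser mu z1.
pose p s := psum (mser mu z) s; pose p1 s := psum (dser (mser mu z)) s.
have pE s : `|s| <= 1 -> p s = psi (z * s%:C) by move=> s1; rewrite psi_psum.
have ode s : `|s| <= 1 ->
    s%:C * p1 s * (1 + s2%:C * (p s + p s * p s)) = p s + p s * p s.
  move=> s1; have [hb] := ode_coefE hc s1; cbv zeta => h.
  apply/eqP; rewrite -subr_eq0 -h; apply/eqP.
  have -> : ode_coef (mser mu z) = fun n => 0 * mser mu z n.
    by apply/funext => n; rewrite ode_coef_scale ode_coef_mcoef !mul0r.
  by rewrite psumZ// mul0r.
pose E s := cexp (s2%:C * (p s + 2^-1)).
(* The segment starts away from 0 because [c] has a pole at s = 0. *)
pose a := d / 2.
have a0 : 0 < a by rewrite divr_gt0.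
have a1 : a <= 1 by rewrite /a; lra.
have [B hB] := psum_bounded hc; have [B1 hB1] := psum_bounded (geo_bounded_dser hc).
have zs s : `|s| <= 1 -> normc (z * s%:C) < 1.
  by move=> s1; rewrite normcM normc_real (le_lt_trans _ z1)// ler_piMr ?normc_ge0.
(* Re (1 + 2 psi) > 0 means Re (1 + psi) > 1/2, which controls the other factor in the denominator
   of [c]. *)
have p_half s : `|s| <= 1 -> 2^-1 <= normc (1 + p s).
  move=> s1; have := Re_psi_gt0 mu (zs _ s1); rewrite -pE//.
  rewrite Re_1D2 => h; apply: le_trans (Re_normc _).
  rewrite ReD Re1 (le_trans _ (ler_norm _))//; lra.
have sab s : a <= s <= 1 -> `|s| <= 1 /\ 0 < s.
  by move=> /andP[as_ s1]; have s0 := lt_le_trans a0 as_; rewrite gtr0_norm.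
pose c s := ((1 + p s) + s%:C * p1 s) / (s%:C * (1 + p s)).
pose y s := p s * E s - z * (s%:C * (1 + p s)).
have : y 1 = 0.
  apply: (@cder_linear_eq0 _ y c ((1 + B + B1) / (a * 2^-1)) a 1) => //.
  - move=> s /sab[s1 s0]; have dp := cder_psum hc s1.
    apply: cder_eq.
      exact: (cderB (cderM dp (cder_cexp (cderZ s2%:C (cderD dp (cder_cst _ _)))))
        (cderZ z (cderM (cder_id s) (cderD (cder_cst 1 _) dp)))).
    have sC0 : s%:C != 0 :> R[i] by rewrite (inj_eq (@complexI R) _ 0) gt_eqF.
    have p0 : 1 + p s != 0 by rewrite -normc_gt0 (lt_le_trans _ (p_half _ s1)).
    apply: (mulIf (mulf_neq0 sC0 p0)); rewrite [in RHS]mulrAC divfK ?mulf_neq0//.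
    apply/eqP; rewrite -subr_eq0; apply/eqP.
    have := ode _ s1; rewrite /c /y /E /p /p1 /=.
    move: (psum (mser mu z) s) (psum (dser _) s) => P P1.
    move: (cexp _) => e h.
    transitivity (e * (s%:C * P1 * (1 + s2%:C * (P + P * P)) - (P + P * P))); first ring.
    by rewrite h subrr mulr0.
  - move=> s /[dup] /sab[s1 s0] /andP[as_ _].
    rewrite (le_trans (ler_norm _))// (le_trans (Re_normc _))// /c normcM normcV normcM normc_real.
    apply: ler_pM; rewrite ?invr_ge0 ?mulr_ge0 ?normc_ge0//.
      rewrite (le_trans (normcD _ _))// lerD//.
        by rewrite (le_trans (normcD _ _))// normc1 lerD2l hB.
      by rewrite normcM normc_real -[leRHS]mul1r ler_pM ?normc_ge0// hB1.
    rewrite lef_pV2 ?posrE ?mulr_gt0 ?normr_gt0 ?gt_eqF//; last first.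
      by rewrite (lt_le_trans _ (p_half _ s1)).
    by rewrite ler_pM ?(ltW a0) ?p_half// gtr0_norm.
  - have a1' : `|a| <= 1 by rewrite gtr0_norm.
    rewrite /y /E pE// hd; first by ring.
    rewrite normcM normc_real gtr0_norm// (@lt_trans _ _ a)//.
      by rewrite -[ltRHS]mul1r ltr_pM2r.
    by rewrite /a; lra.
rewrite /y /E pE ?normr1// mulr1 => /eqP; rewrite subr_eq0 => /eqP ->.
by rewrite mul1r.
Qed.
End DiscIdentity.

(** * Hyperbolic functions *)

Section Hyperbolic.
Variable R : realType.
Implicit Types (x y : R).

Lemma drv_ext (f g : R -> R) x a : f =1 g -> is_derive x (1 : R) f a ->
  is_derive x (1 : R) g a.
Proof. by move=> /funext ->. Qed.
Lemma sh0 : sh (0 : R) = 0. Proof. by rewrite /sh oppr0 subrr mul0r. Qed.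
Lemma ch0 : ch (0 : R) = 1. Proof. by rewrite /ch oppr0 expR0 -mulr2n -[1 *+ 2]mulr_natr mul1r divff. Qed.
Lemma is_derive_sh y : is_derive y (1 : R) (@sh R) (ch y).
Proof.
have h : is_derive y (1 : R) (fun s => 2^-1 * (expR s - expR (-1 * s))) (ch y).
  refine (drv_eq (drvZ _ (drvB (is_derive_expR _)
    (drv_comp (is_derive_expR _) (drvZ (-1) (drv_id _))))) _).
  by rewrite /ch !mulN1r ?mulr1; field.
by apply: drv_ext h => s; rewrite /sh mulN1r mulrC.
Qed.
Lemma is_derive_ch y : is_derive y (1 : R) (@ch R) (sh y).
Proof.
have h : is_derive y (1 : R) (fun s => 2^-1 * (expR s + expR (-1 * s))) (sh y).
  refine (drv_eq (drvZ _ (drvD (is_derive_expR _)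
    (drv_comp (is_derive_expR _) (drvZ (-1) (drv_id _))))) _).
  by rewrite /sh !mulN1r ?mulr1; field.
by apply: drv_ext h => s; rewrite /ch mulN1r mulrC.
Qed.
Lemma sh_gt0 y : 0 < y -> 0 < sh y.
Proof.
by move=> y0; rewrite /sh divr_gt0// subr_gt0 ltr_expR; lra.
Qed.
Lemma ch_gt0 y : 0 < ch y.
Proof. by rewrite /ch divr_gt0// addr_gt0// expR_gt0. Qed.
Lemma ch_ge1 y : 1 <= ch y.
Proof.
rewrite -(@ler_pXn2r _ 2) ?nnegrE ?(ltW (ch_gt0 _))// expr1n ch2_sh2.
by rewrite lerDl sqr_ge0.
Qed.
Lemma drv_ndecr (f df : R -> R) (a b : R) :
  (forall x, a <= x <= b -> is_derive x (1 : R) f (df x)) ->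
  (forall x, a <= x <= b -> 0 <= df x) -> a <= b -> f a <= f b.
Proof.
move=> h h0 ab; rewrite -lerN2.
apply: (@drv_nincr _ (fun x => - f x) (fun x => - df x)) => // x xab.
  exact/drvN/h.
by rewrite oppr_le0 h0.
Qed.
Lemma sh_ge y : 0 <= y -> y <= sh y.
Proof.
move=> y0; have := @drv_ndecr (fun s => sh s - s) (fun s => ch s - 1) 0 y.
rewrite sh0 subr0 subr_ge0; apply => // x _; last by rewrite subr_ge0 ch_ge1.
exact: (drvB (is_derive_sh x) (drv_id x)).
Qed.
Lemma sh_lt_ych y : 0 < y -> sh y < y * ch y.
Proof.
move=> y0.
(* Subtracting s^3 / 3 keeps the derivative nonnegative, and its value at y makes the resulting
   inequality strict. *)
have := @drv_ndecr (fun s => s * ch s - sh s - 3^-1 * (s * (s * s)))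
  (fun s => s * (sh s - s)) 0 y.
rewrite !mul0r mulr0 sh0 !subr0 => h.
have {}h : 0 <= y * ch y - sh y - 3^-1 * (y * (y * y)).
  apply: h; last exact: ltW.
    move=> x _; refine (drv_eq (drvB (drvB (drvM (drv_id x) (is_derive_ch x)) (is_derive_sh x))
      (drvZ _ (drvM (drv_id x) (drvM (drv_id x) (drv_id x))))) _).
    by field.
  by move=> x /andP[x0 _]; rewrite mulr_ge0// subr_ge0 sh_ge.
have : 0 < 3^-1 * (y * (y * y)) by rewrite !mulr_gt0.
by move=> ?; rewrite -subr_gt0; lra.
Qed.
End Hyperbolic.

(** * The equation of zeta in real coordinates and its limit on the real axis *)

Section ZetaFunction.
Variables (R : realType) (t : R) (zeta : R[i] -> R[i]).
Hypothesis t0 : 0 < t.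
Hypothesis hz : is_zeta t zeta.
Implicit Types (z w theta : R[i]) (x y a b : R).

Lemma ccos_neq0 w : 0 < Im w -> ccos w != 0.
Proof.
move=> w0; rewrite -normc_eq0 -sqrf_eq0 normc_ccos gt_eqF//.
by rewrite ltr_wpDl ?sqr_ge0// exprn_gt0// sh_gt0.
Qed.

Lemma ctan_eqP w theta : ccos w != 0 ->
  w - t%:C * ctan w = theta <-> t%:C * csin w = (w - theta) * ccos w.
Proof.
move=> c0; split => [<-|h].
  by rewrite /ctan; field.
rewrite /ctan mulrA h -mulrA divff// mulr1; ring.
Qed.

Lemma zeta_unique theta w : 0 < Im theta -> 0 < Im w ->
  t%:C * csin w = (w - theta) * ccos w -> w = zeta theta.
Proof.
move=> th0 w0 /ctan_eqP -/(_ (ccos_neq0 w0)) h.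
have [/(_ _ th0) hs _] := hz.
suff : [set zeta theta] w by [].
by rewrite -hs.
Qed.

Lemma zeta_spec theta : 0 < Im theta ->
  0 < Im (zeta theta) /\ t%:C * csin (zeta theta) = (zeta theta - theta) * ccos (zeta theta).
Proof.
move=> th0; have [/(_ _ th0) hs _] := hz.
have : [set zeta theta] (zeta theta) by [].
rewrite -hs /= => -[z0 /ctan_eqP]; rewrite /upper_half/= in z0.
by move=> /(_ (ccos_neq0 z0)).
Qed.

(* Real form of [t tan(x+iy) = (x+iy) - (a+ib)], obtained by multiplying
   [t sin = (w - theta) cos] by the conjugate of [cos w]. *)
Definition zeta_rel a b x y :=
  [/\ (y - b) * (cos x ^+ 2 + sh y ^+ 2) = t * (sh y * ch y),
      (x - a) * (cos x ^+ 2 + sh y ^+ 2) = t * (sin x * cos x) &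
      t <= cos x ^+ 2 + sh y ^+ 2].

Lemma zeta_rel_ofc theta w : t%:C * csin w = (w - theta) * ccos w ->
  (Im w - Im theta) * (cos (Re w) ^+ 2 + sh (Im w) ^+ 2) = t * (sh (Im w) * ch (Im w)) /\
  (Re w - Re theta) * (cos (Re w) ^+ 2 + sh (Im w) ^+ 2) = t * (sin (Re w) * cos (Re w)).
Proof.
move=> h; have hR := congr1 (@complex.Re R) h; have hI := congr1 (@complex.Im R) h.
move: hR hI; rewrite csinE ccosE !ReImE !mul0r subr0 addr0.
have := ch2_sh2 (Im w); have := cos2Dsin2 (Re w).
move: (Im w - _) (Re w - _) (cos _) (sin _) (sh _) (ch _) => b a c s k g h1 h2 hR hI.
have e1 : c ^+ 2 * g ^+ 2 + s ^+ 2 * k ^+ 2 = c ^+ 2 + k ^+ 2.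
  transitivity (c ^+ 2 + k ^+ 2 * (c ^+ 2 + s ^+ 2)); first by rewrite h2; ring.
  by rewrite h1 mulr1.
split.
  rewrite -e1; transitivity (t * (c * k) * (c * g) + t * (s * g) * (s * k)).
    by rewrite hR hI; ring.
  by rewrite -[RHS]mulr1 -h1; ring.
rewrite -e1; transitivity (t * (s * g) * (c * g) - t * (c * k) * (s * k)).
  by rewrite hR hI; ring.
transitivity (t * (s * c) * (g ^+ 2 - k ^+ 2)); first ring.
by rewrite h2; ring.
Qed.

Lemma zeta_rel_toc theta w : 0 < cos (Re w) ^+ 2 + sh (Im w) ^+ 2 ->
  zeta_rel (Re theta) (Im theta) (Re w) (Im w) ->
  t%:C * csin w = (w - theta) * ccos w.
Proof.
move=> N0 [h1 h2 _]; apply: complex_eqP; apply: (mulIf (lt0r_neq0 N0));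
  move: h1 h2; rewrite csinE ccosE !ReImE !mul0r ?subr0 ?addr0;
  have := ch2_sh2 (Im w); have := cos2Dsin2 (Re w);
  move: (Im w - _) (Re w - _) (cos _) (sin _) (sh _) (ch _) {N0} => b a c s k g h1 h2 hR hI.
- transitivity ((a * (c ^+ 2 + k ^+ 2)) * (c * g) + (b * (c ^+ 2 + k ^+ 2)) * (s * k)); last ring.
  by rewrite hR hI; ring.
- transitivity (b * (c ^+ 2 + k ^+ 2) * (c * g) - (a * (c ^+ 2 + k ^+ 2)) * (s * k)); last ring.
  rewrite hR hI.
  transitivity (t * (c * k) * (g ^+ 2 - s ^+ 2)); last ring.
  by rewrite h2 -h1; ring.
Qed.
(** The inequality follows from the first equation, as y - Im theta < y <= sh y ch y. It matters in
    the limit y = 0, where the first equation becomes empty: it then selects the admissible real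
    solutions. *)
Lemma zeta_rel_open theta : 0 < Im theta ->
  zeta_rel (Re theta) (Im theta) (Re (zeta theta)) (Im (zeta theta)).
Proof.
move=> th0; have [z0 /zeta_rel_ofc[h1 h2]] := zeta_spec th0.
split => //; move: z0 h1 {h2}; set y := Im (zeta _); set N := cos _ ^+ 2 + _ => z0 h1.
have N0 : 0 <= N by apply: addr_ge0; exact: sqr_ge0.
rewrite -(ler_pM2l z0).
have h3 : y <= sh y * ch y.
  by rewrite (le_trans (sh_ge (ltW z0)))// ler_peMr ?ch_ge1// ltW// sh_gt0.
have : t * y <= t * (sh y * ch y) by rewrite ler_pM2l.
by rewrite -h1 mulrC => /le_trans -> //; rewrite ler_wpM2r// lerBlDr lerDl ltW.
Qed.

Lemma cos_sh_gt0 x y : 0 < y -> 0 < cos x ^+ 2 + sh y ^+ 2.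
Proof. by move=> y0; rewrite ltr_wpDl ?sqr_ge0// exprn_gt0// sh_gt0. Qed.

Lemma zeta_rel_unique a b x y : 0 < b -> 0 < y -> zeta_rel a b x y ->
  zeta (a +i* b) = x +i* y.
Proof.
move=> b0 y0 h; apply/esym/zeta_unique => //.
exact: (@zeta_rel_toc (a +i* b) (x +i* y) (cos_sh_gt0 _ y0)).
Qed.

Lemma zeta_Dpi a b : 0 < b -> zeta ((a + pi) +i* b) = zeta (a +i* b) + pi%:C.
Proof.
move=> b0; have [h0 _] := @zeta_spec (a +i* b) b0.
have [h1 h2 h3] := @zeta_rel_open (a +i* b) b0.
have -> : zeta (a +i* b) + pi%:C = (Re (zeta (a +i* b)) + pi) +i* Im (zeta (a +i* b)).
  by apply: complex_eqP; rewrite !ReImE ?addr0.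
apply: zeta_rel_unique => //.
rewrite /zeta_rel cosDpi sinDpi sqrrN mulrNN; split => //.
by rewrite -h2 /=; congr (_ * _); ring.
Qed.

Lemma zeta_opp a b : 0 < b ->
  zeta ((- a) +i* b) = (- Re (zeta (a +i* b))) +i* Im (zeta (a +i* b)).
Proof.
move=> b0; have [h0 _] := @zeta_spec (a +i* b) b0.
have [h1 h2 h3] := @zeta_rel_open (a +i* b) b0.
apply: zeta_rel_unique => //; rewrite /zeta_rel cosN sinN; split => //.
by rewrite mulNr mulrN -h2 /=; ring.
Qed.

Lemma zeta_continuous theta (e : R) : 0 <= Im theta -> 0 < e ->
  exists2 d : R, 0 < d & forall w, 0 <= Im w -> normc (w - theta) < d ->
    normc (zeta w - zeta theta) < e.
Proof.
by have [_ hc] := hz; move=> th0 e0; exact: (within_continuous_normc hc th0 e0).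
Qed.

Lemma cvg_right (F : R -> R) (l : R) :
  (forall e, 0 < e -> exists2 d : R, 0 < d & forall s, 0 < s < d -> `|F s - l| < e) ->
  F s @[s --> 0^'+] --> l.
Proof.
move=> h; apply/cvgrPdist_lt => e e0; have [d d0 hd] := h e e0.
near=> s; rewrite distrC; apply: hd; apply/andP; split.
  by near: s; exact: nbhs_right_gt.
by near: s; exact: nbhs_right_lt.
Unshelve. all: by end_near. Qed.

Lemma lim_right_le (F G : R -> R) (l m : R) : F s @[s --> 0^'+] --> l ->
  G s @[s --> 0^'+] --> m -> (forall s, 0 < s -> F s <= G s) -> l <= m.
Proof.
move=> Fl Gm h; apply: (ler_cvg_to Fl Gm); near=> s; apply: h.
by near: s; exact: nbhs_right_gt.
Unshelve. all: by end_near. Qed.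

Lemma lim_right_eq (F G : R -> R) (l m : R) : F s @[s --> 0^'+] --> l ->
  G s @[s --> 0^'+] --> m -> (forall s, 0 < s -> F s = G s) -> l = m.
Proof.
move=> Fl Gm h; apply/eqP; rewrite eq_le; apply/andP; split;
  [apply: (lim_right_le Fl Gm)|apply: (lim_right_le Gm Fl)] => s /h -> //.
Qed.

Lemma zeta_cvg_real a :
  Re (zeta (a +i* s)) @[s --> 0^'+] --> Re (zeta a%:C) /\
  Im (zeta (a +i* s)) @[s --> 0^'+] --> Im (zeta a%:C).
Proof.
have h (e : R) : 0 < e -> exists2 d : R, 0 < d & forall s, 0 < s < d ->
    normc (zeta (a +i* s) - zeta a%:C) < e.
  move=> e0; have [d d0 hd] := @zeta_continuous a%:C e (lexx 0) e0.
  exists d => // s /andP[s0 sd]; apply: hd; first by rewrite Im_mk ltW.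
  have -> : a +i* s - a%:C = s%:C * 'i by apply: complex_eqP; rewrite !ReImE; ring.
  by rewrite normcM normc_i mulr1 normc_real gtr0_norm.
split; apply: cvg_right => e /h[d d0 hd]; exists d => // s /hd; apply: le_lt_trans.
- by rewrite -ReN -ReD Re_normc.
- by rewrite -ImN -ImD Im_normc.
Qed.

Lemma continuous_sh : continuous (@sh R).
Proof.
move=> y; apply: differentiable_continuous; apply/derivable1_diffP.
by have := is_derive_sh y => ?; exact: ex_derive.
Qed.
Lemma continuous_ch : continuous (@ch R).
Proof.
move=> y; apply: differentiable_continuous; apply/derivable1_diffP.
by have := is_derive_ch y => ?; exact: ex_derive.
Qed.

(** The conditions in [zeta_rel] are closed, so they pass to the limit from above. *)
Lemma zeta_real a : zeta_rel a 0 (Re (zeta a%:C)) (Im (zeta a%:C)) /\ 0 <= Im (zeta a%:C).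
Proof.
have [cx cy] := zeta_cvg_real a.
set x := Re _ in cx *; set y := Im _ in cy *.
have ccx : cos (Re (zeta (a +i* s))) @[s --> 0^'+] --> cos x.
  by apply: continuous_cvg => //; exact: continuous_cos.
have csx : sin (Re (zeta (a +i* s))) @[s --> 0^'+] --> sin x.
  by apply: continuous_cvg => //; exact: continuous_sin.
have cshy : sh (Im (zeta (a +i* s))) @[s --> 0^'+] --> sh y.
  by apply: continuous_cvg => //; exact: continuous_sh.
have cchy : ch (Im (zeta (a +i* s))) @[s --> 0^'+] --> ch y.
  by apply: continuous_cvg => //; exact: continuous_ch.
have c0 : s @[s --> (0 : R)^'+] --> (0 : R) by apply: cvg_at_right_filter; exact: cvg_id.
have cN : cos (Re (zeta (a +i* s))) ^+ 2 + sh (Im (zeta (a +i* s))) ^+ 2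
    @[s --> 0^'+] --> cos x ^+ 2 + sh y ^+ 2.
  by apply: cvgD; under eq_fun do rewrite expr2; rewrite expr2; apply: cvgM.
have rel s (s0 : 0 < s) := @zeta_rel_open (a +i* s) s0.
split; last first.
  apply: (lim_right_le (cvg_cst 0) cy) => s s0.
  by have [/ltW] := @zeta_spec (a +i* s) s0.
split.
- apply: (lim_right_eq (cvgM (cvgB cy c0) cN) (cvgM (cvg_cst t) (cvgM cshy cchy))).
  by move=> s /rel[].
- apply: (lim_right_eq (cvgM (cvgB cx (cvg_cst a)) cN) (cvgM (cvg_cst t) (cvgM csx ccx))).
  by move=> s /rel[].
- by apply: (lim_right_le (cvg_cst t) cN) => s /rel[].
Qed.

Lemma Im_zeta_Dpi a : Im (zeta (a + pi)%:C) = Im (zeta a%:C).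
Proof.
have [_ c1] := zeta_cvg_real (a + pi); have [_ c2] := zeta_cvg_real a.
apply: (lim_right_eq c1 c2) => s s0.
by rewrite zeta_Dpi// !ReImE addr0.
Qed.

Lemma Im_zeta_opp a : Im (zeta (- a)%:C) = Im (zeta a%:C).
Proof.
have [_ c1] := zeta_cvg_real (- a); have [_ c2] := zeta_cvg_real a.
by apply: (lim_right_eq c1 c2) => s s0; rewrite zeta_opp.
Qed.

Lemma cexp2i w : cexp (2 * 'i * w) = cexp ('i * w) * cexp ('i * w).
Proof. by rewrite -cexpD; congr cexp; ring. Qed.

(* [e^{2iw}(1 - iT) = 1 + iT] is an exponential form of [tan w = T]. *)
Lemma csin_of_cexp w T : cexp (2 * 'i * w) * (1 - 'i * T) = 1 + 'i * T ->
  csin w = T * ccos w.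
Proof.
rewrite cexp2i /csin /ccos cexpN; have A0 := cexp_neq0 ('i * w).
move: (cexp _) A0 => A A0 h.
have I0 := i_neq0 R.
have e : A * A - 1 = 'i * T * (A * A + 1).
  apply/eqP; rewrite -subr_eq0; apply/eqP.
  transitivity (A * A * (1 - 'i * T) - (1 + 'i * T)); first ring.
  by rewrite h subrr.
transitivity ((A * A - 1) / (2 * 'i * A)); first by field; rewrite A0 I0.
by rewrite e; field; rewrite A0 I0.
Qed.
Lemma cexp_of_csin w T : csin w = T * ccos w ->
  cexp (2 * 'i * w) * (1 - 'i * T) = 1 + 'i * T.
Proof.
rewrite cexp2i /csin /ccos cexpN; have A0 := cexp_neq0 ('i * w).
move: (cexp _) A0 => A A0.
have I0 := i_neq0 R; move=> h.
have e : (A * A - 1) / (2 * 'i * A) = T * ((A * A + 1) / (2 * A)).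
  transitivity ((A - A^-1) / (2 * 'i)); first by field; rewrite A0 I0.
  by rewrite h; field.
have {}e : A * A - 1 = 'i * T * (A * A + 1).
  have nz : 2 * 'i * A != 0 by rewrite !mulf_neq0 ?pnatr_eq0.
  apply: (mulIf (invr_neq0 nz)); rewrite e; by field; rewrite A0 I0.
apply/eqP; rewrite -subr_eq0; apply/eqP.
transitivity (A * A - 1 - 'i * T * (A * A + 1)); first ring.
by rewrite e subrr.
Qed.

(** * Identification of zeta with the Herglotz transform of mu *)

Section Identification.
Variable mu : probability (circle R) R.
Hypothesis hmu : free_unitary_normal (4 * t) mu.

Lemma normc_cexp2i theta : normc (- cexp (2 * 'i * theta)) = expR (- (2 * Im theta)).
Proof. by rewrite normcN normc_cexp; congr expR; rewrite !ReImE; ring. Qed.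

(* [theta + i t H(-e^{2 i theta})], with [H = 1 + 2 psi] the Herglotz transform
   of [mu], solves the equation defining [zeta]. *)
Lemma zeta_psi theta : 0 < Im theta ->
  zeta theta = theta + 'i * t%:C * (1 + 2 * psi mu (- cexp (2 * 'i * theta))).
Proof.
move=> th0; set z := - cexp _.
have z1 : normc z < 1 by rewrite normc_cexp2i expR_lt1 oppr_lt0 mulr_gt0.
have fe := psi_functional hmu z1.
have hp := Re_psi_gt0 mu z1.
set H := 1 + 2 * psi mu z in hp *.
set W := theta + _.
apply/esym/zeta_unique => //.
  have -> : Im W = Im theta + t * Re H.
    by rewrite /W; move: (H) => K; rewrite !ReImE; ring.
  by rewrite addr_gt0// mulr_gt0.
have -> : W - theta = 'i * H * t%:C by rewrite /W; ring.
(* With T = i H, tan W = T becomes e^(2 i W) (1 + H) = 1 - H. As the variance is 4 t, the exponent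
   (4 t) (psi + 1/2) equals 2 t H, and this is the functional equation of psi. *)
rewrite mulrAC mulrC; congr (_ * _); apply: csin_of_cexp.
have -> : 2 * 'i * W = 2 * 'i * theta - 2 * t%:C * H.
  transitivity (2 * 'i * theta + 2 * ('i * 'i) * t%:C * H); first by rewrite /W; ring.
  by rewrite ii; ring.
have -> : 'i * ('i * H) = - H by rewrite mulrA ii mulN1r.
rewrite opprK cexpD cexpN.
have E0 := cexp_neq0 (2 * t%:C * H).
apply: (mulIf E0); rewrite mulrAC [_ / _ * _]divfK//.
have -> : cexp (2 * 'i * theta) = - z by rewrite opprK.
move: fe; rewrite (_ : (4 * t)%:C * (psi mu z + 2^-1) = 2 * t%:C * H); last first.
  by rewrite rmorphM/= (_ : (4 : R)%:C = 4); [rewrite /H; field|rewrite natC].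
rewrite /H; move: (cexp _) {hp W E0 H} => E fe.
transitivity (- (2 * (z * (1 + psi mu z)))); first ring.
by rewrite -fe; ring.
Qed.

Lemma Im_zeta_poisson theta : 0 < Im theta ->
  Im (zeta theta) = Im theta + t * \int[mu]_u poisson (- cexp (2 * 'i * theta)) u.
Proof.
move=> th0; have z1 : normc (- cexp (2 * 'i * theta)) < 1.
  by rewrite normc_cexp2i expR_lt1 oppr_lt0 mulr_gt0.
rewrite zeta_psi// -Re_psi_poisson// ImD; congr (_ + _).
by rewrite ImM !ReImE; ring.
Qed.

End Identification.
End ZetaFunction.

(** * The Poisson kernel as a trigonometric function and its primitive *)

Section PoissonKernel.
Variable R : realType.
Implicit Types (r a b x : R).

(** The Poisson kernel of the circle point a + i b at r e^(-i x), in real form; [poisson_pk] makes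
    the link. *)
Definition pk r a b x : R := (1 - r ^+ 2) / (1 + r ^+ 2 - 2 * r * (a * cos x + b * sin x)).

Lemma drvV (f : R -> R) x l : f x != 0 -> is_derive x (1 : R) f l ->
  is_derive x (1 : R) (fun s => (f s)^-1) (- l / f x ^+ 2).
Proof.
move=> f0 fl; have h := is_deriveV f0 fl; apply: (is_derive_eq h).
by rewrite /GRing.scale/= mulNr [RHS]mulNr mulrC.
Qed.

Lemma trig_sqr a b x : a ^+ 2 + b ^+ 2 = 1 ->
  (a * cos x + b * sin x) ^+ 2 + (a * sin x - b * cos x) ^+ 2 = 1.
Proof.
move=> ab; transitivity ((a ^+ 2 + b ^+ 2) * (cos x ^+ 2 + sin x ^+ 2)); first ring.
by rewrite ab cos2Dsin2 mulr1.
Qed.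

Lemma trig_le1 a b x : a ^+ 2 + b ^+ 2 = 1 -> a * cos x + b * sin x <= 1.
Proof.
move=> ab; have h := trig_sqr x ab; rewrite (le_trans (ler_norm _))//.
rewrite -(@ler_pXn2r _ 2) ?nnegrE// expr1n real_normK ?num_real// -h lerDl sqr_ge0//.
Qed.

Lemma pk_den_gt0 r a b x : a ^+ 2 + b ^+ 2 = 1 -> 0 <= r < 1 ->
  0 < 1 + r ^+ 2 - 2 * r * (a * cos x + b * sin x).
Proof.
move=> ab /andP[r0 r1]; have := trig_le1 x ab; move: (_ + _ * sin _) => c c1.
have : 0 < (1 - r) ^+ 2 by rewrite exprn_gt0// subr_gt0.
nra.
Qed.

Lemma pk_ge0 r a b x : a ^+ 2 + b ^+ 2 = 1 -> 0 <= r < 1 -> 0 <= pk r a b x.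
Proof.
move=> ab r01; rewrite divr_ge0 ?(ltW (pk_den_gt0 _ _ _))// subr_ge0.
by case/andP: r01 => r0 r1; rewrite expr_le1// ltW.
Qed.

(** With a + i b = e^(i alpha), the arctangent is minus the argument of 1 - r e^(i (x - alpha)). It
    is 2 pi-periodic, so over a period only the term [x] contributes. *)
Definition pk_prim r a b x : R :=
  x + 2 * atan (r * (a * sin x - b * cos x) * (1 - r * (a * cos x + b * sin x))^-1).

Lemma is_derive_pk_prim r a b x : a ^+ 2 + b ^+ 2 = 1 -> 0 <= r < 1 ->
  is_derive x (1 : R) (pk_prim r a b) (pk r a b x).
Proof.
move=> ab r01; have [r0 r1] := andP r01.
have d0 : 1 - r * (a * cos x + b * sin x) != 0.
  have := trig_le1 x ab; move: (_ + _ * sin _) => c c1; apply: lt0r_neq0; nra.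
have dS : is_derive x (1 : R) (fun x => r * (a * sin x - b * cos x)) (r * (a * cos x + b * sin x)).
  refine (drv_eq (drvZ r (drvB (drvZ a (is_derive_sin x)) (drvZ b (is_derive_cos x)))) _); ring.
have dC : is_derive x (1 : R) (fun x => 1 - r * (a * cos x + b * sin x)) (r * (a * sin x - b * cos x)).
  refine (drv_eq (drvB (drv_cst _ _) (drvZ r (drvD (drvZ a (is_derive_cos x)) (drvZ b (is_derive_sin x))))) _); ring.
have dV := @drvV (fun x => 1 - r * (a * cos x + b * sin x)) x _ d0 dC.
refine (drv_eq (drvD (drv_id x) (drvZ 2 (drv_comp (is_derive1_atan _) (drvM dS dV)))) _).
rewrite /pk; have den := pk_den_gt0 x ab r01; have := trig_sqr x ab.
move: d0 den; move: (_ + b * sin _) (a * sin x - _) => c s d0 den h.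
have e : (1 - r * c) ^+ 2 + (r * s) ^+ 2 = 1 + r ^+ 2 - 2 * r * c.
  by transitivity (1 - 2 * r * c + r ^+ 2 * (c ^+ 2 + s ^+ 2)); [ring|rewrite h; ring].
have e2 : 1 + (r * s * (1 - r * c)^-1) ^+ 2 = (1 + r ^+ 2 - 2 * r * c) / (1 - r * c) ^+ 2.
  by rewrite -e; field.
rewrite e2 invf_div; move: (gt_eqF den) => den0.
have s2 : s ^+ 2 = 1 - c ^+ 2 by rewrite -h; ring.
have -> : (r * c * (1 - r * c)^-1 + r * s * (- (r * s) / (1 - r * c) ^+ 2)) *
   ((1 - r * c) ^+ 2 / (1 + r ^+ 2 - 2 * r * c)) = (r * c - r ^+ 2 * (c ^+ 2 + s ^+ 2)) / (1 + r ^+ 2 - 2 * r * c).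
  by field; rewrite d0 den0.
by rewrite h; field; rewrite den0.
Qed.

Lemma derivable_LR (F f : R -> R) (a b : R) : a <= b ->
  (forall x, a <= x <= b -> is_derive x (1 : R) F (f x)) -> derivable_oo_LRcontinuous F a b.
Proof.
move=> ab h; have d x : a <= x <= b -> derivable F x 1 by move=> /h ?; exact: ex_derive.
have c x : a <= x <= b -> F y @[y --> x] --> F x.
  by move=> xab; apply: differentiable_continuous; exact/derivable1_diffP/d.
split => [x||]; first by rewrite in_itv/= => /andP[? ?]; apply: d; rewrite !ltW.
  by apply/cvg_at_right_filter/c; rewrite lexx.
by apply/cvg_at_left_filter/c; rewrite lexx andbT.
Qed.

Lemma pk_continuous r a b : a ^+ 2 + b ^+ 2 = 1 -> 0 <= r < 1 -> continuous (pk r a b).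
Proof.
move=> ab r01 x; apply: cvgM; first exact: cvg_cst.
apply: cvgV; first by rewrite gt_eqF// pk_den_gt0.
apply: cvgB; first exact: cvg_cst.
apply: cvgM; first exact: cvg_cst.
apply: cvgD; apply: cvgM; try exact: cvg_cst; [exact: continuous_cos|exact: continuous_sin].
Qed.

Lemma pk_integral r a b : a ^+ 2 + b ^+ 2 = 1 -> 0 <= r < 1 ->
  (\int[lebesgue_measure]_(x in `[(- pi)%R, pi[) (pk r a b x)%:E = (2 * pi)%:E)%E.
Proof.
move=> ab r01; have cpk := pk_continuous ab r01.
rewrite integral_itv_bndo_bndc; last first.
  apply/measurable_EFinP; apply: measurable_funTS.
  exact: continuous_measurable_fun.
rewrite (@continuous_FTC2 _ _ (pk_prim r a b)).
- rewrite -EFinB; congr EFin; rewrite /pk_prim cosN sinN cospi sinpi oppr0; ring.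
- by have := pi_gt0 R; lra.
- by apply: continuous_subspaceT.
- apply: derivable_LR (fun x _ => is_derive_pk_prim x ab r01).
  by have := pi_ge0 R; lra.
- move=> x _; rewrite derive1E.
  exact: (@derive_val _ _ _ _ _ _ _ (is_derive_pk_prim x ab r01)).
Qed.
End PoissonKernel.

(** * Poisson integrals over part of the period *)

Section PoissonIntegrals.
Variable R : realType.
Local Notation leb := (@lebesgue_measure R).
Local Notation D := (`[(- pi)%R, pi[%classic : set R).

Lemma lebesgue_D : leb D = (2 * pi)%:E.
Proof.
rewrite lebesgue_measure_itv/= lte_fin ifT; last by have := pi_gt0 R; lra.
by rewrite -EFinB; congr EFin; ring.
Qed.

Lemma measurable_D : measurable (D : set (measurableTypeR R)). Proof. exact: measurable_itv. Qed.

Lemma measurable_pk r a b (W : set R) : a ^+ 2 + b ^+ 2 = 1 -> 0 <= r < 1 ->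
  measurable_fun W (fun x => (pk r a b x)%:E).
Proof.
move=> ab r01; apply/measurable_EFinP; apply: measurable_funTS.
by apply: continuous_measurable_fun; exact: pk_continuous.
Qed.

Lemma pk_integral_le r a b (V : set R) : measurable V -> a ^+ 2 + b ^+ 2 = 1 ->
  0 <= r < 1 -> (\int[leb]_(x in D `&` V) (pk r a b x)%:E <= (2 * pi)%:E)%E.
Proof.
move=> mV ab r01; rewrite -(pk_integral ab r01).
apply: ge0_subset_integral => //; [exact: measurableI|exact: measurable_pk|].
by move=> x _; rewrite lee_fin pk_ge0.
Qed.

Lemma pk_integral_ge r a b (V : set R) rho : measurable V -> a ^+ 2 + b ^+ 2 = 1 ->
  0 < r < 1 -> 0 < rho ->
  (forall x, - pi <= x < pi -> ~ V x -> a * cos x + b * sin x <= 1 - rho) ->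
  ((2 * pi - (1 - r ^+ 2) / (2 * r * rho) * (2 * pi))%:E <=
   \int[leb]_(x in D `&` V) (pk r a b x)%:E)%E.
Proof.
move=> mV ab /andP[r0 r1] rho0 hV.
have r01 : 0 <= r < 1 by rewrite ltW.
(* Writing c for [a * cos x + b * sin x], the denominator off [V] is (1 - r)^2 + 2 r (1 - c) >= 2 r
   rho. Hence the kernel is at most [K] there, and [K] tends to 0 as r tends to 1. *)
set K := (1 - r ^+ 2) / (2 * r * rho).
have r21 : 0 <= 1 - r ^+ 2 by rewrite subr_ge0 expr_le1// ltW.
have K0 : 0 <= K by rewrite divr_ge0// !mulr_ge0// ltW.
have mDV : measurable (D `&` V) by exact: measurableI.
have mDC : measurable (D `\` V) by exact: measurableD.
have pk0 x : (0 <= (pk r a b x)%:E)%E by rewrite lee_fin pk_ge0.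
have split_D : (2 * pi)%:E = (\int[leb]_(x in D `&` V) (pk r a b x)%:E +
    \int[leb]_(x in D `\` V) (pk r a b x)%:E)%E.
  rewrite -(pk_integral ab r01) -ge0_integral_setU//.
  - by congr integral; rewrite setUIDK.
  - exact: measurable_pk.
  - by apply/disj_setPS => x [[_ Vx] [_ nVx]].
rewrite EFinB leeBlDr// split_D leeD2l//.
have -> : (K * (2 * pi))%:E = (\int[leb]_(x in D) (cst K%:E) x)%E.
  by rewrite integral_cst// EFinM; congr (_ * _)%E; exact/esym/lebesgue_D.
apply: (@le_trans _ _ (\int[leb]_(x in D `\` V) (cst K%:E) x)%E).
  apply: ge0_le_integral => //; first exact: measurable_pk.
  move=> x [/=]; rewrite in_itv/= => xD nV; rewrite lee_fin /pk /K.
  have hC := hV x xD nV; have den := pk_den_gt0 x ab r01.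
  apply: ler_wpM2l => //; rewrite lef_pV2 ?posrE// ?mulr_gt0//.
  move: (_ + b * sin x) hC {den} => c hC.
  have : 0 <= (1 - r) ^+ 2 by rewrite sqr_ge0.
  have : 0 <= r * (1 - rho - c) by rewrite mulr_ge0 ?(ltW r0)// subr_ge0.
  by nra.
apply: ge0_subset_integral => //; exact: subDsetl.
Qed.
End PoissonIntegrals.

(** * Radial limits of Poisson integrals of a probability *)

Section PoissonLimit.
Context d (T : measurableType d) (R : realType) (P : probability T R).
Variables (a b : T -> R) (r : nat -> R) (V : set R) (h : R -> R) (M : R).
Local Notation leb := (@lebesgue_measure R).
Local Notation D := (`[(- pi)%R, pi[%classic : set R).
Hypotheses (ma : measurable_fun setT a) (mb : measurable_fun setT b).
Hypothesis ab : forall u, a u ^+ 2 + b u ^+ 2 = 1.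
Hypothesis r01 : forall n, 0 < r n < 1.
Hypothesis r1 : r n @[n --> \oo] --> (1 : R).
Hypothesis mV : measurable (V : set (measurableTypeR R)).
Hypothesis hM : forall n x, (\int[P]_u (pk (r n) (a u) (b u) x)%:E <= M%:E)%E.
Hypothesis hcvg : forall x, D x ->
  (\int[P]_u (pk (r n) (a u) (b u) x)%:E)%E @[n --> \oo] --> (h x)%:E.
Hypothesis mh : measurable_fun D h.

Let r01' n : 0 <= r n < 1. Proof. by have /andP[/ltW -> ->] := r01 n. Qed.

Let W := D `&` V.
Let mW : measurable W. Proof. by apply: measurableI => //; exact: measurable_D. Qed.

(** The indicator of [W] sits in the integrand so that the exchange of integrals takes place on the
    full product space. *)
Let fk n (p : T * measurableTypeR R) : \bar R :=
  (pk (r n) (a p.1) (b p.1) p.2 * \1_W p.2)%:E.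

Let measurable_pk2 n : measurable_fun setT
  (fun p : T * measurableTypeR R => pk (r n) (a p.1) (b p.1) p.2).
Proof.
pose den (p : T * measurableTypeR R) := 1 + r n ^+ 2 - 2 * r n * (a p.1 * cos p.2 + b p.1 * sin p.2).
(* The inverse of the positive denominator is written exp (- ln), a composition of measurable
   functions. *)
have -> : (fun p : T * measurableTypeR R => pk (r n) (a p.1) (b p.1) p.2) =
    (fun p => (1 - r n ^+ 2) * expR (-1 * ln (den p))).
  apply/funext => p; rewrite /pk mulN1r expRN lnK// posrE; exact: pk_den_gt0.
have m1 : measurable_fun setT (fun p : T * measurableTypeR R => a p.1).
  exact: measurableT_comp ma measurable_fst.
have m2 : measurable_fun setT (fun p : T * measurableTypeR R => b p.1).
  exact: measurableT_comp mb measurable_fst.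
have m3 : measurable_fun setT (fun p : T * measurableTypeR R => cos p.2).
  apply: measurableT_comp measurable_snd.
  by apply: continuous_measurable_fun; exact: continuous_cos.
have m4 : measurable_fun setT (fun p : T * measurableTypeR R => sin p.2).
  apply: measurableT_comp measurable_snd.
  by apply: continuous_measurable_fun; exact: continuous_sin.
have mden : measurable_fun setT den.
  apply: measurable_funB; first exact: measurable_cst.
  apply: measurable_funM; first exact: measurable_cst.
  by apply: measurable_funD; apply: measurable_funM.
apply: measurable_funM; first exact: measurable_cst.
apply: measurableT_comp; first exact: measurable_expR.
apply: measurable_funM; first exact: measurable_cst.
by apply: measurableT_comp; first exact: measurable_ln.
Qed.

Let mfk n : measurable_fun setT (fk n).
Proof.
apply/measurable_EFinP; apply: measurable_funM; first exact: measurable_pk2.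
apply: measurableT_comp measurable_snd; exact: measurable_indic.
Qed.

Let fk0 n p : (0 <= fk n p)%E.
Proof. by rewrite lee_fin mulr_ge0// pk_ge0. Qed.

Let G n u : \bar R := (\int[leb]_(x in W) (pk (r n) (a u) (b u) x)%:E)%E.
Let H n x : \bar R := (\int[P]_u (pk (r n) (a u) (b u) x)%:E)%E.

Let GE n u : G n u = (\int[leb]_x fk n (u, x))%E.
Proof.
rewrite /G integral_mkcond; apply: eq_integral => x _.
by rewrite patchE /fk /= indicE; case: ifPn => _; rewrite ?mulr1 ?mulr0.
Qed.

Let HE n x : (H n \_ W) x = (\int[P]_u fk n (u, x))%E.
Proof.
rewrite patchE /fk /= indicE; case: ifPn => _.
  by apply: eq_integral => u _; rewrite mulr1.
by rewrite integral0_eq// => u _; rewrite mulr0.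
Qed.

Let fubini n : (\int[P]_u G n u = \int[leb]_(x in W) H n x)%E.
Proof.
transitivity (\int[P]_u \int[leb]_x fk n (u, x))%E.
  by apply: eq_integral => u _; exact: GE.
rewrite (fubini_tonelli (fk n))// [RHS]integral_mkcond.
by apply: eq_integral => x _; rewrite HE.
Qed.

Let mG n : measurable_fun setT (G n).
Proof.
have := @measurable_fun_fubini_tonelli_F _ _ T (measurableTypeR R) R leb (fk n) (mfk n) (fk0 n).
by apply: eq_measurable_fun => u _; rewrite GE.
Qed.

Let mH n : measurable_fun setT (H n).
Proof.
have pk0 (p : T * measurableTypeR R) : (0 <= (pk (r n) (a p.1) (b p.1) p.2)%:E)%E.
  by rewrite lee_fin pk_ge0.
have mp : measurable_fun setT (fun p : T * measurableTypeR R => (pk (r n) (a p.1) (b p.1) p.2)%:E).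
  by apply/measurable_EFinP; exact: measurable_pk2.
exact: (@measurable_fun_fubini_tonelli_G _ _ T (measurableTypeR R) R P _ mp pk0).
Qed.

(** Once the integrals are exchanged, the integral over [P] is bounded by [M] and converges
    pointwise to [h], on a set of finite length. *)
Lemma poisson_limit :
  (\int[P]_u \int[leb]_(x in D `&` V) (pk (r n) (a u) (b u) x)%:E)%E @[n --> \oo] -->
  (\int[leb]_(x in D `&` V) (h x)%:E)%E.
Proof.
under eq_fun do rewrite fubini.
have lebW : (leb W < +oo)%E.
  apply: (@le_lt_trans _ _ (leb D)); last by rewrite lebesgue_D ltry.
  by apply: le_measure; rewrite ?inE; [exact: mW|exact: measurable_D|exact: subIsetl].
have [] := @dominated_convergence _ _ _ leb W mW H (EFin \o h) (cst M%:E).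
- by move=> n; apply: measurable_funTS; exact: mH.
- apply/measurable_EFinP; apply: (measurable_funS _ _ mh); [exact: measurable_itv|exact: subIsetl].
- by apply: aeW => x [Dx _]; exact: hcvg.
- by apply: (@measurable_bounded_integrable _ _ _ _ (cst M)) => //; exact: bounded_cst.
- apply: aeW => x n _; rewrite gee0_abs ?hM//.
  by apply: integral_ge0 => u _; rewrite lee_fin pk_ge0.
by [].
Qed.
Let G_le n u : (G n u <= (2 * pi)%:E)%E.
Proof. exact: pk_integral_le. Qed.

Let G_ge0 n u : (0 <= G n u)%E.
Proof. by apply: integral_ge0 => x _; rewrite lee_fin pk_ge0. Qed.

(** Approximate identity: when u stays at positive distance from the points outside [V], the whole
    mass 2 pi of the kernel ends up in [V]. *)
Let G_cvg u rho : 0 < rho ->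
  (forall x, - pi <= x < pi -> ~ V x -> a u * cos x + b u * sin x <= 1 - rho) ->
  G n u @[n --> \oo] --> (2 * pi)%:E.
Proof.
move=> rho0 hV.
pose L n := 2 * pi - (1 - r n ^+ 2) / (2 * r n * rho) * (2 * pi).
have hL : (L n)%:E @[n --> \oo] --> (2 * pi)%:E.
  apply: cvg_EFin; first by apply: nearW.
  have -> : 2 * pi = 2 * pi - (1 - 1 ^+ 2) / (2 * 1 * rho) * (2 * pi) :> R.
    by rewrite expr1n subrr !mul0r subr0.
  rewrite /L /=; apply: cvgB; first exact: cvg_cst.
  apply: cvgM; last exact: cvg_cst.
  apply: cvgM.
    apply: cvgB; first exact: cvg_cst.
    by under eq_fun do rewrite expr2; rewrite expr2; apply: cvgM.
  apply: cvgV; first by rewrite mulr1 mulf_neq0// gt_eqF.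
  by apply: cvgM; [apply: cvgM => //; exact: cvg_cst|exact: cvg_cst].
apply: (squeeze_cvge _ hL (cvg_cst _)); apply: nearW => n.
by rewrite G_le andbT; exact: pk_integral_ge.
Qed.

(** For u in [U] the integral over [V] tends to its largest possible value 2 pi; for the other u
    only its sign is used. *)
Lemma poisson_open_le (U : set T) : measurable U ->
  (forall u, U u -> exists2 rho, 0 < rho &
    forall x, - pi <= x < pi -> ~ V x -> a u * cos x + b u * sin x <= 1 - rho) ->
  ((2 * pi)%:E * P U <= \int[leb]_(x in D `&` V) (h x)%:E)%E.
Proof.
move=> mU hU; rewrite -integral_cst//.
have [] := @dominated_convergence _ _ _ P U mU G (cst (2 * pi)%:E) (cst (2 * pi)%:E).
- by move=> n; apply: measurable_funTS; exact: mG.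
- exact: measurable_cst.
- by apply: aeW => u /hU[rho rho0 h1]; exact: G_cvg rho0 h1.
- exact: finite_measure_integrable_cst.
- by apply: aeW => u n _; rewrite gee0_abs// G_le.
move=> _ _ hc; apply: (lee_cvg_to hc poisson_limit); apply: nearW => n.
by apply: ge0_subset_integral => //; exact: mG.
Qed.
End PoissonLimit.

(** Over a full period the inner integral is 2 pi at every radius, so the sequence converging to the
    integral of [h] is constant. *)
Lemma poisson_total d (T : measurableType d) (R : realType) (P : probability T R)
    (a b : T -> R) (r : nat -> R) (h : R -> R) (M : R) :
  measurable_fun setT a -> measurable_fun setT b ->
  (forall u, a u ^+ 2 + b u ^+ 2 = 1) -> (forall n, 0 < r n < 1) ->
  (forall n x, (\int[P]_u (pk (r n) (a u) (b u) x)%:E <= M%:E)%E) ->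
  (forall x, - pi <= x < pi ->
    (\int[P]_u (pk (r n) (a u) (b u) x)%:E)%E @[n --> \oo] --> (h x)%:E) ->
  measurable_fun (`[(- pi)%R, pi[%classic : set R) h ->
  (\int[lebesgue_measure]_(x in `[(- pi)%R, pi[) (h x)%:E = (2 * pi)%:E)%E.
Proof.
move=> ma mb ab r01 hM hc mh.
have lim := @poisson_limit _ T R P a b r setT h M ma mb ab r01 measurableT hM hc mh.
rewrite setIT in lim; rewrite -(cvg_lim (@ereal_hausdorff R) lim).
apply: cvg_lim; first exact: ereal_hausdorff.
apply: cvg_near_cst; apply: nearW => n.
transitivity (\int[P]_u (cst (2 * pi)%:E) u)%E.
  apply: eq_integral => u _; apply: pk_integral => //.
  by have /andP[/ltW -> ->] := r01 n.
by rewrite integral_cst// -[RHS]mule1 -(probability_setT P).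
Qed.

(** * Angles on the circle and descent of periodic functions *)

Section CircleParametrization.
Variable R : realType.
Implicit Types (u v : circle R) (x y : R).

Lemma normc_conjc (z : R[i]) : normc (conjc z) = normc z.
Proof. by case: z => x y; rewrite /= sqrrN. Qed.

Lemma mul_conjc_unit (z : R[i]) : normc z = 1 -> z * conjc z = 1.
Proof. by move=> z1; rewrite -sqr_normc normc_norm z1 expr1n. Qed.

Lemma normc_mul_conjcB1 (w z : R[i]) : normc z = 1 ->
  normc (w * conjc z - 1) = normc (w - z).
Proof.
move=> z1; rewrite -[in LHS](mul_conjc_unit z1) -mulrBl normcM normc_conjc.
by rewrite z1 mulr1.
Qed.

Lemma circle_inj u v : set_val u = set_val v -> u = v.
Proof. by move=> uv; exact: val_inj. Qed.

Lemma circle_sqr u : Re (set_val u) ^+ 2 + Im (set_val u) ^+ 2 = 1.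
Proof. by rewrite -normc_sqr normc_circle expr1n. Qed.

Lemma set_val_cis x : set_val (cis x) = cos x +i* sin x. Proof. by []. Qed.

Lemma cis_surj u : exists x, - pi <= x < pi /\ cis x = u.
Proof.
have ab := circle_sqr u; set a := Re _ in ab; set b := Im _ in ab.
have pi0 := pi_gt0 R.
have a1 : -1 <= a <= 1.
  rewrite -ler_norml -(@ler_pXn2r _ 2) ?nnegrE// expr1n real_normK ?num_real//.
  by rewrite -ab lerDl sqr_ge0.
have ca := acosK (a1 : a \in `[(-1)%R, 1]).
have sa : sin (acos a) = `|b|.
  by rewrite sin_acos// -[1]ab addrC addKr sqrtr_sqr.
have e x : cos x = a -> sin x = b -> cis x = u.
  by move=> cx sx; apply: circle_inj; rewrite set_val_cis cx sx; case: (set_val u) @a @b {ab a1 ca sa cx sx}.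
have p0 := acos_ge0 a1; have p1 := acos_lepi a1.
have [b0|b0] := leP 0 b.
  have [p2|p2] := ltP (acos a) pi.
    exists (acos a); split; first by apply/andP; split; lra.
    by apply: e => //; rewrite sa ger0_norm.
  (* The point -1 receives the angle - pi, the period being closed on the left only. *)
  have pE : acos a = pi by apply/eqP; rewrite eq_le p1.
  exists (- pi); split; first by apply/andP; split; lra.
  have b00 : b = 0 by rewrite -(ger0_norm b0) -sa pE sinpi.
  by apply: e; rewrite ?cosN ?sinN -?pE// pE sinpi oppr0 b00.
exists (- acos a); split; first by apply/andP; split; lra.
by apply: e; rewrite ?cosN ?sinN// sa ltr0_norm// opprK.
Qed.

Lemma cos_eq1 x : 0 <= x < 2 * pi -> cos x = 1 -> x = 0.
Proof.
move=> /andP[x0 x2]; have -> : x = x / 2 + x / 2 by field.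
rewrite cosD => h; have := cos2Dsin2 (x / 2) => h2.
have s0 : sin (x / 2) = 0.
  by apply/eqP; rewrite -sqrf_eq0; apply/eqP; move: h h2; rewrite !expr2; lra.
have [x20|x20] := eqVneq x 0; first by rewrite x20; field.
have : 0 < sin (x / 2).
  by apply: sin_gt0_pi; apply/andP; split; [rewrite divr_gt0// lt_neqAle eq_sym x20|lra].
by rewrite s0 ltxx.
Qed.

Lemma periodic_int (g : R -> R) (T : R) : (forall x, g (x + T) = g x) ->
  forall (k : int) x, g (x + k%:~R * T) = g x.
Proof.
move=> h; have hn (n : nat) x : g (x + n%:R * T) = g x.
  elim: n => [|n IH]; first by rewrite mul0r addr0.
  by rewrite -natr1 mulrDl mul1r addrA h IH.
case=> n x; first exact: hn.
have e : (Negz n)%:~R = - n.+1%:R :> R by rewrite NegzE mulrNz.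
by have := hn n.+1 (x + (Negz n)%:~R * T); rewrite e mulNr subrK.
Qed.

Lemma cis_eq x y : cis x = cis y -> exists k : int, x = y + k%:~R * (2 * pi).
Proof.
move=> /(congr1 set_val); rewrite !set_val_cis => -[cxy sxy].
have pi0 : 0 < 2 * pi :> R by rewrite mulr_gt0// pi_gt0.
(* Subtracting this multiple of the period leaves an angle in [0, 2 pi) whose cosine is 1. *)
pose k := Num.floor ((x - y) / (2 * pi)); exists k.
have h1 := floor_le ((x - y) / (2 * pi)); have h2 := floorD1_gt ((x - y) / (2 * pi)).
rewrite -/k ler_pdivlMr// in h1; rewrite -/k ltr_pdivrMr// intrD mulrDl mul1r in h2.
suff : x - y - k%:~R * (2 * pi) = 0 by lra.
apply: cos_eq1; first by apply/andP; split; lra.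
have cosP z : cos (z + 2 * pi) = cos z :> R.
  by rewrite mulr_natl cosD2pi.
rewrite -mulNr -mulrNz (periodic_int cosP) cosB cxy sxy.
by rewrite -!expr2 cos2Dsin2.
Qed.

Lemma nbhs_near_normc u (e : R) (Q : circle R -> Prop) : 0 < e ->
  (forall v, normc (set_val v - set_val u) < e -> Q v) -> nbhs u Q.
Proof.
by move=> e0 h; apply: (@filterS _ _ (@nbhs_filter (circle R) u) _ _ h (nbhs_circle u e0)).
Qed.

(** The chosen angle [arg] jumps at -1, so continuity is obtained by rotation: a nearby v is w u
    with w near 1, and [arg u + asin (Im w)] is an angle of v close to [arg u]; by periodicity [g]
    does not see which angle is taken. *)
Lemma circle_lift (g : R -> R) : continuous g -> (forall x, g (x + 2 * pi) = g x) ->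
  exists2 f : circle R -> R, continuous f & forall x, f (cis x) = g x.
Proof.
move=> cg pg; pose arg u := projT1 (cid (cis_surj u)).
have argP u : cis (arg u) = u by rewrite /arg; case: cid => x [].
have fE x : g (arg (cis x)) = g x.
  by have [k ->] := cis_eq (argP (cis x)); rewrite periodic_int.
exists (fun u => g (arg u)) => // u.
have FF : ProperFilter (nbhs u) by exact: nbhs_pfilter.
apply/(@cvgrPdist_lt _ _ _ (nbhs u)) => e e0.
set al := arg u.
have /cvgrPdist_lt/(_ e e0) := cg al; rewrite near_simpl.
move=> /nbhs_ballP[d /= d0 hd].
have /cvgrPdist_lt/(_ d d0) := @continuous_asin R 0 ltac:(by rewrite ltrN10 ltr01).
rewrite near_simpl => /nbhs_ballP[d1 /= d10 hd1].
have e1 : 0 < Num.min d1 1 by rewrite lt_min d10 ltr01.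
apply: (nbhs_near_normc e1) => v; rewrite lt_min => /andP[v1 v2] /=.
pose w := set_val v * conjc (set_val u).
have uu := mul_conjc_unit (normc_circle u).
have wE : set_val v = w * set_val u by rewrite /w -mulrA [conjc _ * _]mulrC uu mulr1.
have nw : normc (w - 1) = normc (set_val v - set_val u).
  exact: (normc_mul_conjcB1 _ (normc_circle u)).
have w1 : Re w ^+ 2 + Im w ^+ 2 = 1.
  by rewrite -normc_sqr /w normcM normc_conjc !normc_circle mulr1 expr1n.
have sw : `|Im w| < d1.
  by rewrite (le_lt_trans _ v1)// -nw -[Im w](subr0) -[0](Im1 R) -ImN -ImD Im_normc.
have cw : 0 < Re w.
  have : `|Re w - 1| < 1.
    by rewrite (le_lt_trans _ v2)// -nw -[X in _ - X](Re1 R) -ReN -ReD Re_normc.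
  by rewrite ltr_norml => /andP[h _]; lra.
pose be := asin (Im w).
have Iw1 : -1 <= Im w <= 1.
  rewrite -ler_norml -(@ler_pXn2r _ 2) ?nnegrE// expr1n real_normK ?num_real//.
  by rewrite -w1 lerDr sqr_ge0.
have sb : sin be = Im w by rewrite /be asinK.
have cb : cos be = Re w.
  by rewrite /be cos_asin// -w1 addrK sqrtr_sqr gtr0_norm.
have vE : v = cis (al + be).
  apply: circle_inj; rewrite wE set_val_cis -{1}(argP u) set_val_cis -/al cosD sinD sb cb.
  by apply: complex_eqP; rewrite !ReImE; ring.
rewrite {1}vE fE; apply: hd; rewrite /ball/= opprD addrA subrr sub0r normrN.
have := hd1 (Im w); rewrite /ball/= sub0r normrN => /(_ sw).
have asin0 : asin 0 = 0 :> R.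
  rewrite -[in LHS](sin0 R) sinK// in_itv/= oppr_le0.
  by have := pi_gt0 R => ?; rewrite andbb divr_ge0// ltW.
by rewrite asin0 sub0r normrN.
Qed.
End CircleParametrization.

(** * Integration against a restricted measure *)

Section MeasureRestriction.
Context d (T : measurableType d) (R : realType) (m : {measure set T -> \bar R}).

Lemma ge0_integral_mrestr (D E : set T) (mD : measurable D) (f : T -> \bar R) :
  measurable E -> measurable_fun E f -> (forall x, E x -> (0 <= f x)%E) ->
  (\int[mrestr m mD]_(x in E) f x = \int[m]_(x in D `&` E) f x)%E.
Proof.
move=> mE mf f0.
have mDE : measurable (E `&` D) by exact: measurableI.
have mDC : measurable (E `\` D) by exact: measurableD.
have -> : (\int[mrestr m mD]_(x in E) f x =
    \int[mrestr m mD]_(x in E `&` D) f x + \int[mrestr m mD]_(x in E `\` D) f x)%E.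
  rewrite -ge0_integral_setU//; rewrite ?setUIDK//.
  by apply/disj_setPS => x [[_ Dx] [_ nDx]].
rewrite [X in (_ + X)%E]null_set_integral//; last 2 first.
- by apply: measurable_funS mf => //; exact: subDsetl.
- rewrite /= /mrestr (_ : _ `&` D = set0) ?measure0//.
  by apply/seteqP; split => x // [[_ nDx] Dx].
rewrite adde0 [in RHS]setIC; apply: eq_measure_integral => A mA AED.
by rewrite /= /mrestr setIidl// => x /AED[].
Qed.
End MeasureRestriction.

(** * Comparison of probability measures on the circle *)

Section CircleMeasures.
Variable R : realType.
Implicit Types (u v : circle R) (x y : R).

Lemma open_circle_ball (U : set (circle R)) u : open U -> U u ->
  exists2 e : R, 0 < e & forall v, normc (set_val v - set_val u) < e -> U v.
Proof.
move=> [A oA <-] /= Au.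
have : nbhs (set_val u : R[i]) A by exact: open_nbhs_nbhs.
move=> /nbhs_ballP[[a b]]; rewrite /= ltcE /= => /andP[/eqP -> a0] h.
exists a => // v va; apply: h; rewrite /ball /= normc_norm normcB.
by rewrite -/(a%:C) ltcR.
Qed.

Lemma nbhd_open (F : set (circle R)) (e : R) : 0 < e ->
  open [set u : circle R | exists2 v : circle R, F v & normc (set_val u - set_val v) < e].
Proof.
move=> e0; rewrite openE => u [v Fv uv]; rewrite /interior.
have d0 : 0 < e - normc (set_val u - set_val v) by rewrite subr_gt0.
apply: (nbhs_near_normc d0) => w hw; exists v => //.
rewrite -(subrK (set_val u) (set_val w)) -addrA (le_lt_trans (normcD _ _))//.
by rewrite -ltrBrDr.
Qed.

(** A closed set is the decreasing intersection of its open neighbourhoods, so the inequality passes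
    to closed sets; on the complements, total mass 1 reverses it. Equality on open sets extends
    because they form a generating pi-system. *)
Lemma circle_measure_unique (m1 m2 : {measure set (circle R) -> \bar R}) :
  m1 setT = 1%E -> m2 setT = 1%E ->
  (forall U : set (circle R), open U -> (m1 U <= m2 U)%E) ->
  forall A, measurable A -> m1 A = m2 A.
Proof.
move=> m1T m2T h.
have fin (m : {measure set (circle R) -> \bar R}) (A : set (circle R)) : measurable A -> m setT = 1%E ->
    m A \is a fin_num.
  move=> mA mT; rewrite ge0_fin_numE ?measure_ge0//.
  apply: (@le_lt_trans _ _ 1%E); last exact: ltry.
  by rewrite -mT; apply: le_measure; rewrite ?inE.
have compl (m : {measure set (circle R) -> \bar R}) (A : set (circle R)) : measurable A -> m setT = 1%E ->
    fine (m A) + fine (m (~` A)) = 1.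
  move=> mA mT; have mC := measurableC mA.
  rewrite -fineD ?fin// -measureU ?setUv ?mT//.
  - exact: (congr1 fine mT).
  - exact: setICr.
have hO (U : set (circle R)) : open U -> m1 U = m2 U.
  move=> oU; have mU : measurable U by exact: measurable_open_circle.
  pose F n := [set u : circle R | exists2 v : circle R, (~` U) v & normc (set_val u - set_val v) < n.+1%:R^-1].
  have oF n : open (F n) by apply: nbhd_open; rewrite invr_gt0.
  have mF n : measurable (F n) by exact: measurable_open_circle.
  have FU : \bigcap_n F n = ~` U.
    apply/seteqP; split => u.
      move=> hu Uu; have [e e0 he] := open_circle_ball oU Uu.
      have [n ne] : exists n : nat, n.+1%:R^-1 < e.
        by have [n _ /(_ n (leqnn n)) hn] := near_infty_natSinv_lt (PosNum e0); exists n.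
      have [v nUv uv] := hu n I; apply: nUv; apply: he.
      by rewrite normcB (lt_trans uv).
    move=> nUu n _; exists u => //; by rewrite subrr normc0 invr_gt0.
  have hc (k : {measure set (circle R) -> \bar R}) : k setT = 1%E -> (k \o F) @ \oo --> k (~` U).
    move=> kT; rewrite -FU; apply: nonincreasing_cvg_mu => //.
    - by rewrite -ge0_fin_numE ?measure_ge0// fin.
    - by rewrite FU; exact: measurableC.
    - move=> p q pq; apply/subsetPset => u [v nUv uv]; exists v => //.
      by rewrite (lt_le_trans uv)// lef_pV2 ?posrE// ler_nat ltnS.
  have hC : (m1 (~` U) <= m2 (~` U))%E.
    by apply: (lee_cvg_to (hc m1 m1T) (hc m2 m2T)); apply: nearW => n; exact: h.
  have hU := h U oU; have mC := measurableC mU.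
  have c1 := compl m1 U mU m1T; have c2 := compl m2 U mU m2T.
  move: hU hC; rewrite -(fineK (fin m1 _ mU m1T)) -(fineK (fin m2 _ mU m2T)).
  rewrite -(fineK (fin m1 _ mC m1T)) -(fineK (fin m2 _ mC m2T)) !lee_fin => h1 h2.
  by congr EFin; lra.
move=> A mA.
apply: (@measure_unique _ _ _ (@open (circle R)) (fun _ => setT)) => //.
- exact: openI.
- by move=> _; exact: openT.
- exact: bigcup_const.
- by move=> _; rewrite m1T ltry.
Qed.
End CircleMeasures.

(** * The density of mu *)

Section Density.
Variables (R : realType) (t : R) (zeta : R[i] -> R[i]) (mu : probability (circle R) R).
Hypothesis t0 : 0 < t.
Hypothesis hz : is_zeta t zeta.
Hypothesis hmu : free_unitary_normal (4 * t) mu.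
Implicit Types (u v : circle R) (x y : R).

(** The density as a periodic function on the line, with [4 * t] in place of sigma^2; it descends to
    the circle by [circle_lift]. *)
Definition fun_dens x : R := 2 / (pi * (4 * t)) * Im (zeta ((x - pi) / 2)%:C).

Lemma Im_zeta_continuous : continuous (fun x : R => Im (zeta x%:C)).
Proof.
move=> x; apply/cvgrPdist_lt => e e0.
have [d d0 hd] := @zeta_continuous _ _ _ hz x%:C e (lexx 0) e0.
apply/nbhs_ballP; exists d => //= y; rewrite /ball/= => yx.
rewrite -ImN -ImD (le_lt_trans (Im_normc _))// normcB; apply: hd; first exact: lexx.
by rewrite -rmorphB normc_real distrC.
Qed.

Lemma fun_dens_continuous : continuous fun_dens.
Proof.
move=> x; apply: cvgM; first exact: cvg_cst.
have h1 : (y - pi) / 2 @[y --> x] --> (x - pi) / 2.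
  by apply: cvgM; [apply: cvgB; [exact: cvg_id|exact: cvg_cst]|exact: cvg_cst].
exact: (cvg_comp _ _ h1 (@Im_zeta_continuous ((x - pi) / 2))).
Qed.

Lemma fun_dens_periodic x : fun_dens (x + 2 * pi) = fun_dens x.
Proof.
rewrite /fun_dens; have -> : (x + 2 * pi - pi) / 2 = (x - pi) / 2 + pi by field.
by rewrite (Im_zeta_Dpi t0 hz).
Qed.

Lemma fun_densN x : fun_dens (- x) = fun_dens x.
Proof.
rewrite /fun_dens; have -> : (- x - pi) / 2 = - ((x - pi) / 2 + pi) by field.
by rewrite (Im_zeta_opp t0 hz) (Im_zeta_Dpi t0 hz).
Qed.

Lemma fun_dens_ge0 x : 0 <= fun_dens x.
Proof.
have [_ h] := zeta_real t0 hz ((x - pi) / 2).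
by rewrite mulr_ge0// divr_ge0// !mulr_ge0// ?pi_ge0// ltW.
Qed.

Lemma poisson_pk r x u : 0 <= r ->
  poisson (r%:C * (cos x -i* sin x)) u = pk r (Re (set_val u)) (Im (set_val u)) x.
Proof.
move=> r0; rewrite /poisson /pk normcM normc_real (ger0_norm r0).
have -> : normc (cos x -i* sin x) = 1.
  have : normc (cos x -i* sin x) ^+ 2 = 1 by rewrite normc_sqr !ReImE sqrrN cos2Dsin2.
  by move/eqP; rewrite sqrp_eq1 ?normc_ge0// => /eqP.
rewrite mulr1 normc_sqr; congr (_ / _).
have := circle_sqr u; have := cos2Dsin2 x.
rewrite !ReImE; move: (Re _) (Im _) (cos x) (sin x) => a b c s h1 h2.
transitivity (1 - 2 * r * (a * c + b * s) + r ^+ 2 * ((a ^+ 2 + b ^+ 2) * (c ^+ 2 + s ^+ 2))).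
  by ring.
by rewrite h1 h2; ring.
Qed.

(** For y > 1 one has sh y > 1, hence ch y <= 2 sh y; dropping the cosine from the first relation of
    [zeta_rel] then leaves y - Im theta <= 2 t. Divided by t, this bound dominates the Poisson
    integrals at all radii. *)
Lemma zeta_im_bound theta : 0 < Im theta -> Im (zeta theta) - Im theta <= 1 + 2 * t.
Proof.
move=> th0; have [h1 _ _] := zeta_rel_open t0 hz th0.
have [y0 _] := zeta_spec hz th0.
move: h1 y0; set y := Im (zeta _); set N := _ + sh y ^+ 2 => h1 y0.
have [y1|y1] := leP y 1.
  by move: th0 y1 t0; move: (Im theta) => b; lra.
have s1 : 1 < sh y by rewrite (lt_le_trans y1)// sh_ge// ltW.
have s0 : 0 < sh y by lra.
have c2 : ch y <= 2 * sh y.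
  have b1 : ch y \is Num.nneg by rewrite nnegrE ltW// ch_gt0.
  have b2 : 2 * sh y \is Num.nneg by rewrite nnegrE; lra.
  rewrite -(@ler_pXn2r _ 2)//.
  have s2 : 1 <= sh y ^+ 2 by rewrite exprn_ege1// ltW.
  by move: s2; rewrite ch2_sh2 !expr2; move: (sh y) => q; lra.
have NN : sh y ^+ 2 <= N by rewrite lerDr sqr_ge0.
suff : (y - Im theta) * sh y ^+ 2 <= 2 * t * sh y ^+ 2.
  by rewrite ler_pM2r ?exprn_gt0// => /le_trans; apply; rewrite lerDr.
have [yb|yb] := leP (y - Im theta) 0.
  apply: (@le_trans _ _ 0); first by rewrite mulr_le0_ge0 ?sqr_ge0.
  by apply: mulr_ge0; rewrite ?sqr_ge0// mulr_ge0// ltW.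
apply: (@le_trans _ _ ((y - Im theta) * N)); first by rewrite ler_pM2l.
rewrite h1 expr2 -mulrA [leRHS]mulrCA ler_pM2l//.
by rewrite mulrC [leRHS]mulrA ler_pM2r.
Qed.

Let eta (n : nat) : R := n.+1%:R^-1.
Let rad (n : nat) : R := expR (- (2 * eta n)).
(** The sign of [x] makes - e^(2 i th) equal to [rad n] times e^(-i x), so that the kernel peaks at
    u = e^(i x). The symmetries of Im zeta bring the limit back to the point (x - pi) / 2. *)
Let th (n : nat) x : R[i] := ((- x - pi) / 2) +i* eta n.

Let eta_gt0 n : 0 < eta n. Proof. by rewrite invr_gt0. Qed.

Let rad01 n : 0 < rad n < 1.
Proof. by rewrite expR_gt0 expR_lt1 oppr_lt0 mulr_gt0. Qed.

Let thE n x : - cexp (2 * 'i * th n x) = (rad n)%:C * (cos x -i* sin x).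
Proof.
have e : 2 * 'i * th n x = (- (2 * eta n)) +i* (- x - pi).
  by apply: complex_eqP; rewrite !ReImE; field.
rewrite e; apply: complex_eqP; rewrite !(ReN, ImN, ReM, ImM, Re_cexp, Im_cexp);
  rewrite !ReImE -opprD ?cosN ?sinN ?cosDpi ?sinDpi /rad; ring.
Qed.

Let int_pk n x :
  (\int[mu]_u (pk (rad n) (Re (set_val u)) (Im (set_val u)) x)%:E =
   ((Im (zeta (th n x)) - eta n) / t)%:E)%E.
Proof.
have th0 : 0 < Im (th n x) by exact: eta_gt0.
rewrite (Im_zeta_poisson t0 hz hmu th0) thE Im_mk addrC addKr mulrC mulKf ?gt_eqF//.
have z1 : normc ((rad n)%:C * (cos x -i* sin x)) < 1.
  by rewrite -thE normc_cexp2i expR_lt1 oppr_lt0 mulr_gt0.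
have := poisson_integrable mu z1 => /(integrable_fin_num measurableT) /fineK h.
rewrite /Rintegral h; apply: eq_integral => u _.
by rewrite -poisson_pk// ltW//; case/andP: (rad01 n).
Qed.

(** The limit of the Poisson integrals, that is, the density with respect to length normalised to
    total mass 1. *)
Let h x : R := Im (zeta ((x - pi) / 2)%:C) / t.

Let h_dens x : h x = 2 * pi * fun_dens x.
Proof.
rewrite /h /fun_dens; move: (Im _) (pi_gt0 R); move: (pi : R) => q z q0.
by field; rewrite (gt_eqF t0) (gt_eqF q0).
Qed.

Let zeta_cvg x : Im (zeta (th n x)) @[n --> \oo] --> Im (zeta ((x - pi) / 2)%:C).
Proof.
have -> : Im (zeta ((x - pi) / 2)%:C) = Im (zeta ((- x - pi) / 2)%:C).
  have -> : (- x - pi) / 2 = - ((x - pi) / 2 + pi) by field.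
  by rewrite (Im_zeta_opp t0 hz) (Im_zeta_Dpi t0 hz).
set a := (- x - pi) / 2; apply/cvgrPdist_lt => e e0.
have [dl d0 hd] := @zeta_continuous _ _ _ hz a%:C e (lexx 0) e0.
have [N _ hN] := near_infty_natSinv_lt (PosNum d0).
exists N => // n /= Nn; rewrite -ImN -ImD (le_lt_trans (Im_normc _))// normcB.
apply: hd; first by rewrite /th Im_mk ltW.
have -> : th n x - a%:C = (eta n)%:C * 'i by apply: complex_eqP; rewrite !ReImE /a; ring.
rewrite normcM normc_i mulr1 normc_real gtr0_norm ?eta_gt0//; exact: hN.
Qed.

Let eta_cvg : eta n @[n --> \oo] --> (0 : R).
Proof.
apply/cvgrPdist_lt => e e0; have [N _ hN] := near_infty_natSinv_lt (PosNum e0).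
by exists N => // n /= Nn; rewrite sub0r normrN gtr0_norm ?eta_gt0//; exact: hN.
Qed.

Let rad_cvg : rad n @[n --> \oo] --> (1 : R).
Proof.
rewrite -(expR0 R) -[0](mulr0 (-2)) /rad.
under eq_fun do rewrite -mulNr.
apply: continuous_cvg; first exact: continuous_expR.
by apply: cvgM; [exact: cvg_cst|exact: eta_cvg].
Qed.

Let int_cvg x :
  (\int[mu]_u (pk (rad n) (Re (set_val u)) (Im (set_val u)) x)%:E)%E @[n --> \oo] --> (h x)%:E.
Proof.
under eq_fun do rewrite int_pk; apply: cvg_EFin; first exact: nearW.
apply: cvgM; last exact: cvg_cst.
rewrite -[X in _ --> X]subr0; apply: cvgB; [exact: zeta_cvg|exact: eta_cvg].
Qed.

Let int_bound n x :
  (\int[mu]_u (pk (rad n) (Re (set_val u)) (Im (set_val u)) x)%:E <= ((1 + 2 * t) / t)%:E)%E.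
Proof.
rewrite int_pk lee_fin ler_pM2r ?invr_gt0//.
exact: (@zeta_im_bound (th n x) (eta_gt0 n)).
Qed.

Let mRe : measurable_fun setT (fun u : circle R => Re (set_val u)).
Proof.
apply: continuous_measurable_circle; apply: (@lipschitz_continuous_circle _ _ 1) => u v.
by rewrite mul1r -ReN -ReD Re_normc.
Qed.

Let mIm : measurable_fun setT (fun u : circle R => Im (set_val u)).
Proof.
apply: continuous_measurable_circle; apply: (@lipschitz_continuous_circle _ _ 1) => u v.
by rewrite mul1r -ImN -ImD Im_normc.
Qed.

Let h_continuous : continuous h.
Proof.
have -> : h = (fun x => 2 * pi * fun_dens x) by apply/funext => x; exact: h_dens.
by move=> x; apply: cvgM; [exact: cvg_cst|exact: fun_dens_continuous].
Qed.

Let mh : measurable_fun (`[(- pi)%R, pi[%classic : set R) h.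
Proof. by apply: measurable_funTS; exact: continuous_measurable_fun. Qed.

Let dens_integral (A : set R) : measurable A ->
  (\int[lebesgue_measure]_(x in `[(- pi)%R, pi[ `&` A) (h x)%:E =
   (2 * pi)%:E * \int[lebesgue_measure]_(x in `[(- pi)%R, pi[ `&` A) (fun_dens x)%:E)%E.
Proof.
move=> mA; rewrite -ge0_integralZl//.
- by apply: eq_integral => x _; rewrite h_dens EFinM.
- exact: measurableI.
- apply/measurable_EFinP; apply: measurable_funTS.
  by apply: continuous_measurable_fun; exact: fun_dens_continuous.
- by move=> x _; rewrite lee_fin fun_dens_ge0.
- by rewrite lee_fin mulr_ge0// pi_ge0.
Qed.

Lemma mu_open_le (U : set (circle R)) : open U ->
  (mu U <= \int[lebesgue_measure]_(x in `[(- pi)%R, pi[ `&` @cis R @^-1` U) (fun_dens x)%:E)%E.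
Proof.
move=> oU; have mU := measurable_open_circle oU.
have mV : measurable (@cis R @^-1` U : set R).
  by rewrite -[X in measurable X]setTI; apply: measurable_cis.
have p0 : (0%:E < ((2 * pi)%R%:E : \bar R))%E by rewrite lte_fin mulr_gt0 ?pi_gt0.
rewrite -(lee_pmul2l _ p0)// -dens_integral//.
apply: (poisson_open_le mRe mIm (@circle_sqr R) rad01 rad_cvg mV int_bound
  (fun x _ => @int_cvg x) mh mU).
move=> u Uu; have [e e0 he] := open_circle_ball oU Uu.
(* Since |e^(i x) - u|^2 = 2 - 2 (a cos x + b sin x) for u = a + i b, distance at least [e] yields
   this gap. *)
exists (e ^+ 2 / 2); first by rewrite divr_gt0// exprn_gt0.
move=> x _ nU; have : e <= normc (set_val (cis x) - set_val u).
  by rewrite leNgt; apply/negP => /he.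
rewrite -(@ler_pXn2r _ 2) ?nnegrE ?normc_ge0 ?(ltW e0)// normc_sqr set_val_cis !ReImE.
have := circle_sqr u; have := cos2Dsin2 x.
move: (Re _) (Im _) (cos x) (sin x) => a b c s h1 h2; rewrite !expr2 in h1 h2 *.
by move=> h3; lra.
Qed.

Lemma fun_dens_total :
  (\int[lebesgue_measure]_(x in `[(- pi)%R, pi[) (fun_dens x)%:E = 1)%E.
Proof.
have := poisson_total mRe mIm (@circle_sqr R) rad01 int_bound (fun x _ => @int_cvg x) mh.
rewrite -[X in (\int[_]_(x in X) (h _)%:E)%E]setIT dens_integral// setIT.
have p0 : (0%:E < ((2 * pi)%R%:E : \bar R))%E by rewrite lte_fin mulr_gt0 ?pi_gt0.
case: (\int[_]_(x in _) _)%E => [r| |].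
- rewrite -EFinM => -[] h1; congr EFin; apply: (mulfI (lt0r_neq0 p0)); by rewrite h1 mulr1.
- by rewrite gt0_muley.
- by rewrite gt0_muleNy.
Qed.

Lemma length_integral (f : circle R -> R) (A : set (circle R)) :
  measurable_fun setT f -> (forall u, 0 <= f u) -> measurable A ->
  (\int[@length_measure R]_(u in A) (f u)%:E =
   \int[lebesgue_measure]_(x in `[(- pi)%R, pi[ `&` @cis R @^-1` A) (f (cis x))%:E)%E.
Proof.
move=> mf f0 mA.
have mV : measurable (@cis R @^-1` A : set R).
  by rewrite -[X in measurable X]setTI; apply: measurable_cis.
have mfE : measurable_fun A (fun u => (f u)%:E).
  by apply/measurable_EFinP; exact: measurable_funTS.
pose m : {measure set (measurableTypeR R) -> \bar R} :=
  mrestr (@lebesgue_measure R) (measurable_itv `[(- pi)%R, pi[).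
rewrite (@ge0_integral_pushforward _ _ (measurableTypeR R) (circle R) R (@cis R) (@measurable_cis R)
  m A (fun u => (f u)%:E))//.
  rewrite ge0_integral_mrestr//; last by move=> x _; rewrite /= lee_fin.
  apply: measurable_funTS; apply/measurable_EFinP.
  exact: measurableT_comp mf (@measurable_cis R).
by move=> y _; rewrite lee_fin.
Qed.

Lemma density_exists : exists f : circle R -> R,
  is_density mu f /\ forall x, f (cis x) = fun_dens x.
Proof.
have [f cf fE] := circle_lift fun_dens_continuous fun_dens_periodic.
have mf := continuous_measurable_circle cf.
have f0 u : 0 <= f u by have [x [_ <-]] := cis_surj u; rewrite fE fun_dens_ge0.
exists f; split => //; split => //.
pose nu A := (\int[@length_measure R]_(u in A) (f u)%:E)%E.
have nuE A : measurable A -> nu A =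
    (\int[lebesgue_measure]_(x in `[(- pi)%R, pi[ `&` @cis R @^-1` A) (fun_dens x)%:E)%E.
  by move=> mA; rewrite /nu length_integral//; apply: eq_integral => x _; rewrite fE.
have mfE : measurable_fun setT (fun u => (f u)%:E) by exact/measurable_EFinP.
have fE0 u : (0 <= (f u)%:E)%E by rewrite lee_fin.
have nu0 : nu set0 = 0%E by rewrite /nu integral_set0.
have nu_ge0 A : (0 <= nu A)%E by exact: integral_ge0.
have nu_sigma : semi_sigma_additive nu := semi_sigma_additive_nng_induced mfE fE0.
pose nu_mix := isMeasure.Build _ _ _ nu nu0 nu_ge0 nu_sigma.
pose nuM : {measure set (circle R) -> \bar R} := HB.pack nu nu_mix.
move=> A mA.
apply: (@circle_measure_unique _ mu nuM) => //.
- exact: probability_setT.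
- by rewrite /= nuE// preimage_setT setIT fun_dens_total.
- move=> U oU; rewrite /= nuE; [exact: mu_open_le|exact: measurable_open_circle].
Qed.
End Density.

(** * Course-of-values recursion *)

Section CausalRecursion.
Variables (X : Type) (y0 : X) (G : (nat -> X) -> nat -> X).
Hypothesis causal : forall c c' n, (forall k, (k <= n)%N -> c k = c' k) -> G c n = G c' n.

(** [causal_aux n] is correct up to index [n], and [G] at index [n] reads no further; the solution
    is the diagonal. *)
Fixpoint causal_aux n : nat -> X :=
  if n is m.+1 then fun k => if (k <= m)%N then causal_aux m k else G (causal_aux m) m
  else fun=> y0.

Lemma causal_auxE n k : (k <= n)%N -> causal_aux n k = causal_aux k k.
Proof.
elim: n => [|n IH]; first by rewrite leqn0 => /eqP ->.
by rewrite leq_eqVlt => /predU1P[->//|]; rewrite ltnS => kn /=; rewrite kn IH.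
Qed.

Lemma causal_recursion : exists c : nat -> X, c 0 = y0 /\ forall n, c n.+1 = G c n.
Proof.
exists (fun n => causal_aux n n); split => // n /=; rewrite ltnn.
by apply: causal => k kn; exact: causal_auxE.
Qed.
End CausalRecursion.

(** * Power series at a complex point *)

Section ScaledSeries.
Variable R : realType.
Implicit Types (c : nat -> R[i]) (x : R[i]) (C K : R).

(** [psum (ser c x) s] is the series at s x: the value at the complex point [x] is read at s = 1,
    while s runs along the segment from 0. *)
Definition ser c x n : R[i] := c n * x ^+ n.

Lemma geo_bounded_ser c x C K : 0 <= C -> 0 <= K -> (forall n, normc (c n) <= C * K ^+ n) ->
  K * normc x < 1 -> geo_bounded (ser c x).
Proof.
move=> C0 K0 h Kx; exists (K * normc x), C; split => //.
  by rewrite mulr_ge0// normc_ge0.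
move=> n; rewrite normcM normcX exprMn mulrA.
by rewrite ler_wpM2r ?exprn_ge0 ?normc_ge0.
Qed.

Lemma dser_ser c x n : dser (ser c x) n = x * ser (dser c) x n.
Proof. by rewrite /dser /ser exprS; ring. Qed.

Lemma normc_subX x w (r : R) n : normc x <= r -> normc w <= r ->
  normc (x ^+ n - w ^+ n) <= n%:R * r ^+ n.-1 * normc (x - w).
Proof.
move=> xr wr; have r0 : 0 <= r by apply: le_trans xr; exact: normc_ge0.
rewrite subrXX normcM mulrC ler_wpM2r ?normc_ge0//.
rewrite (le_trans (normc_sum _ _ _))// -[n in n%:R]card_ord mulr_natl -sumr_const.
apply: ler_sum => i _; rewrite normcM !normcX.
have ni : (i <= n.-1)%N by case: n i => [[]//|n] i /=; rewrite -ltnS.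
rewrite -[X in _ <= _ ^+ X](subnK ni).
by rewrite exprD ler_pM ?exprn_ge0 ?normc_ge0// lerXn2r// nnegrE ?normc_ge0.
Qed.

(** Terms of index n differ by at most C K^n n r^(n-1) |x - w|. The factor n is absorbed by n <=
    2^n, at the cost of half the radius. *)
Lemma psum_ser_lipschitz c C K (r : R) : 0 <= C -> 0 <= K -> 0 < r -> 2 * (K * r) < 1 ->
  (forall n, normc (c n) <= C * K ^+ n) ->
  exists L : R, forall x w, normc x <= r -> normc w <= r ->
    normc (psum (ser c x) 1 - psum (ser c w) 1) <= L * normc (x - w).
Proof.
move=> C0 K0 r0 Kr h; exists (2 * (C / r) / (1 - 2 * (K * r))) => x w xr wr.
have Krx z : normc z <= r -> K * normc z < 1.
  move=> zr; have : K * normc z <= K * r by rewrite ler_wpM2l.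
  have : 0 <= K * r by rewrite mulr_ge0// ltW.
  lra.
have hx := geo_bounded_ser C0 K0 h (Krx _ xr).
have hw := geo_bounded_ser C0 K0 h (Krx _ wr).
have n1 : `|1 : R| <= 1 by rewrite normr1.
rewrite -[X in _ - X]mul1r -mulNr -psumZ// -psumD//; last exact: geo_boundedZ.
set d := fun n => _ + _.
have q01 : 0 <= 2 * (K * r) < 1 by rewrite !mulr_ge0// ltW.
have M0 : 0 <= C / r * normc (x - w) by rewrite mulr_ge0 ?normc_ge0// divr_ge0// ltW.
have hd n : normc (d n) <= C / r * normc (x - w) * (2 * (K * r)) ^+ n.
  rewrite /d /ser mulN1r -mulrBr normcM.
  rewrite (le_trans (ler_pM _ _ (h n) (normc_subX n xr wr)))//.
  - exact: normc_ge0.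
  - exact: normc_ge0.
  case: n => [|n]; first by rewrite mul0r mul0r mulr0 mulr_ge0// expr0.
  rewrite /= !exprMn [leLHS](_ : _ = C * normc (x - w) * K ^+ n.+1 * r ^+ n * n.+1%:R); last by ring.
  rewrite [leRHS](_ : _ = C * normc (x - w) * K ^+ n.+1 * r ^+ n * 2 ^+ n.+1); last first.
    by rewrite [r ^+ n.+1]exprS; field; rewrite gt_eqF.
  apply: ler_wpM2l; first by rewrite !mulr_ge0 ?normc_ge0 ?exprn_ge0// ltW.
  by rewrite -natrX ler_nat ltnW// ltn_expl.
have := psum_tail q01 M0 hd n1 0; rewrite /ppart big_nil subr0 expr0 mulr1.
by move=> /le_trans -> //; rewrite le_eqVlt; apply/orP; left; apply/eqP; ring.
Qed.
End ScaledSeries.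

(** * The quadratic system satisfied by tan zeta *)

Section QuadraticSystem.
Variables (R : realType) (t : R).
Hypothesis t0 : 0 < t.
Implicit Types (c : nat -> nat -> R[i]).

(* Power-series form of a quadratic system satisfied by V = 1/(1 - t - t T^2),
   P = V^2 - V, Q = TP, Y = TV and T = tan zeta, as functions of theta:
   V' = 2VQ, P' = 2(2P+V)Q, Q' = (VP-P)/t + 4Q^2 + 2YQ, Y' = P/t + 2YQ,
   T' = (V-1)/t.  They are the components 0, .., 4 of [c]. *)
Definition sys c n : nat -> R[i] := fun j =>
  let V n := c n 0 in let P n := c n 1 in let Q n := c n 2 in
  let Y n := c n 3 in
  (n.+1%:R)^-1 *
  match j with
  | 0 => 2 * conv V Q n
  | 1 => 2 * conv (fun n => 2 * P n + V n) Q n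
  | 2 => t^-1%:C * (conv V P n + (-1) * P n) + (4 * conv Q Q n + 2 * conv Y Q n)
  | 3 => t^-1%:C * P n + 2 * conv Y Q n
  | _ => t^-1%:C * (V n + (if n is 0 then -1 else 0))
  end.

Lemma conv_eq (a b a' b' : nat -> R[i]) n :
  (forall k, (k <= n)%N -> a k = a' k) -> (forall k, (k <= n)%N -> b k = b' k) ->
  conv a b n = conv a' b' n.
Proof.
move=> ha hb; apply: eq_bigr => i _; rewrite ha ?hb ?leq_subr//.
by rewrite -ltnS.
Qed.

Lemma sys_causal c c' n : (forall k, (k <= n)%N -> c k = c' k) -> sys c n = sys c' n.
Proof.
move=> h; apply/funext => j; rewrite /sys; congr (_ * _).
have hn := h n (leqnn n).
case: j => [|[|[|[|j]]]]; rewrite ?hn //; repeat congr (_ + _); repeat congr (_ * _);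
  by repeat congr (_ + _); apply: conv_eq => k /h ->.
Qed.

Lemma conv_bound (a b : nat -> R[i]) (A B K : R) n : 0 <= K -> 0 <= A ->
  (forall k, (k <= n)%N -> normc (a k) <= A * K ^+ k) ->
  (forall k, (k <= n)%N -> normc (b k) <= B * K ^+ k) ->
  normc (conv a b n) <= n.+1%:R * (A * B * K ^+ n).
Proof.
move=> K0 A0 ha hb; rewrite (le_trans (normc_sum _ _ _))//.
rewrite mulr_natl -[n.+1 in leRHS]card_ord -sumr_const; apply: ler_sum => i _.
have ni : (i <= n)%N by rewrite -ltnS.
rewrite normcM (le_trans (ler_pM _ _ (ha _ ni) (hb _ (leq_subr _ _))))// ?normc_ge0//.
by rewrite mulrACA -exprD subnKC.
Qed.
Lemma normcDle (z w : R[i]) (a b : R) : normc z <= a -> normc w <= b ->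
  normc (z + w) <= a + b.
Proof. by move=> za wb; rewrite (le_trans (normcD _ _))// lerD. Qed.

Lemma normcMle (z w : R[i]) (a b : R) : normc z <= a -> normc w <= b ->
  normc (z * w) <= a * b.
Proof. by move=> za wb; rewrite normcM ler_pM ?normc_ge0. Qed.

Lemma normc_nat n : normc (n%:R : R[i]) = n%:R.
Proof. by rewrite natC normc_real ger0_norm. Qed.

(* Quadratic right-hand sides reproduce the bound [C * K ^+ n]: the convolution
   has [n.+1] terms, and this factor is cancelled by the integration. *)
Lemma sys_bound c (C : R) : 1 <= C -> (forall j, normc (c 0 j) <= C) ->
  (forall n, c n.+1 = sys c n) ->
  forall n j, normc (c n j) <= C * (C * (2 / t + 6)) ^+ n.
Proof.
(* In each component the coefficients of the right-hand side add up, in modulus, to at most 2 / t +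
   6; the third component attains this. *)
move=> C1 h0 hS; set K := C * _.
have C0 : 0 <= C by lra.
have t20 : 0 <= 2 / t by rewrite divr_ge0// ltW.
have K0 : 0 <= K by rewrite mulr_ge0// addr_ge0.
suff h m n : (n <= m)%N -> forall j, normc (c n j) <= C * K ^+ n by move=> n; exact: h.
elim: m n => [|m IH] n; first by rewrite leqn0 => /eqP -> j; rewrite expr0 mulr1.
rewrite leq_eqVlt => /predU1P[->|]; last by rewrite ltnS; exact: IH.
move=> j; rewrite hS.
have tC : normc (t^-1%:C) <= t^-1 by rewrite normc_real gtr0_norm ?invr_gt0.
have n2 : normc (2 : R[i]) <= 2 by rewrite normc_nat.
have n4 : normc (4 : R[i]) <= 4 by rewrite normc_nat.
have n1 : normc (- 1 : R[i]) <= 1 by rewrite normcN normc1.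
set N := m.+1%:R : R.
have N1 : 1 <= N by rewrite /N -[1]/(1%:R) ler_nat.
have Km : 0 <= K ^+ m by rewrite exprn_ge0.
have cv (a b : nat -> R[i]) A B : 0 <= A ->
    (forall k, (k <= m)%N -> normc (a k) <= A * K ^+ k) ->
    (forall k, (k <= m)%N -> normc (b k) <= B * K ^+ k) ->
    normc (conv a b m) <= N * (A * B * K ^+ m).
  exact: conv_bound.
have b j' k : (k <= m)%N -> normc (c k j') <= C * K ^+ k by move=> km; exact: IH.
(* Linear terms obey the bound of the quadratic ones because C and N are at least 1. *)
have CC : C * K ^+ m <= N * (C * C * K ^+ m).
  rewrite -[leLHS]mul1r; apply: ler_pM => //; first by rewrite mulr_ge0.
  by rewrite ler_wpM2r// ler_peMl.
suff hs : normc (m.+1%:R * sys c m j) <= N * (C * C * K ^+ m) * (2 / t + 6).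
  have N0 : 0 < N by lra.
  rewrite normcM normc_nat -/N in hs; rewrite -(ler_pM2l N0) (le_trans hs)//.
  by rewrite exprS /K le_eqVlt; apply/orP; left; apply/eqP; ring.
have e z : m.+1%:R * (m.+1%:R^-1 * z) = z :> R[i] by rewrite mulrA divff ?mul1r// pnatr_eq0.
set X := N * (C * C * K ^+ m) in CC cv *.
have X0 : 0 <= X by rewrite !mulr_ge0//; lra.
have cvb j1 j2 : normc (conv (fun n => c n j1) (fun n => c n j2) m) <= X.
  by apply: cv => // k; exact: b.
have r1 : 0 <= t^-1 by rewrite invr_ge0 ltW.
have tX : 0 <= t^-1 * X by rewrite mulr_ge0.
rewrite /sys e; case: j => [|[|[|[|j]]]].
- by apply: le_trans (normcMle n2 (cvb _ _)) _; rewrite mulrDr; nra.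
- have h3 : normc (conv (fun n => 2 * c n 1 + c n 0) (fun n => c n 2) m) <= N * (3 * C * C * K ^+ m).
    apply: cv => //; first by rewrite mulr_ge0.
      move=> k km; apply: le_trans (normcDle (normcMle n2 (b 1 k km)) (b 0 k km)) _.
      by rewrite le_eqVlt; apply/orP; left; apply/eqP; ring.
    by move=> k; exact: b.
  apply: le_trans (normcMle n2 h3) _.
  rewrite (_ : _ * _ = X * 6); last by rewrite /X; ring.
  by rewrite ler_wpM2l// lerDr.
- have h1 := normcMle tC (normcDle (cvb 0 1) (le_trans (normcMle n1 (b 1 m (leqnn m))) ltac:(by rewrite mul1r; exact: CC))).
  apply: le_trans (normcDle h1 (normcDle (normcMle n4 (cvb 2 2)) (normcMle n2 (cvb 3 2)))) _.
  by rewrite le_eqVlt; apply/orP; left; apply/eqP; ring.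
- apply: le_trans (normcDle (normcMle tC (le_trans (b 1 m (leqnn m)) CC)) (normcMle n2 (cvb 3 2))) _.
  rewrite [leRHS]mulrDr [X * (2 / t)](_ : _ = 2 * (t^-1 * X)); last by ring.
  by lra.
- have hd : normc (if m is 0 then -1 else 0 : R[i]) <= X.
    apply: (@le_trans _ _ (C * K ^+ m)) => //.
    by case: (m) => [|m']; rewrite ?normc0 ?mulr_ge0 ?exprn_ge0// (le_trans n1)// expr0 mulr1.
  apply: le_trans (normcMle tC (normcDle (le_trans (b 0 m (leqnn m)) CC) hd)) _.
  rewrite [leRHS]mulrDr [X * (2 / t)](_ : _ = 2 * (t^-1 * X)); last by ring.
  by lra.
Qed.

Lemma sys_solution (y0 : nat -> R[i]) (C : R) : 1 <= C -> (forall j, normc (y0 j) <= C) ->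
  exists c K, [/\ c 0 = y0, forall n, c n.+1 = sys c n, 0 < K &
    forall n j, normc (c n j) <= C * K ^+ n].
Proof.
move=> C1 hy; have [c [c0 cS]] := causal_recursion y0 sys_causal.
exists c, (C * (2 / t + 6)); split => //.
  by rewrite mulr_gt0 ?ltr_wpDl// ?divr_ge0 ?(ltW t0)//; lra.
by apply: sys_bound => // j; rewrite c0.
Qed.

(** * Sums of the recursive series solve the system *)

Section Solution.
Variables (c : nat -> nat -> R[i]) (C K : R) (x : R[i]).
Hypotheses (C0 : 0 <= C) (K0 : 0 < K).
Hypothesis cS : forall n, c n.+1 = sys c n.
Hypothesis cb : forall n j, normc (c n j) <= C * K ^+ n.
Hypothesis Kx : K * normc x < 1.

Let a j : nat -> R[i] := ser (fun n => c n j) x.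
(** The unknowns along the segment from 0 to [x], in the order V, P, Q, Y, T. *)
Let S j s := psum (a j) s.

Let gb j : geo_bounded (a j).
Proof. by apply: (geo_bounded_ser C0 (ltW K0)). Qed.

Let S_bounded : exists B : R, forall j, (j <= 4)%N -> forall s, `|s| <= 1 -> normc (S j s) <= B.
Proof.
have [B0 h0] := psum_bounded (gb 0); have [B1 h1] := psum_bounded (gb 1).
have [B2 h2] := psum_bounded (gb 2); have [B3 h3] := psum_bounded (gb 3).
have [B4 h4] := psum_bounded (gb 4).
have p (A B : R) : A <= B -> forall z, z <= A -> z <= B by move=> AB z /le_trans; apply.
have n0 : `|0 : R| <= 1 by rewrite normr0.
have q0 := le_trans (normc_ge0 _) (h0 _ n0).
have q1 := le_trans (normc_ge0 _) (h1 _ n0).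
have q2 := le_trans (normc_ge0 _) (h2 _ n0).
have q3 := le_trans (normc_ge0 _) (h3 _ n0).
have q4 := le_trans (normc_ge0 _) (h4 _ n0).
exists (B0 + B1 + B2 + B3 + B4) => -[|[|[|[|[|//]]]]] _ s s1.
- by apply: p (h0 s s1); lra.
- by apply: p (h1 s s1); lra.
- by apply: p (h2 s s1); lra.
- by apply: p (h3 s s1); lra.
- by apply: p (h4 s s1); lra.
Qed.

Let dserE j n : dser (a j) n = x * (n.+1%:R * sys c n j * x ^+ n).
Proof. by rewrite dser_ser /ser /dser cS. Qed.

Let nz n : n.+1%:R != 0 :> R[i]. Proof. by rewrite pnatr_eq0. Qed.

Let cder0 s : `|s| <= 1 -> cder (S 0) s (x * (2 * (S 0 s * S 2 s))).
Proof.
move=> s1; apply: cder_eq; first exact: cder_psum.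
have g := geo_bounded_conv (gb 0) (gb 2).
rewrite -psumM// -psumZ// -psumZ//; last exact: geo_boundedZ.
congr psum; apply/funext => n; rewrite dserE conv_mser /sys.
by congr (_ * _); rewrite mulVKf ?nz// mulrA.
Qed.

Let cder1 s : `|s| <= 1 -> cder (S 1) s (x * (2 * ((2 * S 1 s + S 0 s) * S 2 s))).
Proof.
move=> s1; apply: cder_eq; first exact: cder_psum.
have g1 := geo_boundedD (geo_boundedZ 2 (gb 1)) (gb 0).
have g := geo_bounded_conv g1 (gb 2).
rewrite -(psumZ _ (gb 1))// -psumD//; last exact: geo_boundedZ.
rewrite -psumM// -psumZ// -psumZ//; last exact: geo_boundedZ.
congr psum; apply/funext => n; rewrite dserE /sys.
have -> : conv (fun n => 2 * a 1 n + a 0 n) (a 2) n =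
    conv (fun n => 2 * c n 1 + c n 0) (fun n => c n 2) n * x ^+ n.
  by rewrite -conv_mser; congr conv; apply/funext => k; rewrite /a /ser; ring.
by congr (_ * _); rewrite mulVKf ?nz// mulrA.
Qed.

Let cder2 s : `|s| <= 1 -> cder (S 2) s (x * (t^-1%:C * (S 0 s * S 1 s - S 1 s) +
  (4 * (S 2 s * S 2 s) + 2 * (S 3 s * S 2 s)))).
Proof.
move=> s1; apply: cder_eq; first exact: cder_psum.
have g01 := geo_bounded_conv (gb 0) (gb 1).
have g22 := geo_bounded_conv (gb 2) (gb 2).
have g32 := geo_bounded_conv (gb 3) (gb 2).
have z1 := geo_boundedZ (-1) (gb 1).
have z2 := geo_boundedD g01 z1.
have z3 := geo_boundedZ t^-1%:C z2.
have z4 := geo_boundedZ 4 g22.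
have z5 := geo_boundedZ 2 g32.
have z6 := geo_boundedD z4 z5.
have z7 := geo_boundedD z3 z6.
transitivity (psum (fun n => x * (t^-1%:C * (conv (a 0) (a 1) n + (-1) * a 1 n) +
    (4 * conv (a 2) (a 2) n + 2 * conv (a 3) (a 2) n))) s).
  congr psum; apply/funext => n; rewrite dserE !conv_mser /sys /a /ser.
  by congr (_ * _); rewrite mulVKf ?nz//; ring.
by rewrite psumZ// psumD// psumZ// psumD// psumZ// psumM// psumD// psumZ// psumM// psumZ// psumM// mulN1r.
Qed.

Let cder3 s : `|s| <= 1 -> cder (S 3) s (x * (t^-1%:C * S 1 s + 2 * (S 3 s * S 2 s))).
Proof.
move=> s1; apply: cder_eq; first exact: cder_psum.
have g32 := geo_bounded_conv (gb 3) (gb 2).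
have z1 := geo_boundedZ t^-1%:C (gb 1).
have z2 := geo_boundedZ 2 g32.
have z3 := geo_boundedD z1 z2.
transitivity (psum (fun n => x * (t^-1%:C * a 1 n + 2 * conv (a 3) (a 2) n)) s).
  congr psum; apply/funext => n; rewrite dserE !conv_mser /sys /a /ser.
  by congr (_ * _); rewrite mulVKf ?nz//; ring.
by rewrite psumZ// psumD// psumZ// psumZ// psumM.
Qed.

Let delta (n : nat) : R[i] := if n is 0 then -1 else 0.
Let geo_delta : geo_bounded delta.
Proof.
exists 0, 1; split => // -[|n]; first by rewrite normcN normc1 expr0 mulr1.
by rewrite normc0 exprS mul0r mulr0.
Qed.
Let psum_delta s : `|s| <= 1 -> psum delta s = -1.
Proof.
move=> s1; apply/esym; apply: (@psum_unique _ _ _ _ 0 1) => //.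
  by rewrite lexx ltr01.
case=> [|n]; first by rewrite /ppart big_nil subr0 normcN normc1 expr0 mulr1.
rewrite /ppart big_nat_recl// big1 ?addr0 => [|i _]; last by rewrite mul0r.
by rewrite expr0 mulr1 subrr normc0 exprS mul0r mulr0.
Qed.

Let cder4 s : `|s| <= 1 -> cder (S 4) s (x * (t^-1%:C * (S 0 s - 1))).
Proof.
move=> s1; apply: cder_eq; first exact: cder_psum.
have z1 := geo_boundedD (gb 0) geo_delta.
have z2 := geo_boundedZ t^-1%:C z1.
transitivity (psum (fun n => x * (t^-1%:C * (a 0 n + delta n))) s).
  congr psum; apply/funext => n; rewrite dserE /sys /a /ser.
  congr (_ * _); rewrite mulVKf ?nz// -mulrA mulrDl; congr (_ * (_ + _)).
  by case: n => [|n]; rewrite /delta ?expr0 ?mulr1 ?mul0r.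
by rewrite psumZ// psumZ// psumD// psum_delta.
Qed.

Let linear_eq0 (y f : R -> R[i]) (B : R) :
  (forall s : R, 0 <= s <= 1 -> cder y s (f s * y s)) ->
  (forall s : R, 0 <= s <= 1 -> normc (f s) <= B) -> y 0 = 0 ->
  forall s : R, 0 <= s <= 1 -> y s = 0.
Proof.
move=> hy hf y00 s /andP[s0 s1].
have sub r : 0 <= r <= s -> 0 <= r <= 1 by move=> /andP[-> /le_trans ->].
apply: (@cder_linear_eq0 _ y f B 0 s) => // r /sub hr; first exact: hy.
by rewrite (le_trans (ler_norm _))// (le_trans (Re_normc _))// hf.
Qed.

Let S0 j : S j 0 = c 0 j.
Proof. by rewrite /S psum0E// /a /ser expr0 mulr1. Qed.

Variables (T0 V0 theta0 : R[i]).
Hypothesis V0E : V0 * (1 - t%:C - t%:C * T0 ^+ 2) = 1.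
Hypothesis c0 : [/\ c 0 0 = V0, c 0 1 = V0 ^+ 2 - V0, c 0 2 = T0 * (V0 ^+ 2 - V0),
  c 0 3 = T0 * V0 & c 0 4 = T0].
Hypothesis T0E : cexp (2 * 'i * (theta0 + t%:C * T0)) * (1 - 'i * T0) = 1 + 'i * T0.

Let s01 (s : R) : 0 <= s <= 1 -> `|s| <= 1.
Proof. by move=> /andP[s0 s1]; rewrite ger0_norm. Qed.

Let tC0 : t%:C != 0 :> R[i].
Proof. by rewrite (inj_eq (@complexI R) _ 0) gt_eqF. Qed.

Let tVE : t^-1%:C = t%:C^-1 :> R[i].
Proof. by rewrite fmorphV. Qed.

(* [W = theta0 + x + t T] solves [tan W = T]: each relation between the five
   unknowns has a defect [y] with [y' = f y] and [y 0 = 0]. *)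
Lemma sys_solves :
  let T := psum (ser (fun n => c n 4) x) 1 in
  cexp (2 * 'i * (theta0 + x + t%:C * T)) * (1 - 'i * T) = 1 + 'i * T.
Proof.
move=> T; have [B hB] := S_bounded; have [c00 c01 c02 c03 c04] := c0.
have B0 : 0 <= B by apply: le_trans (hB 0 (leq0n _) 0 _); rewrite ?normc_ge0 ?normr0.
have b2 (k : R[i]) (s : R) : 0 <= s <= 1 -> normc (x * (k * S 2 s)) <= normc x * (normc k * B).
  by move=> h; rewrite !normcM !ler_wpM2l ?normc_ge0// hB// s01.
(* The order makes each defect equation close: P = V^2 - V stands alone, Y = T V uses it, Q = T P
   uses the one for Y, and the relation defining V uses those for P and Q. *)
have I1 (s : R) : 0 <= s <= 1 -> S 1 s = S 0 s * S 0 s - S 0 s.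
  move=> hs; apply/eqP; rewrite -subr_eq0; apply/eqP.
  apply: (linear_eq0 (y := fun s => S 1 s - (S 0 s * S 0 s - S 0 s))
    (f := fun s => x * (4 * S 2 s)) _ (b2 4)) hs; last by rewrite !S0 c00 c01; ring.
  move=> r /s01 hr; apply: cder_eq.
    exact: (cderB (cder1 hr) (cderB (cderM (cder0 hr) (cder0 hr)) (cder0 hr))).
  by ring.
have I3 (s : R) : 0 <= s <= 1 -> S 3 s = S 4 s * S 0 s.
  move=> hs; apply/eqP; rewrite -subr_eq0; apply/eqP.
  apply: (linear_eq0 (y := fun s => S 3 s - S 4 s * S 0 s)
    (f := fun s => x * (2 * S 2 s)) _ (b2 2)) hs; last by rewrite !S0 c00 c03 c04; ring.
  move=> r /[dup] /I1 e /s01 hr; apply: cder_eq.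
    exact: (cderB (cder3 hr) (cderM (cder4 hr) (cder0 hr))).
  by rewrite e; ring.
have I2 (s : R) : 0 <= s <= 1 -> S 2 s = S 4 s * S 1 s.
  move=> hs; apply/eqP; rewrite -subr_eq0; apply/eqP.
  apply: (linear_eq0 (y := fun s => S 2 s - S 4 s * S 1 s)
    (f := fun s => x * (4 * S 2 s)) _ (b2 4)) hs; last by rewrite !S0 c01 c02 c04; ring.
  move=> r /[dup] /I3 e /s01 hr; apply: cder_eq.
    exact: (cderB (cder2 hr) (cderM (cder4 hr) (cder1 hr))).
  by rewrite e; ring.
have I4 (s : R) : 0 <= s <= 1 -> S 0 s * (1 - t%:C - t%:C * (S 4 s * S 4 s)) = 1.
  move=> hs; apply/eqP; rewrite -subr_eq0; apply/eqP.
  apply: (linear_eq0 (y := fun s => S 0 s * (1 - t%:C - t%:C * (S 4 s * S 4 s)) - 1)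
    (f := fun s => x * (2 * S 2 s)) _ (b2 2)) hs; last by rewrite !S0 c00 c04 -expr2 V0E subrr.
  move=> r /[dup] /[dup] /I1 e1 /I2 e2 /s01 hr; apply: cder_eq.
    exact: (cderB (cderM (cder0 hr) (cderB (cder_cst _ _)
      (cderZ t%:C (cderM (cder4 hr) (cder4 hr))))) (cder_cst _ _)).
  transitivity (x * (2 * S 2 r) * (S 0 r * (1 - t%:C - t%:C * (S 4 r * S 4 r)) - 1) +
    2 * x * (S 2 r - S 4 r * (S 0 r * S 0 r - S 0 r))).
    by rewrite tVE; field.
  by rewrite -e1 -e2 subrr mulr0 addr0.
pose W s := theta0 + s%:C * x + t%:C * S 4 s.
pose D s := cexp (2 * 'i * W s) * (1 - 'i * S 4 s) - (1 + 'i * S 4 s).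
suff : D 1 = 0.
  by rewrite /D /W mul1r => /eqP; rewrite subr_eq0 => /eqP.
apply: (linear_eq0 (y := D) (f := fun s => x * ('i * S 0 s * (1 - 'i * S 4 s)))
  (B := normc x * (B * (1 + B)))); last by rewrite ler01 lexx.
- move=> r /[dup] /I4 e /s01 hr.
  have dW : cder W r (x * S 0 r).
    apply: cder_eq.
      exact: (cderD (cderD (cder_cst theta0 _) (cderM (cder_id r) (cder_cst x _)))
        (cderZ t%:C (cder4 hr))).
    by rewrite tVE; field.
  apply: cder_eq.
    exact: (cderB (cderM (cder_cexp (cderZ (2 * 'i) dW)) (cderB (cder_cst 1 _) (cderZ 'i (cder4 hr))))
      (cderD (cder_cst 1 _) (cderZ 'i (cder4 hr)))).
  rewrite /D; move: (cexp _) => E.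
  (* Thus T' = W' (1 + T^2), the differential equation of the tangent composed with W. *)
  have -> : t^-1%:C * (S 0 r - 1) = S 0 r * (1 + S 4 r * S 4 r).
    by rewrite -[in X in _ - X]e tVE; field.
  have -> : 1 + S 4 r * S 4 r = (1 - 'i * S 4 r) * (1 + 'i * S 4 r).
    transitivity (1 - ('i * 'i) * (S 4 r * S 4 r)); last by ring.
    by rewrite ii; ring.
  by ring.
- move=> r /s01 hr; rewrite !normcM normc_i mul1r ler_wpM2l ?normc_ge0//.
  apply: ler_pM; rewrite ?normc_ge0 ?hB//.
  by rewrite (le_trans (normcD _ _))// normcN normcM normc_i normc1 mul1r lerD2l hB.
- by rewrite /D /W !S0 c04 mul0r addr0 T0E subrr.
Qed.

End Solution.
End QuadraticSystem.

(** * Real analyticity where Im zeta is positive *)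

Section RealAnalyticity.
Variables (R : realType) (t : R) (zeta : R[i] -> R[i]).
Hypothesis t0 : 0 < t.
Hypothesis hz : is_zeta t zeta.
Implicit Types (x w : R[i]) (a b h : R).

Lemma csin2_ccos2 w : csin w ^+ 2 + ccos w ^+ 2 = 1.
Proof.
rewrite /csin /ccos cexpN; have A0 := cexp_neq0 ('i * w); have I0 := i_neq0 R.
move: (cexp _) A0 => A A0.
transitivity (((A - A^-1) ^+ 2 / ('i * 'i) + (A + A^-1) ^+ 2) / 4).
  by field; rewrite A0 I0.
by rewrite ii; field.
Qed.

Lemma ch_gt1 b : 0 < b -> 1 < ch b.
Proof.
move=> b0; rewrite -(@ltr_pXn2r _ 2) ?nnegrE ?(ltW (ch_gt0 _))// expr1n ch2_sh2.
by rewrite ltrDl exprn_gt0// sh_gt0.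
Qed.

Lemma zeta_real_complex a : 0 < Im (zeta a%:C) ->
  t%:C * csin (zeta a%:C) = (zeta a%:C - a%:C) * ccos (zeta a%:C).
Proof.
move=> y0; have [rel _] := zeta_real t0 hz a.
exact: (@zeta_rel_toc _ _ a%:C _ (cos_sh_gt0 _ y0)).
Qed.

(* With [T = tan w], [1 - t - t T^2] is the derivative of [w - t tan w]. *)
Lemma zeta_simple_root a : 0 < Im (zeta a%:C) ->
  1 - t%:C - t%:C * ((zeta a%:C - a%:C) / t%:C) ^+ 2 != 0.
Proof.
move=> y0; have [[hA _ _] _] := zeta_real t0 hz a.
have tC0 : t%:C != 0 :> R[i] by rewrite (inj_eq (@complexI R) _ 0) gt_eqF.
have rel := zeta_real_complex y0; set w := zeta a%:C in y0 hA rel *.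
set T := (w - a%:C) / t%:C; have cc := ccos_neq0 y0.
have TE : csin w = T * ccos w.
  by apply: (mulfI tC0); rewrite rel /T; field.
apply/eqP => D0.
(* A double root means cos^2 w = t. This being real, sin x cos x = 0: if sin x = 0 then y = sh y ch
   y, false for y > 0; if cos x = 0 then t <= 0. *)
have c2 : ccos w ^+ 2 = t%:C.
  have e : t%:C * (1 + T ^+ 2) = 1.
    by apply/eqP; rewrite -subr_eq0 -oppr_eq0 -D0; apply/eqP; ring.
  have := csin2_ccos2 w; rewrite TE => h.
  transitivity (t%:C * (1 + T ^+ 2) * ccos w ^+ 2); first by rewrite e mul1r.
  transitivity (t%:C * ((T * ccos w) ^+ 2 + ccos w ^+ 2)); first by ring.
  by rewrite h mulr1.
have s0 := sh_gt0 y0; have c0 := ch_gt0 (Im w); have c1 := ch_gt1 y0.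
have := ch2_sh2 (Im w); have := cos2Dsin2 (Re w); have := sh_ge (ltW y0).
have cR := congr1 (@complex.Re R) c2; have cI := congr1 (@complex.Im R) c2.
move: cR cI hA; rewrite expr2 ccosE !ReImE.
move: (Im w) (cos _) (sin _) (sh _) (ch _) s0 c0 c1 y0 => y c s k g k0 g0 g1 y0 cR cI hA ky cs gk.
have sc : s * c = 0.
  have : (2 * (g * k)) * (s * c) = 0 by rewrite -[RHS]oppr0 -cI; ring.
  by move/eqP; rewrite mulf_eq0 gt_eqF ?mulr_gt0//= => /eqP.
move/eqP: sc; rewrite mulf_eq0 => /orP[/eqP s00|/eqP c00].
  have c21 : c * c = 1 by rewrite -cs s00 expr0n addr0 expr2.
  have gt_ : g * g = t by rewrite -cR s00 -[LHS]mul1r -c21; ring.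
  have : y * (g * g) = k * g * (g * g).
    rewrite [LHS](_ : _ = (y - 0) * (c ^+ 2 + k ^+ 2)); last first.
      by rewrite subr0 expr2 c21 -gk expr2.
    by rewrite hA -gt_; ring.
  move/(mulIf (lt0r_neq0 (mulr_gt0 g0 g0))) => yE.
  suff : k < k * g by lra.
  by rewrite ltr_pMr.
move: cR; rewrite c00 mul0r mul0r sub0r mulrNN => cR.
suff : t <= 0 by rewrite leNgt t0.
by rewrite -cR oppr_le0 -expr2 sqr_ge0.
Qed.

Lemma psum_ser0 (c : nat -> R[i]) (C K : R) : 0 <= C -> 0 <= K ->
  (forall n, normc (c n) <= C * K ^+ n) -> psum (ser c 0) 1 = c 0.
Proof.
move=> C0 K0 h.
have g : geo_bounded (ser c 0) by apply: (geo_bounded_ser C0 K0 h); rewrite normc0 mulr0.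
rewrite psum_shift ?normr1// /ser expr0 mulr1.
rewrite (_ : (fun n => _) = (fun n => 0 * ser c 0 n)); last first.
  by apply/funext => n; rewrite exprS !mul0r mulr0.
by rewrite psumZ ?normr1// mul0r mulr0 addr0.
Qed.

(** The series solves the equation near [a]. Being Lipschitz, the solution stays close to zeta a,
    hence in the upper half-plane, where uniqueness identifies it with zeta; this requires Im x >
    0. *)
Lemma zeta_local_series a : 0 < Im (zeta a%:C) ->
  exists c C K, [/\ 0 <= C, 0 < K, forall n, normc (c n) <= C * K ^+ n &
    exists2 r : R, 0 < r & K * r < 1 /\ forall x, normc x <= r -> 0 < Im x ->
      zeta (a%:C + x) = a%:C + x + t%:C * psum (ser c x) 1].
Proof.
move=> y0; have rel := zeta_real_complex y0; have D0 := zeta_simple_root y0.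
have tC0 : t%:C != 0 :> R[i] by rewrite (inj_eq (@complexI R) _ 0) gt_eqF.
set w := zeta a%:C in y0 rel D0; pose T0 := (w - a%:C) / t%:C; rewrite -/T0 in D0.
have wE : a%:C + t%:C * T0 = w by rewrite /T0; field.
have T0E : cexp (2 * 'i * (a%:C + t%:C * T0)) * (1 - 'i * T0) = 1 + 'i * T0.
  rewrite wE; apply: cexp_of_csin.
  by apply: (mulfI tC0); rewrite rel /T0; field.
set D := 1 - _ - _ in D0; pose V0 := D^-1.
have V0E : V0 * (1 - t%:C - t%:C * T0 ^+ 2) = 1 by rewrite /V0 mulVf.
pose y (j : nat) : R[i] := match j with
  | 0 => V0 | 1 => V0 ^+ 2 - V0 | 2 => T0 * (V0 ^+ 2 - V0) | 3 => T0 * V0 | _ => T0 end.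
pose C : R := 1 + (normc (y 0) + normc (y 1) + normc (y 2) + normc (y 3) + normc (y 4)).
have yC j : normc (y j) <= C.
  have n0 := normc_ge0 (y 0); have n1 := normc_ge0 (y 1); have n2 := normc_ge0 (y 2).
  have n3 := normc_ge0 (y 3); have n4 := normc_ge0 (y 4).
  have -> : y j = y (minn j 4) by move: j => [|[|[|[|[|?]]]]].
  rewrite /C; move: (minn j 4) (geq_minr j 4) => k.
  move: n0 n1 n2 n3 n4; case: k => [|[|[|[|[|k]]]]] //; generalize y => z; move=> *; lra.
have C1 : 1 <= C.
  by rewrite /C lerDl !addr_ge0// normc_ge0.
have C0 : 0 <= C by apply: le_trans C1.
have [c [K [c0 cS K0 cb]]] := sys_solution t0 C1 yC.
pose d n := c n 4.
have db n : normc (d n) <= C * K ^+ n := cb n 4.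
exists d, C, K; split => //.
pose r1 := (4 * K)^-1.
have r10 : 0 < r1 by rewrite invr_gt0 mulr_gt0.
have K41 : K * r1 = 4^-1 by rewrite /r1 invfM mulrA -mulrAC divff ?mul1r// gt_eqF.
have K2 : 2 * (K * r1) < 1 by rewrite K41; lra.
have [L hL] := psum_ser_lipschitz C0 (ltW K0) r10 K2 db.
pose L1 := 1 + t * `|L|.
have L10 : 0 < L1 by rewrite ltr_wpDr// mulr_ge0// ltW.
(* The second bound keeps the solution within Im w / 2 of [w]. *)
pose r := Num.min r1 (Im w / (2 * L1)).
have r0 : 0 < r by rewrite lt_min r10 divr_gt0// mulr_gt0.
have rr1 : r <= r1 by rewrite ge_min lexx.
have Kr : K * r < 1.
  by apply: (@le_lt_trans _ _ (K * r1)); [rewrite ler_wpM2l// ltW|rewrite K41; lra].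
exists r => //; split => // x xr x0; apply/esym/(zeta_unique hz).
- by rewrite ImD !ReImE add0r.
- have := hL x 0 (le_trans xr rr1); rewrite normc0 subr0 => /(_ (ltW r10)).
  rewrite (psum_ser0 C0 (ltW K0) db) /d c0 /= => hT.
  have -> : a%:C + x + t%:C * psum (ser d x) 1 = w + (x + t%:C * (psum (ser d x) 1 - T0)).
    by rewrite -wE; ring.
  rewrite ImD.
  have : normc (x + t%:C * (psum (ser d x) 1 - T0)) <= L1 * r.
    apply: le_trans (normcD _ _) _; rewrite /L1 mulrDl mul1r lerD// normcM normc_real.
    rewrite gtr0_norm// -mulrA ler_wpM2l ?(ltW t0)//.
    apply: (le_trans hT); apply: (@le_trans _ _ (`|L| * normc x)).
      by rewrite ler_wpM2r ?normc_ge0// ler_norm.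
    by rewrite ler_wpM2l.
  move=> hh; have := le_trans (Im_normc _) hh; rewrite ler_norml => /andP[+ _].
  have : L1 * r <= Im w / 2.
    have : r <= Im w / (2 * L1) by rewrite ge_min lexx orbT.
    by rewrite invfM mulrA ler_pdivlMr// mulrC.
  lra.
- have Kx : K * normc x < 1 by apply: le_lt_trans Kr; rewrite ler_wpM2l// ltW.
  have cc0 : [/\ c 0 0 = V0, c 0 1 = V0 ^+ 2 - V0, c 0 2 = T0 * (V0 ^+ 2 - V0),
      c 0 3 = T0 * V0 & c 0 4 = T0] by rewrite c0.
  have /csin_of_cexp-> := sys_solves t0 C0 K0 cS cb Kx V0E cc0 T0E.
  rewrite -/d; ring.
Qed.

(** The real increment h is approached by h + i s: zeta varies little by continuity on the closed
    half-plane, and the series by its Lipschitz bound. *)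
Lemma zeta_series_real a : 0 < Im (zeta a%:C) ->
  exists c C K, [/\ 0 <= C, 0 < K, forall n, normc (c n) <= C * K ^+ n &
    exists2 r : R, 0 < r & K * r < 1 /\ forall h, `|h| <= r ->
      zeta (a + h)%:C = (a + h)%:C + t%:C * psum (ser c h%:C) 1].
Proof.
move=> /zeta_local_series[c [C [K [C0 K0 cb [r r0 [Kr hr]]]]]].
exists c, C, K; split => //.
pose r1 := (4 * K)^-1.
have r10 : 0 < r1 by rewrite invr_gt0 mulr_gt0.
have K41 : K * r1 = 4^-1 by rewrite /r1 invfM mulrA -mulrAC divff ?mul1r// gt_eqF.
have K2 : 2 * (K * r1) < 1 by rewrite K41; lra.
have [L hL] := psum_ser_lipschitz C0 (ltW K0) r10 K2 cb.
pose L1 := 1 + t * `|L|.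
have L10 : 0 < L1 by rewrite ltr_wpDr// mulr_ge0// ltW.
pose q := Num.min r r1 / 2.
have q0 : 0 < q by rewrite divr_gt0// lt_min r0.
have qr : q + q <= r by rewrite -splitr ge_min lexx.
have qr1 : q + q <= r1 by rewrite -splitr ge_min lexx orbT.
exists q => //; split.
  by apply: le_lt_trans Kr; rewrite ler_wpM2l ?(ltW K0)//; lra.
move=> h hq; apply/eqP; rewrite -subr_eq0 -normc_eq0 eq_le normc_ge0 andbT.
apply/ler_addgt0Pr => e e0; rewrite add0r.
have [d d0 hd] := @zeta_continuous _ _ _ hz (a + h)%:C (e / 2) (lexx 0) (divr_gt0 e0 (ltr0n _ 2)).
pose s := Num.min (d / 2) (Num.min q (e / 2 / L1)).
have s0 : 0 < s by rewrite !lt_min q0 !divr_gt0.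
have sd : s < d.
  by apply: (@le_lt_trans _ _ (d / 2)); [rewrite ge_min lexx|lra].
have sq : s <= q by rewrite !ge_min lexx orbT.
have sL : L1 * s <= e / 2.
  by rewrite mulrC -ler_pdivlMr// !ge_min lexx !orbT.
have nis : normc ('i * s%:C : R[i]) = s by rewrite normcM normc_i mul1r normc_real gtr0_norm.
pose x : R[i] := h%:C + 'i * s%:C.
have xq : normc x <= q + q.
  by apply: le_trans (normcD _ _) _; rewrite normc_real nis lerD.
have ixE : Im x = s by rewrite /x !ReImE; lra.
have := hr x (le_trans xq qr); rewrite ixE => /(_ s0) zE.
have := hd (a%:C + x); rewrite ImD ixE !ReImE add0r => /(_ (ltW s0)).
have -> : a%:C + x - (a + h)%:C = 'i * s%:C.
  by apply: complex_eqP; rewrite /x !ReImE; lra.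
rewrite nis => /(_ sd) h1.
have h2 := hL x h%:C (le_trans xq qr1) _.
have {}h2 := h2 (le_trans _ qr1); rewrite normc_real in h2.
have {}h2 := h2 (le_trans hq _); rewrite lerDl in h2; have {}h2 := h2 (ltW q0).
have xh : x - h%:C = 'i * s%:C by rewrite /x addrAC subrr add0r.
rewrite xh nis in h2.
have ahE : (a + h)%:C = a%:C + h%:C :> R[i] by apply: complex_eqP; rewrite !ReImE; lra.
have E : zeta (a + h)%:C - ((a + h)%:C + t%:C * psum (ser c h%:C) 1) =
    - (zeta (a%:C + x) - zeta (a + h)%:C) +
    ('i * s%:C + t%:C * (psum (ser c x) 1 - psum (ser c h%:C) 1)).
  set Z := zeta (a + h)%:C; rewrite zE -xh ahE; clearbody x; move: t%:C h%:C a%:C Z (psum _ _) (psum _ _) => v1 v2 v3 z p1 p2.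
  ring.
rewrite E.
apply: le_trans (normcD _ _) _; rewrite normcN [leRHS]splitr lerD ?(ltW h1)//.
apply: le_trans sL; apply: le_trans (normcD _ _) _.
rewrite nis normcM normc_real gtr0_norm// /L1 mulrDl mul1r lerD2l -mulrA ler_wpM2l ?(ltW t0)//.
by apply: (le_trans h2); rewrite ler_wpM2r ?(ltW s0)// ler_norm.
Qed.

Lemma Im_zeta_series a : 0 < Im (zeta a%:C) ->
  exists b : nat -> R, exists2 r : R, 0 < r & forall h, `|h| <= r ->
    series (fun k => b k * h ^+ k) @ \oo --> Im (zeta (a + h)%:C).
Proof.
move=> /zeta_series_real[c [C [K [C0 K0 cb [r r0 [Kr hr]]]]]].
exists (fun k => t * Im (c k)); exists r => // h hhr.
rewrite hr// ImD ImM !ReImE mul0r addr0 add0r /psum /=.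
have e : (fun n => Im (ser c h%:C n)) = (fun n => Im (c n) * h ^+ n).
  by apply/funext => n; rewrite /ser -[h%:C ^+ n]rmorphXn ImM !ReImE mulr0 add0r.
rewrite e.
have cv : cvgn (pseries (fun n => Im (c n) * h ^+ n) 1).
  apply: (@cvgn_pseries_geo _ _ (K * `|h|) C); rewrite ?mulr_ge0 ?(ltW K0)//.
    by rewrite mulr1; apply: le_lt_trans Kr; rewrite ler_wpM2l// ltW.
  move=> n; rewrite exprMn normrM normrX mulrA ler_wpM2r ?exprn_ge0//.
  exact: le_trans (Im_normc _) (cb n).
rewrite (_ : series _ = (fun n => t * pseries (fun n => Im (c n) * h ^+ n) 1 n)).
  exact: cvgMr cv.
apply/funext => n; rewrite /pseries/= mulr_sumr; apply: eq_bigr => k _.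
by rewrite expr1n mulr1 mulrA.
Qed.

Lemma fun_dens_analytic (x : R) : 0 < Im (zeta ((x - pi) / 2)%:C) ->
  analytic_at (fun_dens t zeta) x.
Proof.
move=> /Im_zeta_series[b [r r0 hr]].
exists (fun k => 2 / (pi * (4 * t)) * (b k * 2^-1 ^+ k)).
near=> h.
have hh : `|h / 2| <= r.
  near: h; apply/nbhs_ballP; exists r => //= h; rewrite /ball/= sub0r normrN => hr'.
  by rewrite normrM (@ger0_norm _ 2^-1)// ; apply: le_trans (ltW hr'); rewrite ler_piMr//; lra.
have := hr _ hh; rewrite /fun_dens (_ : (x - pi) / 2 + h / 2 = (x + h - pi) / 2); last first.
  by move: (pi : R) => p; field.
move=> H; have {}H := cvgMr (a := 2 / (pi * (4 * t))) H.
rewrite (_ : series _ = (fun n => 2 / (pi * (4 * t)) * series (fun k => b k * (h / 2) ^+ k) n)); first exact: H.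
apply/funext => n; rewrite /= mulr_sumr; apply: eq_bigr => k _.
by rewrite -!mulrA -exprMn [2^-1 * h]mulrC.
Unshelve. all: by end_near. Qed.

End RealAnalyticity.

(** * The zeros of Im zeta on the real axis *)

Section ZeroSet.
Variables (R : realType) (t : R) (zeta : R[i] -> R[i]).
Hypothesis t0 : 0 < t.
Hypothesis hz : is_zeta t zeta.
Implicit Types (a b x y : R).

Lemma drv_incr (f df : R -> R) a b :
  (forall x, a <= x <= b -> is_derive x (1 : R) f (df x)) ->
  (forall x, a < x < b -> 0 < df x) -> a < b -> f a < f b.
Proof.
move=> h h0 ab; have cf : {within `[a, b], continuous f}.
  apply: derivable_within_continuous => x; rewrite in_itv/= => /h hx; exact: ex_derive.
have [x xab|c] := MVT ab (df := df) _ cf.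
  by apply: h; move: xab; rewrite in_itv/= => /andP[? ?]; rewrite !ltW.
rewrite in_itv/= => /h0 c0 E; rewrite -subr_gt0 E mulr_gt0// subr_gt0//.
Qed.

Lemma cos_mono x y : 0 <= x -> x < y -> y <= pi -> cos y < cos x.
Proof. by move=> x0 xy yp; rewrite ltr_cos// in_itv/=; apply/andP; split; lra. Qed.

Lemma is_derive_sincos x : is_derive x (1 : R) (fun s => s - sin s * cos s) (2 * sin x ^+ 2).
Proof.
refine (drv_eq (drvB (drv_id x) (drvM (is_derive_sin x) (is_derive_cos x))) _).
by have := cos2Dsin2 x; lra.
Qed.

Lemma sincos_incr x y : 0 <= x -> x < y -> y <= pi ->
  x - sin x * cos x < y - sin y * cos y.
Proof.
move=> x0 xy yp.
apply: (@drv_incr (fun s => s - sin s * cos s) (fun s => 2 * sin s ^+ 2)) => //.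
  by move=> s _; exact: is_derive_sincos.
by move=> s /andP[s0 s1]; rewrite mulr_gt0// exprn_gt0// sin_gt0_pi//; apply/andP; split; lra.
Qed.

Lemma sincos_ndecr x y : x <= y -> x - sin x * cos x <= y - sin y * cos y.
Proof.
apply: (@drv_ndecr _ (fun s => s - sin s * cos s) (fun s => 2 * sin s ^+ 2)) => s _.
  exact: is_derive_sincos.
by rewrite mulr_ge0// sqr_ge0.
Qed.

Lemma sh_ch_gt y : 0 < y -> y < sh y * ch y.
Proof.
move=> y0; apply: (le_lt_trans (sh_ge (ltW y0))).
by rewrite ltr_pMr ?sh_gt0// ch_gt1.
Qed.

Lemma Re_zeta_opp a : Re (zeta (- a)%:C) = - Re (zeta a%:C).
Proof.
have [c1 _] := zeta_cvg_real hz (- a); have [c2 _] := zeta_cvg_real hz a.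
by apply: (lim_right_eq c1 (cvgN c2)) => s s0; rewrite (zeta_opp t0 hz).
Qed.

Let X a := Re (zeta a%:C).
Let Y a := Im (zeta a%:C).

(** The second identity results from eliminating cos^2 + sh^2 between the two real equations. *)
Lemma zeta_pos a : 0 < Y a ->
  Y a * (cos (X a) ^+ 2 + sh (Y a) ^+ 2) = t * (sh (Y a) * ch (Y a)) /\
  (X a - a) * (sh (Y a) * ch (Y a)) = Y a * (sin (X a) * cos (X a)).
Proof.
move=> y0; have [[h1 h2 _] _] := zeta_real t0 hz a.
rewrite subr0 in h1; split=> //.
apply: (mulfI (lt0r_neq0 t0)); rewrite mulrCA -h1 mulrCA h2; ring.
Qed.

(** As sh y < y ch y, one has y (cos^2 + sh^2) = t sh ch < t y (1 + sh^2); with t <= 1 the terms in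
    sh^2 can be removed. *)
Lemma zeta_pos_cos2 a : t <= 1 -> 0 < Y a -> cos (X a) ^+ 2 < t.
Proof.
move=> t1 y0; have [h _] := zeta_pos y0.
have := sh_lt_ych y0; have := ch2_sh2 (Y a); have := ch_gt0 (Y a).
rewrite -(ltr_pM2l y0 (cos _ ^+ 2)); move: h.
move: (Y a) (cos _) (sh _) (ch _) y0 => y c k g y0 h g0 gk kyg.
have e : t * (k * g) < t * y * (1 + k ^+ 2).
  rewrite -gk -[ltRHS]mulrA; rewrite (ltr_pM2l t0).
  by rewrite expr2 mulrA ltr_pM2r.
have : t * (y * k ^+ 2) <= y * k ^+ 2 by rewrite ler_piMl// mulr_ge0 ?sqr_ge0// ltW.
lra.
Qed.

Section Edge.
Variable xc : R.
Hypothesis xc_ge0 : 0 <= xc.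
Hypothesis xc_lt : xc < pi / 2.
Hypothesis cos_xc : cos xc ^+ 2 = t.

(** [xc] is a critical point of x - t tan x, and [h] is its critical value because t tan xc = sin xc
    cos xc. *)
Let h := xc - sin xc * cos xc.

Let t1 : t <= 1.
Proof. by rewrite -cos_xc; have := cos2Dsin2 xc; have := sqr_ge0 (sin xc); lra. Qed.

Let p2 : 1 <= pi / 2 :> R. Proof. exact: pihalf_ge1. Qed.

Let cos_xc_gt0 : 0 < cos xc.
Proof. apply: cos_gt0_pihalf; apply/andP; split=> //; move: (pi : R) xc_lt p2 xc_ge0 => p; lra. Qed.

Lemma edge_ge0 : 0 <= h.
Proof. by have := sincos_ndecr xc_ge0; rewrite sin0 mul0r subr0. Qed.

Lemma edge_lt : h < pi / 2.
Proof.
have := sincos_incr xc_ge0 xc_lt; rewrite cos_pihalf mulr0 subr0; apply.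
by move: (pi : R) p2 => p; lra.
Qed.

(** As y < sh y ch y, the second identity of [zeta_pos] gives a >= x - sin x cos x when the product
    is nonnegative and a >= x otherwise. For x <= pi / 2, cos^2 x < t puts x beyond [xc], and x -
    sin x cos x is increasing; for larger x it already exceeds pi / 2 > h. *)
Lemma pos_right a : 0 < Y a -> 0 <= X a -> h < a.
Proof.
move=> y0 x0; have [_ e] := zeta_pos y0; have c2 := zeta_pos_cos2 t1 y0.
have yM := sh_ch_gt y0; set M := sh _ * _ in e yM.
have M0 : 0 < M by apply: lt_trans yM.
set x := X a in x0 e c2; set y := Y a in y0 e yM.
have A : 0 <= sin x * cos x -> x - sin x * cos x <= a.
  move=> s0; suff : x - a <= sin x * cos x by lra.
  by rewrite -(ler_pM2r M0) e mulrC ler_wpM2l// ltW.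
have B : sin x * cos x <= 0 -> x <= a.
  by move=> s0; rewrite -subr_le0 -(pmulr_lle0 _ M0) e pmulr_rle0.
have [xp|xp] := leP x (pi / 2); last first.
  have [s0|s0] := leP 0 (sin x * cos x).
    have := sincos_ndecr (ltW xp); rewrite cos_pihalf mulr0 subr0.
    by move=> e1; apply: (lt_le_trans edge_lt); apply: le_trans e1 _; exact: A.
  by apply: lt_le_trans (B (ltW s0)); apply: lt_trans xp; exact: edge_lt.
have xpi : x <= pi by move: (pi : R) xp p2 => p; lra.
have cx : 0 <= cos x.
  by apply: cos_ge0_pihalf; apply/andP; split=> //; move: (pi : R) p2 => p; lra.
have sx : 0 <= sin x by apply: sin_ge0_pi; rewrite x0.
apply: lt_le_trans (A (mulr_ge0 sx cx)).
apply: sincos_incr => //; rewrite ltNge; apply/negP; rewrite le_eqVlt => /orP[/eqP xE|xx].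
  by move: c2; rewrite xE cos_xc ltxx.
have : cos xc < cos x by apply: cos_mono => //; move: (pi : R) p2 xc_lt xc_ge0 => p; lra.
by rewrite -(@ltr_pXn2r _ 2) ?nnegrE ?(ltW cos_xc_gt0)// cos_xc => h1; move: (lt_trans c2 h1); rewrite ltxx.
Qed.

Lemma Im_zeta_eq0 a : - h <= a <= h -> Y a = 0.
Proof.
move=> /andP[a1 a2]; have [_] := zeta_real t0 hz a.
rewrite -/(Y a) le_eqVlt => /orP[/eqP//|y0].
have [x0|x0] := leP 0 (X a); first by have := pos_right y0 x0; lra.
have := @pos_right (- a); rewrite /Y /X (Im_zeta_opp t0 hz) Re_zeta_opp => /(_ y0).
have x0' : 0 <= - X a by lra.
move=> /(_ x0'); lra.
Qed.

(** The condition t <= cos^2 x confines x to [-xc, xc], where x - t tan x increases up to its value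
    [h] at [xc]. *)
Lemma real_branch x a : - (pi / 2) <= x <= pi / 2 -> t <= cos x ^+ 2 ->
  (x - a) * cos x ^+ 2 = t * (sin x * cos x) -> [/\ x <= xc, x < xc -> a < h & - xc <= x].
Proof.
move=> xp cx e.
have c0 : 0 <= cos x by exact: cos_ge0_pihalf.
have cc : cos xc <= cos x.
  by rewrite -(@ler_pXn2r _ 2) ?nnegrE ?(ltW cos_xc_gt0)// cos_xc.
have cx0 : 0 < cos x by apply: lt_le_trans cc.
have H z : cos z = cos x -> z <= pi / 2 -> z <= xc.
  move=> cz z1; rewrite leNgt; apply/negP => z2.
  have : cos z < cos xc by apply: cos_mono => //; move: (pi : R) p2 z1 => p; lra.
  by rewrite cz ltNge cc.
have x1 : x <= xc by apply: H => //; case/andP: xp.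
have x2 : - xc <= x.
  by rewrite lerNl; apply: H; rewrite ?cosN// lerNl; case/andP: xp.
split=> // xx.
have -> : a = x - t * tan x.
  rewrite /tan; apply: (mulIf (lt0r_neq0 (exprn_gt0 2 cx0))).
  have -> : (x - t * (sin x / cos x)) * cos x ^+ 2 = x * cos x ^+ 2 - t * (sin x * cos x).
    by field; rewrite gt_eqF.
  by rewrite -e; ring.
have -> : h = xc - t * tan xc.
  by rewrite /h /tan -cos_xc; field; rewrite gt_eqF.
have cosge s : - xc <= s <= xc -> cos xc <= cos s.
  move=> /andP[s1 s2]; have H2 z : 0 <= z -> z <= xc -> cos xc <= cos z.
    move=> z0; rewrite le_eqVlt => /orP[/eqP->//|z1]; apply/ltW/cos_mono => //.
    by move: (pi : R) p2 xc_lt xc_ge0 => p; lra.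
  by have [s0|s0] := leP 0 s; [exact: H2|rewrite -[cos s]cosN; apply: H2; lra].
apply: (@drv_incr (fun s => s - t * tan s) (fun s => 1 - t * cos s ^- 2)) => //.
  move=> s /andP[s1 s2]; refine (drvB (drv_id s) (drvZ t (is_derive_tan _))).
  by apply: lt0r_neq0; apply: lt_le_trans (cosge s _) => //; rewrite s2 (le_trans x2).
move=> s /andP[s1 s2].
have cs : cos xc < cos s.
  have [s0|s0] := leP 0 s; first by apply: cos_mono => //; move: (pi : R) p2 xc_lt xc_ge0 => p; lra.
  by rewrite -[cos s]cosN; apply: cos_mono => //; move: (pi : R) p2 xc_lt xc_ge0 => p; lra.
have cs0 : 0 < cos s by apply: lt_trans cs.
by rewrite subr_gt0 ltr_pdivrMr ?exprn_gt0// mul1r -cos_xc ltr_pXn2r// nnegrE ltW.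
Qed.

Lemma real_branch_le x a : - (pi / 2) <= x <= pi / 2 -> t <= cos x ^+ 2 ->
  (x - a) * cos x ^+ 2 = t * (sin x * cos x) -> a <= h.
Proof.
move=> xp lx ex; have [x1 x2 _] := real_branch xp lx ex.
move: x1; rewrite le_eqVlt => /orP[/eqP xE|/x2/ltW//].
suff -> : a = h by [].
apply: (mulIf (lt0r_neq0 (exprn_gt0 2 cos_xc_gt0))).
by rewrite /h -xE mulrBl -mulrA; move: ex; rewrite -cos_xc -xE; lra.
Qed.

Lemma zeta_real_zero a : Y a = 0 -> t <= cos (X a) ^+ 2 /\
  (X a - a) * cos (X a) ^+ 2 = t * (sin (X a) * cos (X a)).
Proof.
move=> y0; have [[_ e l] _] := zeta_real t0 hz a; move: e l.
by rewrite -/(Y a) y0 sh0 expr0n addr0.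
Qed.

(** Because |sin x cos x| <= 1/2 and t <= cos^2 x. For a between 0 and pi this leaves x in a window
    where [real_branch] applies, up to the reflection x -> pi - x. *)
Lemma zeta_real_dist a : Y a = 0 -> - 2^-1 <= X a - a <= 2^-1.
Proof.
move=> /zeta_real_zero[l e]; have c0 : 0 < cos (X a) ^+ 2 by apply: lt_le_trans l.
have := cos2Dsin2 (X a); move: (X a) (cos _) (sin _) c0 l e => x c s c0 l e cs.
have /andP[b1 b2] : - 2^-1 <= s * c <= 2^-1.
  by have := sqr_ge0 (s - c); have := sqr_ge0 (s + c); rewrite sqrrD sqrrB => ? ?; apply/andP; split; lra.
have e1 : 0 <= t * (s * c + 2^-1) by rewrite mulr_ge0 ?(ltW t0)//; lra.
have e2 : 0 <= t * (2^-1 - s * c) by rewrite mulr_ge0 ?(ltW t0)//; lra.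
apply/andP; split; rewrite -(ler_pM2r c0) e; lra.
Qed.

Lemma Im_zeta_gt0 a : h < a < pi - h -> 0 < Y a.
Proof.
move=> /andP[a1 a2]; have [_] := zeta_real t0 hz a.
rewrite -/(Y a) le_eqVlt => /orP[/eqP/esym y0|//].
have [l e] := zeta_real_zero y0; have /andP[d1 d2] := zeta_real_dist y0.
have h0 := edge_ge0.
exfalso; move: l e d1 d2; set x := X a => l e d1 d2.
have H := real_branch_le.
have [xp|xp] := leP x (pi / 2).
  suff : a <= h by lra.
  by apply: (H x) => //; apply/andP; split=> //; move: (pi : R) p2 => p; lra.
(* The pair (pi - a, pi - x) satisfies the same real equations. *)
suff : pi - a <= h by move: (pi : R) a2 => p; lra.
apply: (H (pi - x)).
- by apply/andP; split; move: (pi : R) p2 a2 xp => p; lra.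
- by rewrite cosB cospi sinpi mul0r addr0 mulN1r sqrrN.
rewrite cosB sinB cospi sinpi !mul0r addr0 mulN1r sqrrN sub0r mulN1r opprK.
by move: e; move: (pi : R) (cos x) (sin x) => p c s e; lra.
Qed.

Lemma Re_zeta_ge0 a : h < a -> 0 < Y a -> 0 <= X a.
Proof.
move=> ha y0; rewrite leNgt; apply/negP => x0.
have x0' : 0 <= - X a by lra.
have := @pos_right (- a); rewrite /Y /X (Im_zeta_opp t0 hz) Re_zeta_opp => /(_ y0 x0').
by have := edge_ge0; move: ha; lra.
Qed.

(** Fixes the side from which x reaches [xc], so that limits at [0^'+] can be composed with x -
    xc. *)
Lemma Re_zeta_gt a : h < a -> 0 < Y a -> X a < pi / 2 -> xc < X a.
Proof.
move=> ha y0 xp; have x0 := Re_zeta_ge0 ha y0; have c2 := zeta_pos_cos2 t1 y0.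
rewrite ltNge; apply/negP => xx.
have : cos xc <= cos (X a).
  move: xx; rewrite le_eqVlt => /orP[/eqP->//|xx]; apply/ltW/cos_mono => //.
  by move: (pi : R) p2 xc_lt => p; lra.
rewrite -(@ler_pXn2r _ 2) ?nnegrE ?(ltW cos_xc_gt0)//; last first.
  by apply: cos_ge0_pihalf; apply/andP; split; move: (pi : R) p2 xp => p; lra.
by rewrite cos_xc leNgt c2.
Qed.

Lemma zeta_edge : zeta h%:C = xc%:C.
Proof.
have h0 := edge_ge0; have hp := edge_lt.
have y0 : Y h = 0 by apply: Im_zeta_eq0; rewrite lexx andbT; lra.
have [l e] := zeta_real_zero y0; have /andP[d1 d2] := zeta_real_dist y0.
apply: complex_eqP => /=; last exact: y0.
move: l e d1 d2; rewrite -/(X h); set x := X h => l e d1 d2.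
have [xp|xp] := leP x (pi / 2).
  have xp2 : - (pi / 2) <= x <= pi / 2 by rewrite xp andbT; move: (pi : R) p2 => p; lra.
  have [x1 x2 _] := real_branch xp2 l e.
  by apply/eqP; rewrite eq_le x1 leNgt; apply/negP => /x2; rewrite ltxx.
exfalso; suff : pi - h <= h by move: (pi : R) hp => p; lra.
apply: (@real_branch_le (pi - x)).
- by apply/andP; split; move: (pi : R) p2 hp xp => p; lra.
- by rewrite cosB cospi sinpi mul0r addr0 mulN1r sqrrN.
rewrite cosB sinB cospi sinpi !mul0r addr0 mulN1r sqrrN sub0r mulN1r opprK.
by move: e; move: (pi : R) (cos x) (sin x) => p c s e; lra.
Qed.

End Edge.

Lemma Im_zeta_gt0_supercritical a : 1 < t -> 0 < Y a.
Proof.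
move=> t1; have [_] := zeta_real t0 hz a.
rewrite -/(Y a) le_eqVlt => /orP[/eqP/esym y0|//].
have [l _] := zeta_real_zero y0.
by have := cos2Dsin2 (X a); have := sqr_ge0 (sin (X a)); lra.
Qed.

End ZeroSet.

(** * One-sided limits and leading terms at 0 *)

Section RightLimits.
Variable R : realType.
Implicit Types (f g F G : R -> R) (l m x y : R).

Lemma cvg_right_near F G l m : (\forall s \near (0 : R)^'+, F s = G s) -> l = m ->
  F s @[s --> 0^'+] --> l -> G s @[s --> 0^'+] --> m.
Proof. by move=> e <- Fl; apply: cvg_trans Fl; exact: near_eq_cvg. Qed.

Lemma rcvgM F G l m : F s @[s --> 0^'+] --> l -> G s @[s --> 0^'+] --> m ->
  F s * G s @[s --> 0^'+] --> l * m.
Proof. exact: cvgM. Qed.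
Lemma rcvgD F G l m : F s @[s --> 0^'+] --> l -> G s @[s --> 0^'+] --> m ->
  F s + G s @[s --> 0^'+] --> l + m.
Proof. exact: cvgD. Qed.
Lemma rcvgB F G l m : F s @[s --> 0^'+] --> l -> G s @[s --> 0^'+] --> m ->
  F s - G s @[s --> 0^'+] --> l - m.
Proof. exact: cvgB. Qed.
Lemma rcvgV F l : l != 0 -> F s @[s --> 0^'+] --> l -> (F s)^-1 @[s --> 0^'+] --> l^-1.
Proof. exact: cvgV. Qed.
Lemma rcvg_cst l : l @[s --> (0 : R)^'+] --> l.
Proof. exact: cvg_cst. Qed.

Lemma cvg_right_pos F : F s @[s --> 0^'+] --> (0 : R) ->
  (\forall s \near (0 : R)^'+, 0 < F s) -> F s @[s --> 0^'+] --> (0 : R)^'+.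
Proof.
move=> F0 Fp A; rewrite /at_right => hA.
have := F0 _ hA; apply: filterS2 Fp => s s0; exact.
Qed.

Lemma drv_right f d : is_derive (0 : R) (1 : R) f d -> f 0 = 0 -> f s @[s --> 0^'+] --> (0 : R).
Proof.
move=> h f0; apply: cvg_at_right_filter; rewrite -{2}f0.
by apply: differentiable_continuous; apply/derivable1_diffP; exact: ex_derive.
Qed.

Lemma lhopital0 f df g dg l : (forall x, 0 <= x -> is_derive x (1 : R) f (df x)) ->
  (forall x, 0 <= x -> is_derive x (1 : R) g (dg x)) -> f 0 = 0 -> g 0 = 0 ->
  (forall x, 0 < x -> dg x != 0) -> df s / dg s @[s --> 0^'+] --> l ->
  f s / g s @[s --> 0^'+] --> l.
Proof.
move=> hf hg f0 g0 dg0 hl; apply: (@lhopital_at_right _ f df g dg 0 1 l) => //.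
- by move=> x; rewrite in_itv/= => /andP[x0 _]; exact/hf/ltW.
- by move=> x; rewrite in_itv/= => /andP[x0 _]; exact/hg/ltW.
- exact: drv_right (hf 0 (lexx 0)) f0.
- exact: drv_right (hg 0 (lexx 0)) g0.
by move=> x; rewrite in_itv/= => /andP[x0 _]; exact: dg0.
Qed.

Lemma cvg_right_id : s @[s --> (0 : R)^'+] --> (0 : R).
Proof. exact: cvg_at_right_filter. Qed.

Lemma cvg_right_continuous f F l : {for l, continuous f} -> F s @[s --> 0^'+] --> l ->
  f (F s) @[s --> 0^'+] --> f l.
Proof. by move=> cf Fl; exact: (continuous_cvg _ cf Fl). Qed.

Lemma ch_cvg1 : ch s @[s --> 0^'+] --> (1 : R).
Proof. by rewrite -(@ch0 R); apply: cvg_right_continuous cvg_right_id; exact: continuous_ch. Qed.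

Lemma cos_cvg1 : cos s @[s --> 0^'+] --> (1 : R).
Proof. by rewrite -(@cos0 R); apply: cvg_right_continuous cvg_right_id; exact: continuous_cos. Qed.

Lemma is_derive_cube x : is_derive x (1 : R) (fun s => s ^+ 3) (3 * x ^+ 2).
Proof.
apply: (@drv_ext _ (fun s => s * (s * s))); first by move=> s; rewrite !exprS expr0 mulr1.
by refine (drv_eq (drvM (drv_id x) (drvM (drv_id x) (drv_id x))) _); ring.
Qed.

Lemma sh_div_cvg : sh s / s @[s --> 0^'+] --> (1 : R).
Proof.
apply: (@lhopital0 (@sh R) (@ch R) (fun s => s) (fun=> 1)); rewrite ?sh0//.
  by move=> x _; exact: is_derive_sh.
by apply: cvg_right_near ch_cvg1 => //; near=> s; rewrite divr1.
Unshelve. all: by end_near. Qed.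

Lemma sin_div_cvg : sin s / s @[s --> 0^'+] --> (1 : R).
Proof.
apply: (@lhopital0 (@sin R) (@cos R) (fun s => s) (fun=> 1)); rewrite ?sin0//.
by apply: cvg_right_near cos_cvg1 => //; near=> s; rewrite divr1.
Unshelve. all: by end_near. Qed.

Lemma cube_neq0 x : 0 < x -> 3 * x ^+ 2 != 0.
Proof. by move=> x0; rewrite mulf_neq0// expf_neq0// gt_eqF. Qed.

Lemma shch_cvg : (sh s * ch s - s) / s ^+ 3 @[s --> 0^'+] --> (2 / 3 : R).
Proof.
apply: (@lhopital0 (fun s => sh s * ch s - s) (fun s => 2 * sh s ^+ 2) (fun s => s ^+ 3)
  (fun s => 3 * s ^+ 2)).
- move=> x _; refine (drv_eq (drvB (drvM (is_derive_sh x) (is_derive_ch x)) (drv_id x)) _).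
  by have := ch2_sh2 x; lra.
- by move=> x _; exact: is_derive_cube.
- by rewrite sh0 mul0r subr0.
- by rewrite expr0n.
- exact: cube_neq0.
refine (cvg_right_near _ _ (cvgM (cvg_cst (2 / 3 : R)) (cvgM sh_div_cvg sh_div_cvg))); last by rewrite !mulr1.
near=> s; have s0 : 0 < s by near: s; exact: nbhs_right_gt.
by rewrite /=; move: (sh s) => k; field; rewrite gt_eqF.
Unshelve. all: by end_near. Qed.

Lemma ychsh_cvg : (s * ch s - sh s) / s ^+ 3 @[s --> 0^'+] --> (3^-1 : R).
Proof.
apply: (@lhopital0 (fun s => s * ch s - sh s) (fun s => s * sh s) (fun s => s ^+ 3)
  (fun s => 3 * s ^+ 2)).
- move=> x _; refine (drv_eq (drvB (drvM (drv_id x) (is_derive_ch x)) (is_derive_sh x)) _).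
  by lra.
- by move=> x _; exact: is_derive_cube.
- by rewrite sh0 mul0r subr0.
- by rewrite expr0n.
- exact: cube_neq0.
refine (cvg_right_near _ _ (cvgM (cvg_cst (3^-1 : R)) sh_div_cvg)); last by rewrite !mulr1.
near=> s; have s0 : 0 < s by near: s; exact: nbhs_right_gt.
by rewrite /=; move: (sh s) => k; field; rewrite gt_eqF.
Unshelve. all: by end_near. Qed.

Lemma sincos_cvg : (s - sin s * cos s) / s ^+ 3 @[s --> 0^'+] --> (2 / 3 : R).
Proof.
apply: (@lhopital0 (fun s => s - sin s * cos s) (fun s => 2 * sin s ^+ 2) (fun s => s ^+ 3)
  (fun s => 3 * s ^+ 2)).
- by move=> x _; exact: is_derive_sincos.
- by move=> x _; exact: is_derive_cube.
- by rewrite sin0 mul0r subr0.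
- by rewrite expr0n.
- exact: cube_neq0.
refine (cvg_right_near _ _ (cvgM (cvg_cst (2 / 3 : R)) (cvgM sin_div_cvg sin_div_cvg))); last by rewrite !mulr1.
near=> s; have s0 : 0 < s by near: s; exact: nbhs_right_gt.
by rewrite /=; move: (sin s) => k; field; rewrite gt_eqF.
Unshelve. all: by end_near. Qed.

(** 1 - F divides 1 - F^(n+1), with quotient at least 1. Equivalents containing roots are thereby
    checked on powers, where the roots disappear. *)
Lemma cvg1_root n F : (\forall s \near (0 : R)^'+, 0 <= F s) ->
  F s ^+ n.+1 @[s --> 0^'+] --> (1 : R) -> F s @[s --> 0^'+] --> (1 : R).
Proof.
move=> F0 h; apply/cvgrPdist_lt => e e0.
have /cvgrPdist_lt/(_ e e0) := h; apply: filterS2 F0 => s f0.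
apply: le_lt_trans; rewrite -[X in `|X - _ ^+ _|](expr1n _ n.+1) subrXX normrM ler_peMr//.
apply: le_trans (ler_norm _); rewrite big_ord_recl/= expr1n expr0 mulr1 lerDl.
by rewrite sumr_ge0// => i _; rewrite expr1n mul1r exprn_ge0.
Qed.

End RightLimits.
Arguments rcvg_cst {R} l [t] _.

(** * Behaviour of zeta at the edge *)

Section EdgeAsymptotics.
Variables (R : realType) (t : R) (zeta : R[i] -> R[i]).
Hypothesis t0 : 0 < t.
Hypothesis hz : is_zeta t zeta.
Implicit Types (a b x y : R).

Let X a := Re (zeta a%:C).
Let Y a := Im (zeta a%:C).

Lemma zeta_cvg_edge a : X (a + s) @[s --> 0^'+] --> X a /\ Y (a + s) @[s --> 0^'+] --> Y a.
Proof.
have h (e : R) : 0 < e -> exists2 d : R, 0 < d & forall s, 0 < s < d ->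
    normc (zeta (a + s)%:C - zeta a%:C) < e.
  move=> e0; have [d d0 hd] := @zeta_continuous _ _ _ hz a%:C e (lexx 0) e0.
  exists d => // s /andP[s0 sd]; apply: hd => //.
  have -> : (a + s)%:C - a%:C = s%:C :> R[i].
    by apply: complex_eqP; rewrite !ReImE; lra.
  by rewrite normc_real gtr0_norm.
split; apply: cvg_right => e /h[d d0 hd]; exists d => // s /hd; apply: le_lt_trans.
  by have := Re_normc (zeta (a + s)%:C - zeta a%:C); rewrite ReD ReN.
by have := Im_normc (zeta (a + s)%:C - zeta a%:C); rewrite ImD ImN.
Qed.

Section Edge.
Variable xc : R.
Hypothesis xc_ge0 : 0 <= xc.
Hypothesis xc_lt : xc < pi / 2.
Hypothesis cos_xc : cos xc ^+ 2 = t.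

Let h := xc - sin xc * cos xc.
Let x d := X (h + d).
Let y d := Y (h + d).

Let p2 : 1 <= pi / 2 :> R. Proof. exact: pihalf_ge1. Qed.

Let x_cvg : x d @[d --> 0^'+] --> xc.
Proof. by have [+ _] := zeta_cvg_edge h; rewrite {2}/X (zeta_edge t0 hz xc_ge0 xc_lt cos_xc). Qed.

Let y_cvg : y d @[d --> 0^'+] --> (0 : R).
Proof. by have [_ +] := zeta_cvg_edge h; rewrite {2}/Y (zeta_edge t0 hz xc_ge0 xc_lt cos_xc). Qed.

Let y_gt0 : \forall d \near (0 : R)^'+, 0 < y d.
Proof.
have := edge_ge0 xc_ge0; have := edge_lt xc_ge0 xc_lt; rewrite -/h => h1 h2.
have hp : 0 < pi - (h + h) by move: (pi : R) h1 => p; lra.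
near=> d; apply: (Im_zeta_gt0 t0 hz xc_ge0 xc_lt cos_xc); rewrite -/h.
have d0 : 0 < d by near: d; exact: nbhs_right_gt.
have : d < pi - (h + h) by near: d; exact: nbhs_right_lt.
by move: (pi : R) => p ?; apply/andP; split; lra.
Unshelve. all: by end_near. Qed.

Let x_gt : \forall d \near (0 : R)^'+, xc < x d.
Proof.
near=> d; apply: (Re_zeta_gt t0 hz xc_ge0 xc_lt cos_xc).
- by rewrite ltrDl; near: d; exact: nbhs_right_gt.
- by near: d; exact: y_gt0.
by near: d; apply: (cvgr_lt xc).
Unshelve. all: by end_near. Qed.

Let u_cvg : x d - xc @[d --> 0^'+] --> (0 : R)^'+.
Proof.
apply: cvg_right_pos.
  by refine (cvg_right_near _ _ (rcvgB x_cvg (rcvg_cst xc))); [near=> d|exact: subrr].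
by near=> d; rewrite subr_gt0; near: d; exact: x_gt.
Unshelve. all: by end_near. Qed.

Let y_right : y d @[d --> 0^'+] --> (0 : R)^'+.
Proof. exact: cvg_right_pos y_cvg y_gt0. Qed.

(** Leading terms known at 0 in one variable are transported along y, and below along x - xc. *)
Let comp_y F (l : R) : F s @[s --> 0^'+] --> l -> F (y d) @[d --> 0^'+] --> l.
Proof. by move=> Fl; exact: (cvg_comp _ _ y_right Fl). Qed.

Let comp_u F (l : R) : F s @[s --> 0^'+] --> l -> F (x d - xc) @[d --> 0^'+] --> l.
Proof. by move=> Fl; exact: (cvg_comp _ _ u_cvg Fl). Qed.

Let rel d : 0 < y d ->
  cos (x d) ^+ 2 = t * (sh (y d) * ch (y d)) / y d - sh (y d) ^+ 2 /\
  x d - (h + d) = y d * (sin (x d) * cos (x d)) / (sh (y d) * ch (y d)).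
Proof.
move=> y0; have [e1 e2] := zeta_pos t0 hz y0.
have M0 : 0 < sh (y d) * ch (y d) by rewrite mulr_gt0 ?sh_gt0 ?ch_gt0.
split; last by rewrite -[_ * (sin _ * _)]e2 mulfK// gt_eqF.
by rewrite -[t * _]e1 mulrC mulKf ?gt_eqF// addrK.
Qed.

Let cvg_cos (F : R -> R) (l : R) : F d @[d --> 0^'+] --> l -> cos (F d) @[d --> 0^'+] --> cos l.
Proof. by apply: cvg_right_continuous; exact: continuous_cos. Qed.
Let cvg_sin (F : R -> R) (l : R) : F d @[d --> 0^'+] --> l -> sin (F d) @[d --> 0^'+] --> sin l.
Proof. by apply: cvg_right_continuous; exact: continuous_sin. Qed.

Let x_lt : \forall d \near (0 : R)^'+, x d < pi / 2.
Proof. exact: (cvgr_lt xc). Qed.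

Let kg d : 0 < y d -> 1 - y d / (sh (y d) * ch (y d)) =
  (sh (y d) * ch (y d) - y d) / y d ^+ 3 * (y d ^+ 2 * (y d / (sh (y d) * ch (y d)))).
Proof.
move=> y0; move: (sh_gt0 y0) (ch_gt0 (y d)); move: (sh _) (ch _) => k g k0 g0.
by field; rewrite !gt_eqF.
Qed.

Let yk_cvg : y d / (sh (y d) * ch (y d)) @[d --> 0^'+] --> (1 : R).
Proof.
have L := rcvgM (comp_y (@sh_div_cvg R)) (comp_y (@ch_cvg1 R)).
have nz : 1 * 1 != 0 :> R by rewrite mulr1 oner_neq0.
refine (cvg_right_near _ _ (rcvgV nz L)); last by rewrite mulr1 invr1.
near=> d; have y0 : 0 < y d by near: d; exact: y_gt0.
rewrite /=; move: (sh_gt0 y0) (ch_gt0 (y d)); move: (sh _) (ch _) => k g k0 g0.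
by field; rewrite !gt_eqF.
Unshelve. all: by end_near. Qed.

(** The identity sin (x - xc) sin (x + xc) = t - cos^2 x shows that x - xc is of order y^2. Inserted
    in the second part of [rel], it expands d; the terms containing 2/3 cancel and d / y^2 tends to
    tan xc. *)
Lemma sqrt_asymptotics : 0 < xc -> y d ^+ 2 / d @[d --> 0^'+] --> cos xc / sin xc.
Proof.
move=> xc0.
have c0 : 0 < cos xc by apply: cos_gt0_pihalf; apply/andP; split=> //; move: (pi : R) p2 => p; lra.
have s0 : 0 < sin xc by apply: sin_gt0_pihalf; rewrite xc0.
have Lk := comp_y (@sh_div_cvg R); have LP := comp_y (@shch_cvg R).
have Ls := comp_u (@sin_div_cvg R); have Lx := cvg_sin (rcvgD x_cvg (rcvg_cst xc)).
have Lc := cvg_cos (rcvgD x_cvg (rcvg_cst xc)).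
have L1 : (x d - xc) / y d ^+ 2 @[d --> 0^'+] -->
    (1 - 2 / 3 * t) / (2 * (sin xc * cos xc)).
  have Ln := rcvgB (rcvgM Lk Lk) (rcvgM (rcvg_cst t) LP).
  have nz : 1 * sin (xc + xc) != 0 :> R.
    by rewrite mul1r sinD gt_eqF//; have := mulr_gt0 s0 c0; lra.
  refine (cvg_right_near _ _ (rcvgM Ln (rcvgV nz (rcvgM Ls Lx)))); last first.
    have -> : sin (xc + xc) = 2 * (sin xc * cos xc).
      by rewrite sinD; move: (sin xc) (cos xc) => s c; lra.
    by rewrite !mul1r [t * _]mulrC.
  near=> d; rewrite /=.
  have y0 : 0 < y d by near: d; exact: y_gt0.
  have u0 : 0 < x d - xc by rewrite subr_gt0; near: d; exact: x_gt.
  have xp : x d < pi / 2 by near: d; exact: x_lt.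
  have su0 : 0 < sin (x d - xc).
    by apply: sin_gt0_pi; rewrite u0/=; move: (pi : R) p2 xp xc0 => p; lra.
  have sp0 : 0 < sin (x d + xc).
    by apply: sin_gt0_pi; apply/andP; split; move: (pi : R) p2 xp xc0 xc_lt u0 => p; lra.
  have [e _] := rel y0.
  have e2 : sin (x d - xc) * sin (x d + xc) = t - cos (x d) ^+ 2.
    rewrite sinB sinD -cos_xc; have := cos2Dsin2 (x d); have := cos2Dsin2 xc.
    move: (cos xc) (sin xc) (cos (x d)) (sin (x d)) => c s c1 s1 h1 h2.
    transitivity (s1 ^+ 2 * c ^+ 2 - c1 ^+ 2 * s ^+ 2); first by ring.
    have -> : s1 ^+ 2 = 1 - c1 ^+ 2 by lra.
    have -> : s ^+ 2 = 1 - c ^+ 2 by lra.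
    by ring.
  have -> : sh (y d) / y d * (sh (y d) / y d) - t * ((sh (y d) * ch (y d) - y d) / y d ^+ 3) =
      sin (x d - xc) * sin (x d + xc) / y d ^+ 2.
    by rewrite e2 e; move: (sh _) (ch _) => k g; field; rewrite gt_eqF.
  by move: (sin _) (sin _) su0 sp0 => a b a0 b0; field; rewrite !gt_eqF.
have nz : sin xc / cos xc != 0 by rewrite gt_eqF// divr_gt0.
have L2 := rcvgD (rcvgM L1 (rcvgB (rcvg_cst 1) (rcvgM Ls Lc)))
  (rcvgM (rcvgM (cvg_sin x_cvg) (cvg_cos x_cvg)) (rcvgM LP yk_cvg)).
have L3 : d / y d ^+ 2 @[d --> 0^'+] --> sin xc / cos xc.
  refine (cvg_right_near _ _ L2); last first.
    rewrite cosD -cos_xc; have := cos2Dsin2 xc; move: (cos xc) (sin xc) c0 s0 => c s c0 s0 cs.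
    have -> : 1 - 1 * (c * c - s * s) = 2 * s ^+ 2 by lra.
    by field; rewrite !gt_eqF.
  near=> d; rewrite /=.
  have y0 : 0 < y d by near: d; exact: y_gt0.
  have u0 : 0 < x d - xc by rewrite subr_gt0; near: d; exact: x_gt.
  have [_ e] := rel y0.
  have dE : d = x d - xc - sin (x d - xc) * cos (x d + xc)
      + sin (x d) * cos (x d) * (1 - y d / (sh (y d) * ch (y d))).
    have -> : sin (x d - xc) * cos (x d + xc) = sin (x d) * cos (x d) - sin xc * cos xc.
      rewrite sinB cosD; have := cos2Dsin2 (x d); have := cos2Dsin2 xc.
      move: (cos xc) (sin xc) (cos (x d)) (sin (x d)) => c s c1 s1 h1 h2.
      transitivity (s1 * c1 * (c ^+ 2 + s ^+ 2) - s * c * (c1 ^+ 2 + s1 ^+ 2)); first by ring.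
      by rewrite h1 h2 !mulr1.
    by move: e; rewrite /h; move: (sh (y d) * ch (y d))^-1 (sin (x d) * cos (x d)) => M q; lra.
  rewrite [X in _ = X / _]dE (kg y0); have [s3 c3] : 0 < sh (y d) /\ 0 < ch (y d) by rewrite sh_gt0 ?ch_gt0.
  move: (sh _) (ch _) (sin _) (cos _) (sin _) (cos _) s3 c3 => k g s1 c1 s2 c2 k0 g0.
  by field; rewrite !gt_eqF.
refine (cvg_right_near _ _ (rcvgV nz L3)); last by rewrite invf_div.
by near=> d; rewrite /= invf_div.
Unshelve. all: by end_near. Qed.

(** Here tan xc = 0, so d is of higher order than y^2. With t = 1, sin^2 x = ch y (y ch y - sh y) /
    y, so x / y tends to 1 / sqrt 3, and d / y^3 to (2/3) (3^(-3/2) + 3^(-1/2)) = 8 / (9 sqrt 3). *)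
Lemma cubic_asymptotics : xc = 0 -> y d ^+ 3 / d @[d --> 0^'+] --> 9 / (8 * Num.sqrt 3^-1).
Proof.
move=> xc0; have t1 : t = 1 by rewrite -cos_xc xc0 cos0 expr1n.
have h0 : h = 0 by rewrite /h xc0 sin0 mul0r subr0.
have Lk := comp_y (@sh_div_cvg R); have LP := comp_y (@shch_cvg R).
have LQ := comp_y (@ychsh_cvg R); have Lg := comp_y (@ch_cvg1 R).
have ue d : x d - xc = x d by rewrite xc0 subr0.
have Ls : sin (x d) / x d @[d --> 0^'+] --> (1 : R).
  by refine (cvg_right_near _ _ (comp_u (@sin_div_cvg R))) => //; near=> d; rewrite ue.
have Lx : (x d - sin (x d) * cos (x d)) / x d ^+ 3 @[d --> 0^'+] --> (2 / 3 : R).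
  by refine (cvg_right_near _ _ (comp_u (@sincos_cvg R))) => //; near=> d; rewrite ue.
have Lc : cos (x d) @[d --> 0^'+] --> (1 : R).
  by have := cvg_cos x_cvg; rewrite xc0 cos0.
have s0 : 0 < Num.sqrt 3^-1 :> R by rewrite sqrtr_gt0.
have x_pos : \forall d \near (0 : R)^'+, 0 < x d < pi / 2 /\ 0 < y d.
  near=> d; split; last by near: d; exact: y_gt0.
  apply/andP; split; last by near: d; exact: x_lt.
  by rewrite -[X in X < _]xc0; near: d; exact: x_gt.
have L1 : sin (x d) / y d @[d --> 0^'+] --> Num.sqrt 3^-1.
  have cs : {for 1 * 3^-1, continuous (@Num.sqrt R)} by exact: sqrt_continuous.
  refine (cvg_right_near _ _ (cvg_right_continuous cs (rcvgM Lg LQ))); last by rewrite mul1r.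
  near=> d; have [/andP[x0 xp] y0] : 0 < x d < pi / 2 /\ 0 < y d by near: d; exact: x_pos.
  have [e _] := rel y0.
  have sx0 : 0 < sin (x d) by apply: sin_gt0_pihalf; rewrite x0.
  rewrite -[RHS]ger0_norm ?divr_ge0 ?(ltW sx0) ?(ltW y0)// -sqrtr_sqr; congr Num.sqrt.
  rewrite expr_div_n; have -> : sin (x d) ^+ 2 = 1 - cos (x d) ^+ 2.
    by have := cos2Dsin2 (x d); lra.
  rewrite e t1; have := ch2_sh2 (y d); move: (sh _) (ch _) => k g gk.
  have -> : k ^+ 2 = g ^+ 2 - 1 by lra.
  by field; rewrite gt_eqF.
have L2 : x d / y d @[d --> 0^'+] --> Num.sqrt 3^-1.
  have nz : 1 != 0 :> R by exact: oner_neq0.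
  refine (cvg_right_near _ _ (rcvgM L1 (rcvgV nz Ls))); last by rewrite invr1 mulr1.
  near=> d; have [/andP[x0 xp] y0] : 0 < x d < pi / 2 /\ 0 < y d by near: d; exact: x_pos.
  have sx0 : 0 < sin (x d) by apply: sin_gt0_pihalf; rewrite x0.
  by move: (sin _) sx0 => s sx0; field; rewrite !gt_eqF.
have L3 : d / y d ^+ 3 @[d --> 0^'+] --> 8 * Num.sqrt 3^-1 / 9.
  refine (cvg_right_near _ _ (rcvgD (rcvgM Lx (rcvgM L2 (rcvgM L2 L2)))
    (rcvgM (rcvgM L1 Lc) (rcvgM LP yk_cvg)))); last first.
    have : Num.sqrt 3^-1 ^+ 2 = 3^-1 :> R by rewrite sqr_sqrtr.
    move: (Num.sqrt _) => s e; rewrite -expr2 e; lra.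
  near=> d; have [/andP[x0 xp] y0] : 0 < x d < pi / 2 /\ 0 < y d by near: d; exact: x_pos.
  have [_ e] := rel y0.
  have dE : d = x d - sin (x d) * cos (x d)
      + sin (x d) * cos (x d) * (1 - y d / (sh (y d) * ch (y d))).
    by move: e; rewrite h0; move: (sh (y d) * ch (y d))^-1 (sin (x d) * cos (x d)) => M q; lra.
  rewrite [X in _ = X / _]dE (kg y0); have [s3 c3] : 0 < sh (y d) /\ 0 < ch (y d) by rewrite sh_gt0 ?ch_gt0.
  move: (sh _) (ch _) (sin _) (cos _) s3 c3 => k g s1 c1 k0 g0.
  by field; rewrite !gt_eqF.
have nz : 8 * Num.sqrt 3^-1 / 9 != 0 :> R by rewrite gt_eqF// divr_gt0// mulr_gt0.
refine (cvg_right_near _ _ (rcvgV nz L3)); last by rewrite invf_div.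
by near=> d; rewrite invf_div.
Unshelve. all: by end_near. Qed.

End Edge.
End EdgeAsymptotics.

(** * The end of the arc as an angle and as an integral *)

Section EdgeConstant.
Variable R : realType.
Implicit Types sigma s : R.

(** [xc] is the arccosine of sigma / 2: then asin (sigma / 2) = pi / 2 - xc and sqrt (4 - sigma^2) =
    2 sin xc. *)
Lemma edge_param sigma : 0 < sigma -> sigma <= 2 -> exists xc : R,
  [/\ 0 <= xc, xc < pi / 2, cos xc = sigma / 2 &
      edge sigma = pi - 2 * (xc - sin xc * cos xc)].
Proof.
move=> s0 s2; pose s := sigma / 2; have s01 : -1 <= s <= 1 by rewrite /s; apply/andP; split; lra.
have cE : cos (acos s) = s by rewrite acosK// in_itv.
exists (acos s); have x0 := acos_ge0 s01.
have p2 := pihalf_ge1 R.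
have xp : acos s < pi / 2.
  rewrite ltNge; apply/negP => h; suff : s <= 0 by rewrite /s; lra.
  rewrite -cE -(@cos_pihalf R); move: h; rewrite le_eqVlt => /orP[/eqP<-//|h].
  apply/ltW/cos_mono => //; last exact: acos_lepi.
  by move: (pi : R) p2 => p; lra.
split => //; rewrite /edge -/s cE.
have asE : asin s = pi / 2 - acos s.
  have e : sin (pi / 2 - acos s) = s by rewrite -opprB sinN sinBpihalf opprK.
  rewrite -[LHS](congr1 (@asin R) e) sinK// in_itv/=.
  by move: (pi : R) p2 xp x0 => p ? ? ?; apply/andP; split; lra.
have sE : Num.sqrt (4 - sigma ^+ 2) = 2 * sin (acos s).
  rewrite sin_acos// -[2]ger0_norm// -sqrtr_sqr -sqrtrM ?sqr_ge0//; congr Num.sqrt.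
  by rewrite /s; field.
by rewrite asE sE; move: (pi : R) (acos s) (sin _) => p x k; field.
Qed.

Lemma is_derive_edge s : - 2 < s < 2 -> is_derive s (1 : R) (@edge R) (Num.sqrt (4 - s ^+ 2)).
Proof.
move=> /andP[s1 s2]; have q0 : 0 < 4 - s ^+ 2 by nra.
have d1 : is_derive s (1 : R) (fun u => 4 - u * u) (0 - (1 * s + s * 1)).
  exact: (drvB (drv_cst _ _) (drvM (drv_id s) (drv_id s))).
have d2 := is_derive1_sqrt q0.
rewrite expr2 in d2.
have d3 : is_derive (2^-1 * s) (1 : R) (@asin R) (Num.sqrt (1 - (2^-1 * s) ^+ 2))^-1.
  by apply: is_derive1_asin; apply/andP; split; lra.
apply: (@drv_ext _ (fun u => 2 * asin (2^-1 * u) + 2^-1 * (u * Num.sqrt (4 - u * u)))).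
  by move=> u; rewrite /edge [2^-1 * u]mulrC expr2; ring.
refine (drv_eq (drvD (drvZ 2 (drv_comp d3 (drvZ _ (drv_id s))))
  (drvZ _ (drvM (drv_id s) (@drv_comp _ Num.sqrt (fun u => 4 - u * u) s _ _ d2 d1)))) _).
have -> : Num.sqrt (1 - (2^-1 * s) ^+ 2) = Num.sqrt (4 - s ^+ 2) / 2.
  rewrite -[2 in RHS]ger0_norm// -sqrtr_sqr -sqrtrV ?sqr_ge0// -sqrtrM ?(ltW q0)//.
  by congr Num.sqrt; field.
rewrite -expr2; have k0 : 0 < Num.sqrt (4 - s ^+ 2) by rewrite sqrtr_gt0.
have k2 : Num.sqrt (4 - s ^+ 2) ^+ 2 = 4 - s ^+ 2 by rewrite sqr_sqrtr// ltW.
move: (Num.sqrt _) k0 k2 => k k0 k2.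
apply: (mulIf (lt0r_neq0 k0)); rewrite -[RHS]expr2 k2.
transitivity (2 + (k ^+ 2 - s ^+ 2) / 2); first by field; rewrite gt_eqF.
by rewrite k2; field.
Qed.

Lemma edge_integral sigma : 0 < sigma -> sigma < 2 ->
  edge sigma = \int[lebesgue_measure]_(t in `[0, sigma]) Num.sqrt (4 - t ^+ 2).
Proof.
move=> s0 s2.
have dE s : 0 <= s <= sigma -> is_derive s (1 : R) (@edge R) (Num.sqrt (4 - s ^+ 2)).
  by move=> /andP[? ?]; apply: is_derive_edge; apply/andP; split; lra.
rewrite /Rintegral (@continuous_FTC2 _ _ (@edge R))//.
- rewrite -EFinB (_ : edge 0 = 0) ?subr0// /edge !mul0r addr0.
  rewrite -[X in asin X](@sin0 R) sinK ?mulr0// in_itv/=.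
  by have := pihalf_ge1 R; move: (pi : R) => p ?; apply/andP; split; lra.
- apply: continuous_subspaceT => x; apply: continuous_comp; last exact: sqrt_continuous.
  by apply: cvgB; [exact: cvg_cst|exact: exprn_continuous].
- by apply: (derivable_LR (ltW s0) dE).
move=> x; rewrite in_itv/= => /andP[x0 x1]; rewrite derive1E.
by apply: (@derive_val _ _ _ _ _ _ _ (dE x _)); rewrite !ltW.
Qed.
End EdgeConstant.

(** * Support, positivity and edge behaviour of the density *)

Section DensityShape.
Variables (R : realType) (t : R) (zeta : R[i] -> R[i]).
Hypothesis t0 : 0 < t.
Hypothesis hz : is_zeta t zeta.
Implicit Types (x d : R).

Local Notation f := (fun_dens t zeta).

Lemma fun_dens_gt0 x : 0 < Im (zeta ((x - pi) / 2)%:C) -> 0 < f x.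
Proof. by move=> y0; rewrite mulr_gt0// divr_gt0// !mulr_gt0// pi_gt0. Qed.

Lemma half_right : d / 2 @[d --> (0 : R)^'+] --> (0 : R)^'+.
Proof.
apply: cvg_right_pos.
  refine (cvg_right_near _ _ (rcvgM (@cvg_right_id R) (rcvg_cst 2^-1))); last by rewrite mul0r.
  by near=> d.
by near=> d; rewrite divr_gt0//; near: d; exact: nbhs_right_gt.
Unshelve. all: by end_near. Qed.

Section Support.
Variable xc : R.
Hypothesis xc_ge0 : 0 <= xc.
Hypothesis xc_lt : xc < pi / 2.
Hypothesis cos_xc : cos xc ^+ 2 = t.
Let h := xc - sin xc * cos xc.
Let m : R := pi - 2 * h.

(** The density sees half the angle, so distance [d] from the end of the arc becomes [d / 2] from
    the edge [h] of zeta; evenness of Im zeta puts it to the right of [h]. *)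
Lemma fun_dens_edge d : f (m - d) = 2 / (pi * (4 * t)) * Im (zeta (h + d / 2)%:C).
Proof.
rewrite /fun_dens (_ : (m - d - pi) / 2 = - (h + d / 2)).
  by rewrite (Im_zeta_opp t0 hz).
by rewrite /m; move: (pi : R) h => p h'; field.
Qed.

Lemma fun_dens_inside x : - m < x < m -> 0 < f x /\ analytic_at f x.
Proof.
move=> /andP[x1 x2]; have y0 : 0 < Im (zeta ((x - pi) / 2)%:C).
  rewrite -(Im_zeta_opp t0 hz); apply: (Im_zeta_gt0 t0 hz xc_ge0 xc_lt cos_xc).
  by move: x1 x2; rewrite /m -/h; move: (pi : R) h => p h' ? ?; apply/andP; split; lra.
by split; [exact: fun_dens_gt0|exact: fun_dens_analytic].
Qed.

Lemma fun_dens_outside x : m <= x <= pi -> f x = 0.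
Proof.
move=> /andP[x1 x2]; rewrite /fun_dens (Im_zeta_eq0 t0 hz xc_ge0 xc_lt cos_xc) ?mulr0//.
have := edge_ge0 xc_ge0.
by move: x1 x2; rewrite /m -/h; move: (pi : R) h => p h' ? ? ?; apply/andP; split; lra.
Qed.

Lemma edge_le_pi : m <= pi.
Proof. by have := edge_ge0 xc_ge0; rewrite /m -/h; move: (pi : R) h => p h' ?; lra. Qed.

Lemma edge_gt0 : 0 < m.
Proof. by have := edge_lt xc_ge0 xc_lt; rewrite /m -/h; move: (pi : R) h => p h' ?; lra. Qed.

Lemma fun_dens_outside_abs x : - pi <= x <= pi -> ~~ (- m < x < m) -> f x = 0.
Proof.
move=> /andP[x1 x2]; rewrite negb_and -!leNgt => /orP[xm|xm]; last first.
  by apply: fun_dens_outside; rewrite xm.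
by rewrite -(fun_densN t0 hz); apply: fun_dens_outside; apply/andP; split; lra.
Qed.

Lemma cos_gt0_edge : 0 < cos xc.
Proof.
apply: cos_gt0_pihalf; rewrite xc_lt andbT; have := pihalf_ge1 R; move: xc_ge0.
by move: (pi : R) => p; lra.
Qed.

(** The fourth power of the quotient removes both roots and equals (y^2 / (e / 2))^2 tan^2 xc. *)
Lemma fun_dens_sqrt (s : R) : 0 < xc -> s = 2 * cos xc ->
  sim_right0 (fun e => f (m - e)) (fun e => 1 / (pi * s ^+ 2)
    * (4 * s ^+ 2 / (4 - s ^+ 2)) `^ (4^-1) * Num.sqrt e).
Proof.
move=> xc0 sE; have c0 := cos_gt0_edge.
have s0 : 0 < sin xc by apply: sin_gt0_pihalf; rewrite xc0.
have L0 := cvg_comp _ _ half_right (sqrt_asymptotics t0 hz xc_ge0 xc_lt cos_xc xc0).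
have E : 4 * s ^+ 2 / (4 - s ^+ 2) = (2 * cos xc / sin xc) ^+ 2.
  have -> : 4 - s ^+ 2 = 4 * sin xc ^+ 2 by rewrite sE; have := cos2Dsin2 xc; lra.
  by rewrite sE; move: (cos _) (sin _) s0 => c k k0; field; rewrite gt_eqF.
rewrite E /sim_right0; set A := _ `^ _.
have A0 : 0 < A by apply: powR_gt0; rewrite exprn_gt0// divr_gt0// mulr_gt0.
have A4 : A ^+ 4 = (2 * cos xc / sin xc) ^+ 2.
  by rewrite -powR_mulrn ?(ltW A0)// /A -powRrM mulVf ?powRr1// sqr_ge0.
clearbody A; apply: (@cvg1_root _ 3).
  near=> e; have e0 : 0 < e by near: e; exact: nbhs_right_gt.
  have := fun_dens_ge0 t0 hz (m - e) => f0.
  by rewrite divr_ge0// !mulr_ge0 ?sqrtr_ge0 ?(ltW A0)// invr_ge0 mulr_ge0 ?pi_ge0 ?sqr_ge0.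
refine (cvg_right_near _ _ (rcvgM (rcvgM L0 L0) (rcvg_cst ((sin xc / cos xc) ^+ 2)))); last first.
  by move: (cos xc) (sin xc) c0 s0 => c k c0' k0'; field; rewrite !gt_eqF.
near=> e; have e0 : 0 < e by near: e; exact: nbhs_right_gt.
rewrite fun_dens_edge /= -cos_xc sE -/h; set y := Im _.
have q0 : 0 < Num.sqrt e by rewrite sqrtr_gt0.
have q4 : Num.sqrt e ^+ 4 = e ^+ 2 by rewrite (exprM _ 2 2) sqr_sqrtr// ltW.
have p0 := pi_gt0 R.
have -> : 2 / (pi * (4 * cos xc ^+ 2)) * y / (1 / (pi * (2 * cos xc) ^+ 2) * A * Num.sqrt e) =
    2 * y / (A * Num.sqrt e).
  clearbody y; move: (pi : R) (Num.sqrt e) (cos xc) p0 q0 c0 => p q c p0' q0' c0'.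
  by field; rewrite !gt_eqF.
rewrite [RHS]expr_div_n !exprMn A4 q4; clearbody y; move: (cos xc) (sin xc) c0 s0 => c k c0' k0'.
by field; rewrite !gt_eqF.
Unshelve. all: by end_near. Qed.

(** The cube of the quotient equals y^3 / (e / 2) times 8 / (9 sqrt 3). *)
Lemma fun_dens_cubic : xc = 0 ->
  sim_right0 (fun e => f (pi - e))
    (fun e => Num.sqrt 3 / (4 * pi) * (3 * e / 2) `^ (3^-1)).
Proof.
move=> xc0.
have L0 := cvg_comp _ _ half_right (cubic_asymptotics t0 hz xc_ge0 xc_lt cos_xc xc0).
have t1 : t = 1 by rewrite -cos_xc xc0 cos0 expr1n.
have mE : m = pi by rewrite /m /h xc0 sin0 mul0r subr0 mulr0 subr0.
have r0 : 0 < Num.sqrt 3 :> R by rewrite sqrtr_gt0.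
have r2 : Num.sqrt 3 ^+ 2 = 3 :> R by rewrite sqr_sqrtr.
have rV : Num.sqrt 3^-1 = (Num.sqrt 3)^-1 :> R by rewrite sqrtrV.
rewrite rV in L0; rewrite /sim_right0; apply: (@cvg1_root _ 2).
  near=> e; have e0 : 0 < e by near: e; exact: nbhs_right_gt.
  have := fun_dens_ge0 t0 hz (pi - e) => f0.
  by rewrite divr_ge0// mulr_ge0 ?powR_ge0// divr_ge0 ?sqrtr_ge0// mulr_ge0// pi_ge0.
refine (cvg_right_near _ _ (rcvgM L0 (rcvg_cst (8 / (9 * Num.sqrt 3))))); last first.
  by move: (Num.sqrt 3) r0 r2 => r r0 r2; field; rewrite gt_eqF.
near=> e; have e0 : 0 < e by near: e; exact: nbhs_right_gt.
rewrite -mE fun_dens_edge /= t1 -/h; set y := Im _; set D := _ `^ _.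
have e3 : 0 < 3 * e / 2 by rewrite divr_gt0// mulr_gt0.
have D0 : 0 < D by exact: powR_gt0.
have D3 : D ^+ 3 = 3 * e / 2 by rewrite -powR_mulrn ?(ltW D0)// /D -powRrM mulVf ?powRr1// ltW.
rewrite mE; have p0 := pi_gt0 R.
have -> : 2 / (pi * (4 * 1)) * y / (Num.sqrt 3 / (4 * pi) * D) = 2 * y / (Num.sqrt 3 * D).
  clearbody y D; move: (pi : R) (Num.sqrt 3) p0 r0 => p q p0' q0'.
  by field; rewrite !gt_eqF.
rewrite [RHS]expr_div_n !exprMn D3; have -> : Num.sqrt 3 ^+ 3 = 3 * Num.sqrt 3 :> R by rewrite exprSr r2.
by clearbody y; move: (Num.sqrt 3) r0 => r r0'; field; rewrite !gt_eqF.
Unshelve. all: by end_near. Qed.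

End Support.

Lemma fun_dens_supercritical x : 1 < t -> 0 < f x /\ analytic_at f x.
Proof.
move=> t1; have y0 := Im_zeta_gt0_supercritical t0 hz ((x - pi) / 2) t1.
by split; [exact: fun_dens_gt0|exact: fun_dens_analytic].
Qed.

End DensityShape.

(** * The three regimes of sigma *)

Theorem theorem2p18 (R : realType) (sigma : R) (zeta : R[i] -> R[i])
    (mu : probability (circle R) R) :
  0 < sigma ->
  is_zeta (sigma ^+ 2 / 4) zeta ->
  free_unitary_normal (sigma ^+ 2) mu ->
  exists f : circle R -> R,
    [/\ is_density mu f,
        (forall theta : R, - pi <= theta < pi ->
           f (cis theta) =
           2 / (pi * sigma ^+ 2) * complex.Im (zeta ((theta - pi) / 2)%:C)) &
        (forall theta : R, f (cis theta) = f (cis (- theta)))] /\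
    [/\ (4 < sigma ^+ 2 ->
           forall theta : R,
             0 < f (cis theta) /\ analytic_at (fun x : R => f (cis x)) theta),
        (sigma ^+ 2 < 4 ->
           [/\ {within `[- pi, pi], continuous (fun theta : R => f (cis theta))},
               (forall theta : R, - edge sigma < theta < edge sigma ->
                  0 < f (cis theta) /\
                  analytic_at (fun x : R => f (cis x)) theta),
               (forall theta : R, - pi <= theta <= pi ->
                  ~~ (- edge sigma < theta < edge sigma) ->
                  f (cis theta) = 0),
               edge sigma =
                 \int[lebesgue_measure]_(t in `[0, sigma])
                   Num.sqrt (4 - t ^+ 2) &
               [/\ f (cis (edge sigma)) = 0,
                   f (cis (- edge sigma)) = 0,
                   (forall e : R, 0 < e ->
                      f (cis (edge sigma - e)) = f (cis (e - edge sigma))) &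
                   sim_right0 (fun e => f (cis (edge sigma - e)))
                     (fun e =>
                        1 / (pi * sigma ^+ 2)
                        * (4 * sigma ^+ 2 / (4 - sigma ^+ 2)) `^ (4^-1)
                        * Num.sqrt e)]]) &
        (sigma ^+ 2 = 4 ->
           [/\ (forall theta : R, - pi < theta < pi ->
                  0 < f (cis theta) /\
                  analytic_at (fun x : R => f (cis x)) theta),
               f (cis pi) = 0,
               f (cis (- pi)) = 0,
               (forall e : R, 0 < e ->
                  f (cis (pi - e)) = f (cis (e - pi))) &
               sim_right0 (fun e => f (cis (pi - e)))
                 (fun e => Num.sqrt 3 / (4 * pi) * (3 * e / 2) `^ (3^-1))])].

Proof.
move=> s0 hz hmu; set t := sigma ^+ 2 / 4 in hz.
have t4 : 4 * t = sigma ^+ 2 by rewrite /t; field.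
have t0 : 0 < t by rewrite divr_gt0// exprn_gt0.
rewrite -t4 in hmu; have [f [fd fE]] := density_exists t0 hz hmu.
have fF : (fun x => f (cis x)) = fun_dens t zeta by apply/funext.
have fN x : f (cis (- x)) = f (cis x) by rewrite !fE (fun_densN t0 hz).
have fS x y : f (cis (x - y)) = f (cis (y - x)) by rewrite -fN opprB.
(* One parameter [xc] describes both regimes sigma <= 2: it is positive for sigma < 2 and 0 for
   sigma = 2. *)
have par : sigma <= 2 -> exists xc, [/\ 0 <= xc, xc < pi / 2, cos xc ^+ 2 = t,
    sigma = 2 * cos xc & edge sigma = pi - 2 * (xc - sin xc * cos xc)].
  move=> /(edge_param s0)[xc [h1 h2 h3 h4]]; exists xc; split => //.
    by rewrite h3 /t; field.
  by rewrite h3; field.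
exists f; split.
  split => // theta; rewrite fE /fun_dens t4//.
split.
- by move=> s4 theta; rewrite fF fE; apply: (fun_dens_supercritical t0 hz); rewrite /t; lra.
- move=> s4; have s2 : sigma < 2 by rewrite -(@ltr_pXn2r _ 2) ?nnegrE ?(ltW s0)//; lra.
  have [xc [h1 h2 h3 h4 eE]] := par (ltW s2).
  have xc0 : 0 < xc.
    rewrite lt_neqAle h1 andbT; apply/eqP => e; move: s2.
    by rewrite h4 -e cos0 mulr1 ltxx.
  rewrite eE; have m0 := edge_gt0 h1 h2; have mp := edge_le_pi h1.
  split.
  + by rewrite fF; apply: continuous_subspaceT; exact: fun_dens_continuous.
  + by move=> theta; rewrite fF fE => ?; exact: (fun_dens_inside t0 hz h1 h2 h3).
  + by move=> theta; rewrite fE => ? ?; exact: (fun_dens_outside_abs t0 hz h1 h2 h3).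
  + by rewrite -eE; exact: edge_integral.
  have e0 : f (cis (pi - 2 * (xc - sin xc * cos xc))) = 0.
    by rewrite fE; apply: (fun_dens_outside t0 hz h1 h2 h3); rewrite lexx.
  split => //; first by rewrite fN.
  have -> : (fun e => f (cis (pi - 2 * (xc - sin xc * cos xc) - e))) =
      (fun e => fun_dens t zeta (pi - 2 * (xc - sin xc * cos xc) - e)) by apply/funext.
  exact: (fun_dens_sqrt t0 hz h1 h2 h3).
move=> s4; have s2 : sigma = 2.
  by apply/eqP; rewrite -(@eqrXn2 _ 2) ?(ltW s0)// s4; apply/eqP; ring.
have [|xc [h1 h2 h3 h4 eE]] := par; first by rewrite s2.
have xc0 : xc = 0.
  apply/eqP; rewrite eq_le h1 andbT leNgt; apply/negP => x0.
  have := cos_mono (lexx 0) x0; rewrite cos0.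
  have -> : cos xc = 1 by lra.
  by rewrite ltxx => /(_ _)/negP; apply => //; have := pihalf_ge1 R; move: (pi : R) h2 => p; lra.
have e0 : f (cis pi) = 0.
  by rewrite fE; apply: (fun_dens_outside t0 hz h1 h2 h3); rewrite xc0 sin0 mul0r subr0 mulr0 subr0 !lexx.
split => //.
- move=> theta; rewrite fF fE => ?; apply: (fun_dens_inside t0 hz h1 h2 h3).
  by rewrite xc0 sin0 mul0r subr0 mulr0 subr0.
- by rewrite fN.
have -> : (fun e => f (cis (pi - e))) = (fun e => fun_dens t zeta (pi - e)) by apply/funext.
exact: (fun_dens_cubic t0 hz h1 h2 h3).
Qed.
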